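(* Let $H=\operatorname{SL}_2(\mathbb{C})$, let $V$ be a finite-dimensional $H$-module with $V^H=(0)$, and let $v\in V$. Then the subgroup $G\subset\operatorname{Aff}(V)$ of affine transformations preserving $Hv$ is contained in $\operatorname{GL}(V)$.
   Context: $\operatorname{Aff}(V)=\operatorname{GL}(V)\ltimes V$ is the group of affine transformations $x\mapsto Ax+c$ of $V$. *)

(* Defs.v *)
From HB Require Import structures.
From mathcomp Require Import all_boot all_order all_algebra.
From mathcomp Require Import complex.
From mathcomp Require Import Rstruct.
Set Implicit Arguments. Unset Strict Implicit. Unset Printing Implicit Defensive.
Import Order.TTheory GRing.Theory Num.Theory.
Local Open Scope ring_scope.

Definition C : numClosedFieldType := (Rdefinitions.R)[i].

Definition inSL2 (A : 'M[C]_2) : Prop := \det A = 1.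

Definition polyfun_M2 (d : nat) (c : {ffun ('I_2 * 'I_2) -> 'I_d} -> C)
  (A : 'M[C]_2) : C :=
  \sum_(e : {ffun ('I_2 * 'I_2) -> 'I_d})
     c e * \prod_(kl : 'I_2 * 'I_2) (A kl.1 kl.2) ^+ (e kl).

(* rho : SL_2(C) -> GL_n(C) is a rational (algebraic) representation, i.e. a
   finite-dimensional SL_2(C)-module structure on V = C^n (column vectors):
   a group homomorphism on SL_2 whose matrix coefficients are regular functions
   (restrictions of polynomials in the entries). *)
Definition rational_rep_SL2 (n : nat) (rho : 'M[C]_2 -> 'M[C]_n) : Prop :=
  [/\ rho 1%:M = 1%:M,
      (forall A B, inSL2 A -> inSL2 B -> rho (A *m B) = rho A *m rho B)
    & exists d (c : 'I_n -> 'I_n -> {ffun ('I_2 * 'I_2) -> 'I_d} -> C),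
        forall A, inSL2 A -> forall i j, rho A i j = polyfun_M2 (c i j) A].

Definition no_invariants (n : nat) (rho : 'M[C]_2 -> 'M[C]_n) : Prop :=
  forall x : 'cV[C]_n, (forall A, inSL2 A -> rho A *m x = x) -> x = 0.

Definition orbit_SL2 (n : nat) (rho : 'M[C]_2 -> 'M[C]_n) (v : 'cV[C]_n)
  (y : 'cV[C]_n) : Prop :=
  exists2 A, inSL2 A & y = rho A *m v.

Definition affine_map (n : nat) (M : 'M[C]_n) (c : 'cV[C]_n) (x : 'cV[C]_n)
  : 'cV[C]_n := M *m x + c.

Definition preserves (n : nat) (M : 'M[C]_n) (c : 'cV[C]_n)
  (S : 'cV[C]_n -> Prop) : Prop :=
  forall y, S y <-> exists2 x, S x & y = affine_map M c x.

(* Main.v *)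
(* Let f(x) = Mx + c preserve the orbit Hv.  For A in sl_2 the vector field
   Y_A(x) = M^-1 A (Mx + c), conjugate by f to the linear field A, is tangent to Hv.
   The stabilizer of v in sl_2 is, up to conjugation, 0, C H or C E (or sl_2, when v = 0).
   - Stabilizer 0: the fields Y_A form a frame on SL_2, with respect to the left invariant
     frame; its determinant has no zero, hence is constant, since SL_2 has no nonconstant
     units.  With the bracket relations this makes Y_A divergence free, so the average
     over the compact form of the function Y_A(x), x = gv, vanishes.  As the average of
     x is invariant, hence 0, this average is M^-1 A c.  So c is invariant and c = 0.
   - Stabilizer C H: the same, the frame determinant being replaced by the discriminant of
     the kernel of A |-> Y_A(x), which is conjugate to C H and so never nilpotent.
   - Stabilizer C E: v is a sum of highest weight vectors v_m, m >= k >= 1, v_k <> 0, and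
     diag(z, 1/z) v = sum_m z^m v_m extends by 0 to z = 0.  Tangency in the limit z -> 0
     shows that the orbit of M^-1 A c lies in the span of v_k and F v_k, which contains no
     nonzero subrepresentation if k >= 2, so that A c = 0.  If k = 1, the orbit map
     factors as gv = Q(g e_1) with Q polynomial on C^2, and the projection to the weight 1
     component recovers g e_1 from gv.  Hence z |-> f(diag(z, 1/z) v) is Q of a polynomial
     curve in C^2, and z = 0 gives c = Q(p): either p = 0 and c = 0, or c lies in Hv, which
     is impossible because f^-1(c) = 0 does not.
   Tangency is obtained without algebraic geometry, from the Jacobian of an algebraically
   dependent family of polynomials, and the average is replaced by an explicit functional
   on polynomials in the matrix entries. *)
Require Import Defs.
From HB Require Import structures.
From mathcomp Require Import all_boot all_order all_algebra.
From mathcomp Require Import complex.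
From mathcomp Require Import Rstruct.
From mathcomp Require Import ssrcomplements mpoly ring zify.
From mathcomp Require boolp.
Set Implicit Arguments. Unset Strict Implicit. Unset Printing Implicit Defensive.
Import Order.TTheory GRing.Theory Num.Theory.
Local Open Scope ring_scope.

(** * Polynomials *)

(** The coordinate ring of SL_2 is never formed: functions are polynomials in the four matrix
    entries, compared by [eqSL], that is by their values where the determinant is 1. Everything
    infinitesimal is reduced to lines t |-> g(1 + tB) with B nilpotent, which stay inside SL_2 and
    along which every function is a polynomial in t. Since nilpotents span sl_2, this shows that
    traceless derivations respect [eqSL], and that they kill a function without zeros on SL_2, a
    polynomial without roots being constant. The vanishing divergence has this source: the
    derivative along Y_A of the determinant of the fields is the divergence of Y_A times the
    determinant, plus the terms in which one field is replaced by its bracket with Y_A. These add up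
    to a multiple of the trace of ad A, which is 0, and the determinant is a nonzero constant.
    Weight 1 has to be treated apart because the span of v_1 and F v_1 is then a subrepresentation,
    and the tangent limit no longer forces A c = 0. *)

Lemma mpoly_ring_ind n (R : comNzRingType) (P : {mpoly R[n]} -> Prop) :
  (forall c, P c%:MP) -> (forall i, P 'X_i) ->
  (forall p q, P p -> P q -> P (p + q)) ->
  (forall p q, P p -> P q -> P (p * q)) -> forall p, P p.
Proof.
move=> PC PX PD PM; elim/mpolyind => [|c m p _ _ Pp]; first by rewrite -mpolyC0.
apply: PD => //; rewrite -mul_mpolyC; apply: (PM) => //.
rewrite mpolyXE_id; apply: big_ind => [||i _]; rewrite -?mpolyC1 //.
by elim: (m i) => [|k IH]; rewrite ?expr0 -?mpolyC1 // exprS; apply: PM.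
Qed.

Lemma mmap_chain (R S : comNzRingType) (f : {rmorphism R -> S})
    (d : {additive S -> S}) n (h : 'I_n -> S) (p : {mpoly R[n]}) :
  (forall x y, d (x * y) = d x * y + x * d y) -> (forall c, d (f c) = 0) ->
  d (mmap f h p) = \sum_i mmap f h p^`M(i) * d (h i).
Proof.
move=> dM dC; elim/mpoly_ring_ind: p => [c|i|p q Hp Hq|p q Hp Hq].
- rewrite mmapC dC big1 // => i _.
  by rewrite mderivC mmap0 mul0r.
- rewrite mmapX mmap1U (bigD1 i) //= big1 => [|j /negPf ji].
    by rewrite mderivX mnm1E eqxx scale1r -{1}[U_(i)%MM]add0m addmK mpolyX0 rmorph1 mul1r addr0.
  by rewrite mderivX mnm1E eq_sym ji scale0r mmap0 mul0r.
- rewrite !raddfD /= Hp Hq -big_split /=; apply: eq_bigr => i _.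
  by rewrite mderivD mmapD mulrDl.
- rewrite rmorphM /= dM Hp Hq mulr_suml mulr_sumr -big_split /=.
  apply: eq_bigr => i _; rewrite mderivM mmapD !rmorphM /=.
  by rewrite mulrDl; ring.
Qed.

Section Line.
Context (K : numClosedFieldType) (n : nat).
Implicit Types (p q : {mpoly K[n]}) (u w : 'I_n -> K).

Definition mcomp_poly (h : 'I_n -> {poly K}) p : {poly K} := mmap (@polyC K) h p.

Lemma horner_mcomp_poly h p t :
  (mcomp_poly h p).[t] = p.@[fun i => (h i).[t]].
Proof.
rewrite /mcomp_poly; elim/mpoly_ring_ind: p => [c|i|p q Hp Hq|p q Hp Hq].
- by rewrite mmapC hornerC mevalC.
- by rewrite mmapX mmap1U mevalXU.
- by rewrite mmapD hornerD Hp Hq mevalD.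
- by rewrite rmorphM hornerM Hp Hq mevalM.
Qed.

Lemma deriv_mcomp_poly h p :
  (mcomp_poly h p)^`() = \sum_i mcomp_poly h p^`M(i) * (h i)^`().
Proof.
by apply: (mmap_chain (d := deriv)) => [x y|c]; [exact: derivM | exact: derivC].
Qed.

Definition mline u w p : {poly K} :=
  mcomp_poly (fun i => (u i)%:P + w i *: 'X) p.

Lemma horner_mline u w p t : (mline u w p).[t] = p.@[fun i => u i + t * w i].
Proof.
rewrite horner_mcomp_poly; apply: meval_eq => i.
by rewrite !hornerE mulrC.
Qed.

Lemma deriv_mline u w p t :
  (mline u w p)^`().[t] = \sum_i w i * p^`M(i).@[fun i => u i + t * w i].
Proof.
rewrite deriv_mcomp_poly horner_sum; apply: eq_bigr => i _.
rewrite hornerM horner_mcomp_poly derivD derivC add0r derivZ derivX hornerZ hornerC mulr1 mulrC.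
by congr (_ * _); apply: meval_eq => j; rewrite !hornerE mulrC.
Qed.

End Line.

(** * Polynomial identities from values *)

Section Infinite.
Context (K : numClosedFieldType).

Lemma poly_nz_ext (p q : {poly K}) :
  (forall z, z != 0 -> p.[z] = q.[z]) -> p = q.
Proof.
move=> H; apply/eqP; rewrite -subr_eq0; apply/negP => /negP nz.
(* The points 1, ..., [size (p - q)]: nonzero, distinct in characteristic 0, and too many to be
   roots. *)
pose s := [seq i.+1%:R : K | i <- iota 0 (size (p - q))].
have /(max_poly_roots nz) : all (root (p - q)) s.
  apply/allP => _ /mapP[i _ ->]; rewrite rootE hornerD hornerN H ?subrr //.
  by rewrite pnatr_eq0.
rewrite size_map size_iota ltnn => us; suff: false by []; apply: us.
rewrite map_inj_uniq ?iota_uniq // => i j /eqP.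
by rewrite eqr_nat eqSS => /eqP.
Qed.

Lemma poly_ext (p q : {poly K}) : (forall z, p.[z] = q.[z]) -> p = q.
Proof. by move=> H; apply: poly_nz_ext. Qed.

Lemma poly_no_root (p : {poly K}) : (forall z, p.[z] != 0) -> p^`() = 0.
Proof.
move=> H; case: (boolP (size p == 1)%N) => [|/closed_rootP[z]].
  by case/size_poly1P => c _ ->; rewrite derivC.
by rewrite rootE (negPf (H z)).
Qed.

Lemma mderiv_eq0_const n (p : {mpoly K[n]}) :
  (forall i, p^`M(i) = 0) -> p = (p@_0)%:MP.
Proof.
move=> H; apply/mpolyP => m; rewrite mcoeffC.
have [->|m0] := eqVneq m 0%MM; first by rewrite mulr1.
rewrite mulr0.
have [i mi] : exists i, m i != 0%N.
  apply/existsP; apply: contraNT m0; rewrite negb_exists => /forallP m0.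
  by apply/eqP/mnmP => i; rewrite mnm0E; apply/eqP; have := m0 i; rewrite negbK.
have := congr1 (mcoeff (m - U_(i))%MM) (H i).
rewrite mcoeff_deriv mcoeff0 submK; last first.
  by apply/mnm_lepP => j; rewrite mnm1E; case: eqP => // <-; rewrite lt0n.
by move/eqP; rewrite mulrn_eq0 /= => /eqP.
Qed.

Lemma msize_mderiv n (p : {mpoly K[n]}) i :
  p != 0 -> (msize p^`M(i) < msize p)%N.
Proof.
move=> p0; rewrite msizeE; rewrite -[X in (_ < X)%N]prednK ?lt0n ?msize_poly_eq0 //.
rewrite ltnS; apply/bigmax_leqP_seq => m /[!mcoeff_msupp] + _.
rewrite mcoeff_deriv mulrn_eq0 /= -mcoeff_msupp => /msize_mdeg_lt.
by rewrite mdegD mdeg1 addn1 ltn_predRL.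
Qed.

Lemma meval_ext0 n (p : {mpoly K[n]}) : (forall u, p.@[u] = 0) -> p = 0.
Proof.
have [k] := ubnP (msize p); elim: k p => // k IH p szp Hp.
have Hd i : p^`M(i) = 0.
  have Hdi u : p^`M(i).@[u] = 0.
    have := deriv_mline u (fun j => (j == i)%:R) p 0.
    rewrite (_ : mline _ _ _ = 0); last first.
      by apply: poly_ext => t; rewrite horner_mline Hp horner0.
    rewrite deriv0 horner0 (bigD1 i) //= eqxx mul1r big1 ?addr0 => [->|j /negPf ->].
      by apply: meval_eq => j; rewrite mul0r addr0.
    by rewrite mul0r.
  have [->|p0] := eqVneq p 0; first by rewrite mderiv0.
  by apply: IH => //; rewrite ltnS in szp; apply: leq_trans szp; apply: msize_mderiv.
rewrite (mderiv_eq0_const Hd); move: (Hp (fun=> 0)).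
by rewrite {1}(mderiv_eq0_const Hd) mevalC => ->; rewrite mpolyC0.
Qed.

(** Multiplying by a high power of z clears the negative exponents. The exponents [e x] may repeat,
    so it is the total coefficient of z^k that vanishes. *)
Lemma laurent_coef (T : eqType) (r : seq T) (c : T -> K) (e : T -> int) k :
  (forall z, z != 0 -> \sum_(x <- r) c x * z ^ (e x) = 0) ->
  \sum_(x <- r | e x == k) c x = 0.
Proof.
move=> H.
pose N := (\sum_(x <- r) `|e x| + `|k|)%N.
have NP (y : int) : (`|y| <= N)%N -> 0 <= N%:Z + y by lia.
have N0 x : x \in r -> 0 <= N%:Z + e x.
  by move=> xr; apply: NP; rewrite /N (big_rem x) //= -addnA leq_addr.
have N1 : 0 <= N%:Z + k by apply: NP; rewrite leq_addl.
pose q := \sum_(x <- r) c x *: 'X^(absz (N%:Z + e x)) : {poly K}.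
have q0 : q = 0.
  apply: poly_nz_ext => z z0; rewrite horner0 horner_sum.
  transitivity (z ^+ N * \sum_(x <- r) c x * z ^ (e x)); last by rewrite H ?mulr0.
  rewrite mulr_sumr big_seq [RHS]big_seq; apply: eq_bigr => x xr.
  rewrite hornerZ hornerXn mulrCA; congr (_ * _).
  have -> : z ^+ (absz (N%:Z + e x)) = z ^ (N%:Z + e x).
    by rewrite -{2}(gez0_abs (N0 _ xr)).
  by rewrite expfzDr.
have := congr1 (fun p : {poly K} => p`_(absz (N%:Z + k))) q0.
rewrite coef0 coef_sum => q0k; rewrite -[RHS]q0k big_mkcond [LHS]big_seq [RHS]big_seq.
apply: eq_bigr => x xr; rewrite coefZ coefXn.
have -> : (absz (N%:Z + k) == absz (N%:Z + e x)) = (e x == k).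
  rewrite -(inj_eq (@addrI _ N%:Z)) -[in RHS](gez0_abs N1) -[in RHS](gez0_abs (N0 _ xr)).
  by rewrite eqz_nat eq_sym.
by case: eqP; rewrite ?mulr1 ?mulr0.
Qed.

End Infinite.

(** * Invariant derivations on SL_2 *)

Section Mat2.
Context (R : comNzRingType).
Implicit Types a b c d : R.

Definition mk2 a b c d : 'M[R]_2 :=
  \matrix_(i, j) if i == 0 then (if j == 0 then a else b)
                 else (if j == 0 then c else d).

Lemma ord2P (P : 'I_2 -> Prop) : P 0 -> P 1 -> forall i, P i.
Proof.
by move=> P0 P1 [[|[|//]] lti]; [have -> : Ordinal lti = 0 | have -> : Ordinal lti = 1];
  rewrite //; apply: val_inj.
Qed.

Lemma mx2P (A B : 'M[R]_2) :
  A 0 0 = B 0 0 -> A 0 1 = B 0 1 -> A 1 0 = B 1 0 -> A 1 1 = B 1 1 -> A = B.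
Proof.
by move=> *; apply/matrixP; apply: ord2P; apply: ord2P.
Qed.

Lemma mk2_eta (A : 'M[R]_2) : A = mk2 (A 0 0) (A 0 1) (A 1 0) (A 1 1).
Proof. by apply: mx2P; rewrite mxE. Qed.

Lemma mk2M a b c d a' b' c' d' : mk2 a b c d *m mk2 a' b' c' d' =
  mk2 (a * a' + b * c') (a * b' + b * d') (c * a' + d * c') (c * b' + d * d').
Proof. by apply: mx2P; rewrite !mxE big_ord_recl big_ord1 !mxE. Qed.

Lemma mk2D a b c d a' b' c' d' :
  mk2 a b c d + mk2 a' b' c' d' = mk2 (a + a') (b + b') (c + c') (d + d').
Proof. by apply: mx2P; rewrite !mxE. Qed.

Lemma mk2N a b c d : - mk2 a b c d = mk2 (- a) (- b) (- c) (- d).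
Proof. by apply: mx2P; rewrite !mxE. Qed.

Lemma mk2Z k a b c d : k *: mk2 a b c d = mk2 (k * a) (k * b) (k * c) (k * d).
Proof. by apply: mx2P; rewrite !mxE. Qed.

Lemma mk2_1 k : k%:M = mk2 k 0 0 k.
Proof. by apply: mx2P; rewrite !mxE. Qed.

Lemma det_mk2 a b c d : \det (mk2 a b c d) = a * d - b * c.
Proof.
rewrite (expand_det_row _ 0) big_ord_recl big_ord1 /cofactor !det_mx11 !mxE /=.
by rewrite expr0 expr1 mulN1r mulrN mul1r.
Qed.

Lemma tr_mk2 a b c d : \tr (mk2 a b c d) = a + d.
Proof. by rewrite /mxtrace big_ord_recl big_ord1 !mxE. Qed.

End Mat2.

Definition mk2E := (mk2_1, mk2M, mk2D, mk2N, mk2Z).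

Lemma mxvecD (R : nmodType) m n (A B : 'M[R]_(m, n)) :
  mxvec (A + B) = mxvec A + mxvec B.
Proof. by apply/rowP; case/mxvec_indexP => i j; rewrite mxE !mxvecE mxE. Qed.

Lemma mxvecZ (R : pzRingType) m n k (A : 'M[R]_(m, n)) :
  mxvec (k *: A) = k *: mxvec A.
Proof. by apply/rowP; case/mxvec_indexP => i j; rewrite mxE !mxvecE mxE. Qed.

Section RegularFunctions.
Context (K : numClosedFieldType).
Local Notation MP := {mpoly K[2 * 2]}.
Implicit Types (p q : MP) (g A B : 'M[K]_2).

Local Notation mev g p := (meval (fun k => mxvec g 0 k) p).

Definition eqSL p q := forall g, \det g = 1 -> mev g p = mev g q.

Definition gX : 'M[MP]_2 := vec_mx (\row_k 'X_k).

Lemma mev_gX g i j : mev g (gX i j) = g i j.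
Proof. by rewrite mxE mxE mevalXU mxvecE. Qed.

Fact Der_key : unit. Proof. by []. Qed.
Definition Der := locked_with Der_key
  (fun (G : 'M[MP]_2) p => \sum_k mxvec G 0 k * p^`M(k)).

Lemma DerE G p : Der G p = \sum_k mxvec G 0 k * p^`M(k).
Proof. by rewrite [Der]unlock. Qed.

Lemma DerD G p q : Der G (p + q) = Der G p + Der G q.
Proof. by rewrite !DerE -big_split; apply: eq_bigr => k _; rewrite mderivD mulrDr. Qed.

Lemma DerM G p q : Der G (p * q) = Der G p * q + p * Der G q.
Proof.
rewrite !DerE mulr_suml mulr_sumr -big_split; apply: eq_bigr => k _ /=.
by rewrite mderivM; ring.
Qed.

Lemma DerC G c : Der G c%:MP = 0.
Proof. by rewrite DerE big1 // => k _; rewrite mderivC mulr0. Qed.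

Lemma Der0 G : Der G 0 = 0.
Proof. by rewrite -mpolyC0 DerC. Qed.

Lemma DerN G p : Der G (- p) = - Der G p.
Proof. by apply/eqP; rewrite -addr_eq0 -DerD addNr Der0. Qed.

Lemma DerX G k : Der G 'X_k = mxvec G 0 k.
Proof.
rewrite DerE (bigD1 k) //= mderivX mnm1E eqxx scale1r -{1}[U_(k)%MM]add0m addmK.
rewrite mpolyX0 mulr1 big1 ?addr0 // => j /negPf jk.
by rewrite mderivX mnm1E eq_sym jk scale0r mulr0.
Qed.

Lemma Der_gX G i j : Der G (gX i j) = G i j.
Proof. by rewrite !mxE DerX mxvecE. Qed.

Lemma Der_sum G (I : Type) (r : seq I) (P : pred I) (f : I -> MP) :
  Der G (\sum_(i <- r | P i) f i) = \sum_(i <- r | P i) Der G (f i).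
Proof. exact: (big_morph _ (DerD G) (Der0 G)). Qed.

Local Notation lift A := (map_mx (@mpolyC (2 * 2) K) A).

Lemma liftE A i j : lift A i j = (A i j)%:MP.
Proof. by rewrite mxE. Qed.

(** [DL A] is the left invariant derivation, differentiation along g(1 + tA); [DR A] is the right
    invariant one, along (1 + tA)g. *)
Definition DL := locked_with Der_key (fun A => Der (gX *m lift A)).
Definition DR := locked_with Der_key (fun A => Der (lift A *m gX)).

Lemma DLE A p : DL A p = Der (gX *m lift A) p.
Proof. by rewrite [DL]unlock. Qed.

Lemma DRE A p : DR A p = Der (lift A *m gX) p.
Proof. by rewrite [DR]unlock. Qed.

Lemma DLD A p q : DL A (p + q) = DL A p + DL A q.
Proof. by rewrite !DLE DerD. Qed.

Lemma DLM A p q : DL A (p * q) = DL A p * q + p * DL A q.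
Proof. by rewrite !DLE DerM. Qed.

Lemma DLC A c : DL A c%:MP = 0.
Proof. by rewrite !DLE DerC. Qed.

Lemma DLN A p : DL A (- p) = - DL A p.
Proof. by rewrite !DLE DerN. Qed.

Lemma DL_sum A (I : Type) (r : seq I) (P : pred I) (f : I -> MP) :
  DL A (\sum_(i <- r | P i) f i) = \sum_(i <- r | P i) DL A (f i).
Proof. by rewrite DLE Der_sum; apply: eq_bigr => i _; rewrite DLE. Qed.

Lemma mevDer g G p :
  mev g (Der G p) = \sum_k mxvec (\matrix_(i, j) mev g (G i j)) 0 k * mev g p^`M(k).
Proof.
rewrite DerE raddf_sum; apply: eq_bigr => k _ /=; rewrite mevalM; congr (_ * _).
by case/mxvec_indexP: k => i j; rewrite !mxvecE mxE.
Qed.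

Lemma mev_mulr g A i j : mev g ((gX *m lift A) i j) = (g *m A) i j.
Proof.
rewrite !mxE raddf_sum; apply: eq_bigr => k _ /=.
by rewrite mevalM mev_gX mxE mevalC.
Qed.

Lemma mev_mull g A i j : mev g ((lift A *m gX) i j) = (A *m g) i j.
Proof.
rewrite !mxE raddf_sum; apply: eq_bigr => k _ /=.
by rewrite mevalM mev_gX mxE mevalC.
Qed.

Lemma mevDL g A p : mev g (DL A p) = \sum_k mxvec (g *m A) 0 k * mev g p^`M(k).
Proof.
rewrite DLE mevDer; apply: eq_bigr => k _; congr (mxvec _ 0 k * _).
by apply/matrixP => i j; rewrite mxE mev_mulr.
Qed.

Lemma mevDR g A p : mev g (DR A p) = \sum_k mxvec (A *m g) 0 k * mev g p^`M(k).
Proof.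
rewrite DRE mevDer; apply: eq_bigr => k _; congr (mxvec _ 0 k * _).
by apply/matrixP => i j; rewrite mxE mev_mull.
Qed.

Lemma mevDLD g A B p : mev g (DL (A + B) p) = mev g (DL A p) + mev g (DL B p).
Proof.
rewrite (mevDL g (A + B)) (mevDL g A) (mevDL g B) -big_split; apply: eq_bigr => k _ /=.
by rewrite mulmxDr mxvecD mxE mulrDl.
Qed.

Lemma mevDLZ g k A p : mev g (DL (k *: A) p) = k * mev g (DL A p).
Proof.
rewrite (mevDL g (k *: A)) (mevDL g A) mulr_sumr; apply: eq_bigr => i _ /=.
by rewrite -scalemxAr mxvecZ mxE mulrA.
Qed.

Lemma mevDRE g A p : \det g = 1 -> mev g (DL A p) = mev g (DR (g *m A *m invmx g) p).
Proof.
move=> g1; rewrite mevDL mevDR; apply: eq_bigr => k _.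
by rewrite mulmxKV // unitmxE g1 unitr1.
Qed.

Definition lineR g A p := mline (fun k => mxvec g 0 k) (fun k => mxvec (g *m A) 0 k) p.
Definition lineL g A p := mline (fun k => mxvec g 0 k) (fun k => mxvec (A *m g) 0 k) p.

Lemma horner_lineR g A p t : (lineR g A p).[t] = mev (g *m (1%:M + t *: A)) p.
Proof.
rewrite horner_mline; apply: meval_eq => k.
by rewrite mulmxDr mulmx1 -scalemxAr mxvecD mxvecZ !mxE.
Qed.

Lemma horner_lineL g A p t : (lineL g A p).[t] = mev ((1%:M + t *: A) *m g) p.
Proof.
rewrite horner_mline; apply: meval_eq => k.
by rewrite mulmxDl mul1mx -scalemxAl mxvecD mxvecZ !mxE.
Qed.

Lemma deriv_lineR g A p : (lineR g A p)^`().[0] = mev g (DL A p).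
Proof.
rewrite deriv_mline mevDL; apply: eq_bigr => k _; congr (_ * _).
by apply: meval_eq => i; rewrite mul0r addr0.
Qed.

Lemma deriv_lineL g A p : (lineL g A p)^`().[0] = mev g (DR A p).
Proof.
rewrite deriv_mline mevDR; apply: eq_bigr => k _; congr (_ * _).
by apply: meval_eq => i; rewrite mul0r addr0.
Qed.

Definition nilp A := \tr A = 0 /\ \det A = 0.
Definition mE := mk2 0 1 0 0 : 'M[K]_2.
Definition mF := mk2 0 0 1 0 : 'M[K]_2.
Definition mH := mk2 1 0 0 (-1) : 'M[K]_2.
(** Completes [mE] and [mF] to a basis of sl_2 made of nilpotents; [mH] cannot serve here, as 1 + tH
    leaves SL_2. *)
Definition mN := mk2 1 (-1) 1 (-1) : 'M[K]_2.

Lemma nilpE : nilp mE. Proof. by split; rewrite ?tr_mk2 ?det_mk2; ring. Qed.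
Lemma nilpF : nilp mF. Proof. by split; rewrite ?tr_mk2 ?det_mk2; ring. Qed.
Lemma nilpN : nilp mN. Proof. by split; rewrite ?tr_mk2 ?det_mk2; ring. Qed.

Lemma det_unip A t : nilp A -> \det (1%:M + t *: A) = 1.
Proof.
rewrite (mk2_eta A) /nilp tr_mk2 det_mk2 => -[trA dA].
rewrite !mk2E det_mk2.
transitivity (1 + t * (A 0 0 + A 1 1) + t ^+ 2 * (A 0 0 * A 1 1 - A 0 1 * A 1 0)); first by ring.
by rewrite trA dA; ring.
Qed.

Lemma nilp_sq A : nilp A -> A *m A = 0.
Proof.
rewrite (mk2_eta A) /nilp tr_mk2 det_mk2 => -[/eqP].
rewrite addr_eq0 => /eqP -> dA.
have -> : 0 = mk2 0 0 0 0 :> 'M[K]_2 by apply: mx2P; rewrite !mxE.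
have dA' : A 0 1 * A 1 0 = - (A 1 1 * A 1 1).
  by apply/eqP; rewrite -subr_eq0 -oppr_eq0 -dA; apply/eqP; ring.
by rewrite !mk2E; congr mk2; rewrite 1?[A 1 0 * _]mulrC ?dA'; ring.
Qed.

Lemma sl2_decomp A : \tr A = 0 ->
  A = (A 0 1 + A 0 0) *: mE + (A 1 0 - A 0 0) *: mF + A 0 0 *: mN.
Proof.
rewrite {1 2}(mk2_eta A) tr_mk2 => /eqP; rewrite addrC addr_eq0 => /eqP e.
by rewrite !mk2E e; congr mk2; ring.
Qed.

Lemma sl2_decompH A : \tr A = 0 -> A = A 0 1 *: mE + A 1 0 *: mF + A 0 0 *: mH.
Proof.
rewrite {1 2}(mk2_eta A) tr_mk2 => /eqP; rewrite addrC addr_eq0 => /eqP e.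
by rewrite !mk2E e; congr mk2; ring.
Qed.

(** This replaces the stability of the ideal of det - 1: along g(1 + tB), B nilpotent, the two
    polynomials agree for all t, hence so do their derivatives, and [sl2_decomp] extends this to
    A. *)
Lemma eqSL_DL A p q : \tr A = 0 -> eqSL p q -> eqSL (DL A p) (DL A q).
Proof.
move=> trA pq g g1.
have Hn B : nilp B -> mev g (DL B p) = mev g (DL B q).
  move=> nB; rewrite -!deriv_lineR; congr (_^`().[0]).
  apply: poly_ext => t; rewrite !horner_lineR pq //.
  by rewrite det_mulmx g1 mul1r det_unip.
have Hd r : mev g (DL A r) = (A 0 1 + A 0 0) * mev g (DL mE r) +
    (A 1 0 - A 0 0) * mev g (DL mF r) + A 0 0 * mev g (DL mN r).
  by rewrite {1}(sl2_decomp trA) 2!mevDLD 3!mevDLZ.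
by rewrite !Hd (Hn _ nilpE) (Hn _ nilpF) (Hn _ nilpN).
Qed.

(** A commutator of derivations is a derivation, so it suffices to compare both sides on the matrix
    entries, where [DL A] multiplies the generic matrix by A on the right. *)
Lemma DL_comm A B p : DL A (DL B p) - DL B (DL A p) = DL (A *m B - B *m A) p.
Proof.
elim/mpoly_ring_ind: p => [c|k|p q Hp Hq|p q Hp Hq].
- by rewrite !DLC subrr.
- case/mxvec_indexP: k => i j.
  have -> : 'X_(mxvec_index i j) = gX i j by rewrite !mxE.
  have DDX A' B' : DL A' (DL B' (gX i j)) = (gX *m lift (A' *m B')) i j.
    rewrite !DLE Der_gX mxE Der_sum map_mxM mulmxA [RHS]mxE; apply: eq_bigr => k _.
    by rewrite DerM !liftE DerC mulr0 addr0 Der_gX.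
  by rewrite !DDX DLE Der_gX map_mxB mulmxBr [RHS]mxE; congr (_ + _); rewrite [RHS]mxE.
- rewrite (DLD A p q) (DLD B p q) (DLD _ p q) -Hp -Hq.
  by rewrite (DLD A (DL B p)) (DLD B (DL A p)) addrACA -opprD.
- rewrite (DLM A p q) (DLM B p q) (DLM _ p q) -Hp -Hq.
  rewrite (DLD A (DL B p * q)) (DLD B (DL A p * q)).
  rewrite (DLM A (DL B p) q) (DLM A p) (DLM B (DL A p) q) (DLM B p).
  have leibniz (R : comNzRingType) (x y xa xb ya yb xab xba yab yba : R) :
      xab * y + xb * ya + (xa * yb + x * yab) -
      (xba * y + xa * yb + (xb * ya + x * yba)) =
      (xab - xba) * y + x * (yab - yba) by ring.
  exact: leibniz.
Qed.

End RegularFunctions.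

(** * Algebraic dependence and Jacobians *)

Section Jacobian.
Context (K : numClosedFieldType).

Definition mcomp r n (h : 'I_n -> {mpoly K[r]}) (p : {mpoly K[n]}) : {mpoly K[r]} :=
  mmap (@mpolyC r K) h p.

Lemma meval_mcomp r n (h : 'I_n -> {mpoly K[r]}) p u :
  (mcomp h p).@[u] = p.@[fun i => (h i).@[u]].
Proof.
rewrite /mcomp; elim/mpoly_ring_ind: p => [c|i|p q Hp Hq|p q Hp Hq].
- by rewrite mmapC !mevalC.
- by rewrite mmapX mmap1U mevalXU.
- by rewrite mmapD !mevalD Hp Hq.
- by rewrite rmorphM !mevalM Hp Hq.
Qed.

Lemma msize_prodX r n (h : 'I_n -> {mpoly K[r]}) (D k : nat) (e : 'I_n -> nat) :
  (forall i, msize (h i) <= D.+1)%N -> (forall i, e i <= k)%N ->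
  (msize (\prod_i h i ^+ e i) <= (n * (k * D)).+1)%N.
Proof.
move=> hD ek.
have szM (p q : {mpoly K[r]}) a b :
    (msize p <= a.+1)%N -> (msize q <= b.+1)%N -> (msize (p * q) <= (a + b).+1)%N.
  have [->|p0] := eqVneq p 0; first by rewrite mul0r msize0.
  have [->|q0] := eqVneq q 0; first by rewrite mulr0 msize0.
  by rewrite msizeM //; move: (msize p) (msize q) => sp sq; lia.
have szX i m : (msize (h i ^+ m) <= (m * D).+1)%N.
  elim: m => [|m IH]; first by rewrite expr0 msize1.
  by rewrite exprS mulSn; apply: szM.
have -> : (n * (k * D) = \sum_(i < n) k * D)%N by rewrite sum_nat_const card_ord.
elim/big_ind2: _ => [||i _]; first by rewrite msize1.
  by move=> p a q b Hp Hq; apply: szM.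
by apply: leq_trans (szX _ _) _; rewrite ltnS leq_mul2r ek orbT.
Qed.

(* Counting monomials: there are more products of the [r.+1] polynomials
   of bounded exponents than monomials in [r] variables they may involve. *)
Lemma mpoly_alg_dep r (h : 'I_r.+1 -> {mpoly K[r]}) :
  exists2 F : {mpoly K[r.+1]}, F != 0 & mcomp h F = 0.
Proof.
pose D := \max_i msize (h i).
have hD i : (msize (h i) <= D.+1)%N by apply: leqW; apply: leq_bigmax.
(* With R = (r + 1)D + 1 and k = R^r, there are at most (R(k + 1))^r = k(k + 1)^r monomials against
   (k + 1)^(r + 1) products. *)
pose k := ((r.+1 * D).+1 ^ r)%N; pose T := (r.+1 * (k * D))%N.
pose E := {ffun 'I_r.+1 -> 'I_k.+1}; pose E' := {ffun 'I_r -> 'I_T.+1}.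
pose mon (e : E) : 'X_{1..r.+1} := [multinom (e i : nat) | i < r.+1].
pose mon' (e : E') : 'X_{1..r} := [multinom (e i : nat) | i < r].
pose G (e : E) := \prod_i h i ^+ e i.
pose A : 'M[K]_(#|E|, #|E'|) :=
  \matrix_(i, j) (G (enum_val i))@_(mon' (enum_val j)).
have cardlt : (#|E'| < #|E|)%N.
  rewrite !card_ffun !card_ord.
  apply: (@leq_trans ((((r.+1 * D).+1 * k.+1) ^ r).+1)%N).
    have mono a b m : (a <= b -> a ^ m <= b ^ m)%N.
      by move=> ab; elim: m => // m IH; rewrite !expnS leq_mul.
    by rewrite ltnS; apply: mono; rewrite /T mulnCA; generalize (r.+1 * D)%N k => x y; nia.
  by rewrite expnMn expnS -/k ltn_pmul2r // expn_gt0.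
have kerA : kermx A != 0.
  rewrite -mxrank_eq0 mxrank_ker subn_eq0 -ltnNge.
  exact: leq_ltn_trans (rank_leq_col _) cardlt.
have [w /sub_kermxP wA w0] := rowV0Pn kerA.
exists (\sum_i w 0 i *: 'X_[mon (enum_val i)]).
  apply: contra_neq w0 => F0; apply/rowP => i; rewrite mxE.
  have := congr1 (mcoeff (mon (enum_val i))) F0.
  rewrite mcoeff0 raddf_sum (bigD1 i) //= mcoeffZ mcoeffX eqxx mulr1 big1 ?addr0 // => j ji.
  rewrite mcoeffZ mcoeffX; case: eqP => [/mnmP e|]; last by rewrite mulr0.
  case/eqP: ji; apply: enum_val_inj; apply/ffunP => l; apply: val_inj.
  by have := e l; rewrite !mnmE.
have -> : mcomp h (\sum_i w 0 i *: 'X_[mon (enum_val i)]) =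
    \sum_i w 0 i *: G (enum_val i).
  rewrite /mcomp raddf_sum; apply: eq_bigr => i _ /=.
  rewrite mmapZ mul_mpolyC mmapX; congr (_ *: _).
  by apply: eq_bigr => l _; rewrite mnmE.
apply/mpolyP => m; rewrite mcoeff0 (raddf_sum (mcoeff m)).
under eq_bigr => i _ do rewrite /= mcoeffZ.
have [mT|mT] := ltnP (mdeg m) T.+1; last first.
  rewrite big1 // => i _; rewrite memN_msupp_eq0 ?mulr0 //.
  apply: msize_mdeg_ge; apply: leq_trans mT; apply: msize_prodX => // l.
  by rewrite -ltnS.
pose e : E' := [ffun i => inord (m i)].
have em : m = mon' e.
  apply/mnmP => i; rewrite !mnmE ffunE inordK //; apply: leq_ltn_trans mT.
  by rewrite mdegE (bigD1 i) //= leq_addr.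
have := congr1 (fun B : 'rV_ _ => B 0 (enum_rank e)) wA.
rewrite !mxE => wAe; rewrite -[RHS]wAe; apply: eq_bigr => i _.
by rewrite mxE enum_rankK -em.
Qed.

(** [h] has more members than variables, so it satisfies a relation F, which [g] inherits. Were the
    Jacobian determinant of [g] nonzero somewhere, the chain rule would make every partial
    derivative of F a relation of [g] again, and descent on the degree would end in F = 0. *)
Lemma jacobian_eq0 r (h : 'I_r.+1 -> {mpoly K[r]}) (g : 'I_r.+1 -> {mpoly K[r.+1]}) u :
  (forall F, mcomp h F = 0 -> mcomp g F = 0) ->
  \det (\matrix_(i, j) ((g i)^`M(j)).@[u]) = 0.
Proof.
move=> hg; apply/eqP; apply: contraT => J0.
pose J := \matrix_(i, j) ((g i)^`M(j)).
have detJ : \det J != 0.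
  apply: contraNneq J0 => J0; rewrite -(meval0 u) -J0 -det_map_mx.
  by apply/eqP; congr (\det _); apply/matrixP => i j; rewrite !mxE.
have [F F0 /hg gF] := mpoly_alg_dep h.
suff : F = 0 by move/eqP; rewrite (negPf F0).
move: gF {F0}; have [m] := ubnP (msize F); elim: m F => // m IH F szF gF.
have [->//|F0] := eqVneq F 0.
have Hd i : F^`M(i) = 0.
  pose w := \row_i mcomp g F^`M(i).
  have wJ : w *m J = 0.
    apply/rowP => j; rewrite !mxE.
    have := mmap_chain (d := mderiv j) g F (mderivM j) (mderivC j).
    rewrite -/(mcomp g F) gF /= mderiv0 => e0; rewrite [RHS]e0.
    by apply: eq_bigr => l _; rewrite !mxE.
  (* The adjugate stands in for an inverse over the polynomial ring: w J = 0 becomes det(J) w =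
     0. *)
  have : w *m J *m \adj J = 0 by rewrite wJ mul0mx.
  rewrite -mulmxA mul_mx_adj mul_mx_scalar => /rowP /(_ i).
  rewrite mxE [X in _ * X]mxE [RHS]mxE => /eqP.
  rewrite mulf_eq0 (negPf detJ) /= => /eqP.
  by apply: IH; rewrite ltnS in szF; apply: leq_trans szF; apply: msize_mderiv.
have := gF; rewrite (mderiv_eq0_const Hd) /mcomp mmapC.
by move/eqP; rewrite mpolyC_eq0 => /eqP ->; rewrite mpolyC0.
Qed.

End Jacobian.

(** * The average over SL_2 *)

Section Haar.
Context (K : numClosedFieldType).
Local Notation MP := {mpoly K[2 * 2]}.
Local Notation mev g p := (meval (fun k => mxvec g 0 k) p).

Definition va : 'I_(2 * 2) := mxvec_index 0 0.
Definition vb : 'I_(2 * 2) := mxvec_index 0 1.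
Definition vc : 'I_(2 * 2) := mxvec_index 1 0.
Definition vd : 'I_(2 * 2) := mxvec_index 1 1.

Lemma big_mxvec (T : Type) (idx : T) (op : Monoid.com_law idx) (F : 'I_(2 * 2) -> T) :
  \big[op/idx]_k F k = op (op (F va) (F vb)) (op (F vc) (F vd)).
Proof.
rewrite (reindex _ (curry_mxvec_bij 2 2)) /=.
rewrite (eq_bigr (fun p => F (mxvec_index p.1 p.2))) => [|[]//].
rewrite -(pair_bigA _ (fun i j => F (mxvec_index i j))) /=.
by rewrite !big_ord_recl !big_ord0 !Monoid.mulm1;
  congr (op (op (F (mxvec_index _ _)) (F (mxvec_index _ _)))
            (op (F (mxvec_index _ _)) (F (mxvec_index _ _)))); apply: val_inj.
Qed.

Lemma mxvec_index_neq (i j i' j' : 'I_2) :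
  (mxvec_index i j == mxvec_index i' j') = (i == i') && (j == j').
Proof.
apply/eqP/andP => [e|[/eqP-> /eqP->]] //.
have := congr1 (fun k => (mxvec (delta_mx i j : 'M[int]_2)) 0 k) e.
by rewrite !mxvecE !mxE !eqxx (eq_sym i) (eq_sym j); do 2 case: eqP.
Qed.

Lemma Der4 (G : 'M[MP]_2) p : Der G p =
  G 0 0 * p^`M(va) + G 0 1 * p^`M(vb) + (G 1 0 * p^`M(vc) + G 1 1 * p^`M(vd)).
Proof. by rewrite DerE big_mxvec !mxvecE. Qed.

(* The integral of [a^i d^i' b^j c^j'] over SU(2), normalized by total mass 1. *)
Definition hw (a d b c : nat) : K :=
  if (a == d) && (b == c) then (-1) ^+ b * (a`! * b`!)%:R / ((a + b).+1)`!%:R else 0.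

Lemma hw_sym1 a d b c : hw a d b c = hw d a b c.
Proof. by rewrite /hw eq_sym; case: eqP => // ->. Qed.

Lemma hw_sym2 a d b c : hw a d b c = hw a d c b.
Proof. by rewrite /hw (eq_sym b); case: (c =P b) => [->|]; rewrite ?andbF. Qed.

(** The functional kills a d/db + c d/dd of a monomial, which is [DL] of [mE]; where [b.-1] or
    [d.-1] is truncated, its factor is 0. The three companions below follow by the symmetries of
    [hw]. *)
Lemma hw_rec a d b c :
  b%:R * hw a.+1 d b.-1 c + d%:R * hw a d.-1 b c.+1 = 0.
Proof.
case: b => [|b]; first by rewrite mul0r add0r /hw andbF mulr0.
case: d => [|d]; first by rewrite mul0r addr0 /hw /= mulr0.
rewrite /= /hw !eqSS; case: eqP => /= [->|]; last by rewrite !mulr0 addr0.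
case: eqP => /= _; last by rewrite !mulr0 addr0.
rewrite addSnnS exprS !factS !natrM; ring.
Qed.

Lemma hw_recF a d b c : a%:R * hw a.-1 d b.+1 c + c%:R * hw a d.+1 b c.-1 = 0.
Proof.
by rewrite addrC (hw_sym1 a) (hw_sym1 a.-1) (hw_sym2 _ _ b) (hw_sym2 _ _ b.+1) hw_rec.
Qed.

Lemma hw_recRE a d b c : a%:R * hw a.-1 d b c.+1 + b%:R * hw a d.+1 b.-1 c = 0.
Proof. by rewrite addrC (hw_sym1 a) (hw_sym1 a.-1) hw_rec. Qed.

Lemma hw_recRF a d b c : c%:R * hw a.+1 d b c.-1 + d%:R * hw a d.-1 b.+1 c = 0.
Proof. by rewrite (hw_sym2 _ _ b) (hw_sym2 _ _ b.+1) hw_rec. Qed.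

Definition hwt (m : 'X_{1..2 * 2}) : K := hw (m va) (m vd) (m vb) (m vc).

(** A linear form on all polynomials in the entries; that it depends only on the values on SL_2 is
    [haar_eqSL]. *)
Definition haar (p : MP) : K := \sum_(m <- msupp p) p@_m * hwt m.

Lemma haarwE p k : (msize p <= k)%N ->
  haar p = \sum_(m : bmultinom (2 * 2) k) p@_m * hwt m.
Proof.
move=> le_pk; pose I : subFinType _ := bmultinom (2 * 2) k.
rewrite /haar (big_mksub I) ?msupp_uniq //=; last first.
  by move=> x /msize_mdeg_lt /leq_trans; apply.
by rewrite big_rmcond //= => j /memN_msupp_eq0 ->; rewrite mul0r.
Qed.

Lemma haarD p q : haar (p + q) = haar p + haar q.
Proof.
pose k := maxn (msize (p + q)) (maxn (msize p) (msize q)).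
rewrite !(@haarwE _ k) ?leq_max ?leqnn ?orbT //.
by rewrite -big_split; apply: eq_bigr => m _; rewrite mcoeffD mulrDl.
Qed.

Lemma haarZ c p : haar (c *: p) = c * haar p.
Proof.
pose k := maxn (msize (c *: p)) (msize p).
rewrite !(@haarwE _ k) ?leq_max ?leqnn ?orbT // mulr_sumr.
by apply: eq_bigr => m _; rewrite mcoeffZ mulrA.
Qed.

Lemma haar0 : haar 0 = 0.
Proof. by rewrite /haar msupp0 big_nil. Qed.

Lemma haar_sum (I : Type) (r : seq I) (P : pred I) (f : I -> MP) :
  haar (\sum_(i <- r | P i) f i) = \sum_(i <- r | P i) haar (f i).
Proof. exact: (big_morph _ haarD haar0). Qed.

Lemma haarX m : haar 'X_[m] = hwt m.
Proof. by rewrite /haar msuppX big_seq1 mcoeffX eqxx mul1r. Qed.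

Lemma haar1 : haar 1 = 1.
Proof. by rewrite -mpolyX0 haarX /hwt !mnm0E /hw /= !fact0 mul1r divr1. Qed.

Lemma haarC c : haar c%:MP = c.
Proof. by rewrite -[c%:MP]mulr1 mul_mpolyC haarZ haar1 mulr1. Qed.

Lemma haarN p : haar (- p) = - haar p.
Proof. by rewrite -scaleN1r haarZ mulN1r. Qed.

Lemma haar_shift i j m :
  haar ('X_i * ('X_[m])^`M(j)) = (m j)%:R * hwt (U_(i) + (m - U_(j)))%MM.
Proof. by rewrite mderivX -scalerAr haarZ -mpolyXD haarX. Qed.

Lemma haar_monom (d : MP -> MP) : (forall p q, d (p + q) = d p + d q) ->
  (forall c p, d (c *: p) = c *: d p) -> (forall m, haar (d 'X_[m]) = 0) ->
  forall p, haar (d p) = 0.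
Proof.
move=> dD dZ dX; elim/mpolyind => [|c m p _ _ IH].
  by rewrite -(scale0r 0) dZ scale0r haar0.
by rewrite dD dZ haarD haarZ IH dX mulr0 addr0.
Qed.

Lemma DerZ G c (p : MP) : Der G (c *: p) = c *: Der G p.
Proof. by rewrite -mul_mpolyC DerM DerC mul0r add0r mul_mpolyC. Qed.

Let hshift := (@mnmDE (2 * 2), @mnmBE (2 * 2), @mnm1E (2 * 2), mxvec_index_neq).

Lemma mul_mk2_gX (x y z t : K) : map_mx (@mpolyC (2 * 2) K) (mk2 x y z t) *m @gX K =
  mk2 (x *: 'X_va + y *: 'X_vc) (x *: 'X_vb + y *: 'X_vd)
      (z *: 'X_va + t *: 'X_vc) (z *: 'X_vb + t *: 'X_vd).
Proof.
rewrite (mk2_eta (map_mx _ _)) (mk2_eta (@gX K)) mk2M.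
by congr mk2; rewrite !mxE /= !mul_mpolyC.
Qed.

Lemma mul_gX_mk2 (x y z t : K) : @gX K *m map_mx (@mpolyC (2 * 2) K) (mk2 x y z t) =
  mk2 (x *: 'X_va + z *: 'X_vb) (y *: 'X_va + t *: 'X_vb)
      (x *: 'X_vc + z *: 'X_vd) (y *: 'X_vc + t *: 'X_vd).
Proof.
rewrite (mk2_eta (map_mx _ _)) (mk2_eta (@gX K)) mk2M.
by congr mk2; rewrite !mxE /= ![_ * _%:MP]mulrC !mul_mpolyC.
Qed.

Lemma haar_DLE p : haar (DL (mE K) p) = 0.
Proof.
rewrite DLE mul_gX_mk2; apply: haar_monom p => [p q|c p|m]; rewrite ?DerD ?DerZ //.
rewrite Der4 !mxE /= !scale0r !scale1r !add0r !addr0 !mul0r !add0r haarD !haar_shift.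
by rewrite /hwt !hshift /= !add0n !subn0 !add1n !subn1 hw_rec.
Qed.

Lemma haar_DLF p : haar (DL (mF K) p) = 0.
Proof.
rewrite DLE mul_gX_mk2; apply: haar_monom p => [p q|c p|m]; rewrite ?DerD ?DerZ //.
rewrite Der4 !mxE /= !scale0r !scale1r !add0r !mul0r !addr0 haarD !haar_shift.
by rewrite /hwt !hshift /= !add0n !subn0 !add1n !subn1 hw_recF.
Qed.

Lemma haar_DRE p : haar (DR (mE K) p) = 0.
Proof.
rewrite DRE mul_mk2_gX; apply: haar_monom p => [p q|c p|m]; rewrite ?DerD ?DerZ //.
rewrite Der4 !mxE /= !scale0r !scale1r !add0r !mul0r !addr0 haarD !haar_shift.
by rewrite /hwt !hshift /= !add0n !subn0 !add1n !subn1 hw_recRE.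
Qed.

Lemma haar_DRF p : haar (DR (mF K) p) = 0.
Proof.
rewrite DRE mul_mk2_gX; apply: haar_monom p => [p q|c p|m]; rewrite ?DerD ?DerZ //.
rewrite Der4 !mxE /= !scale0r !scale1r !addr0 !mul0r !add0r haarD !haar_shift.
by rewrite /hwt !hshift /= !add0n !subn0 !add1n !subn1 hw_recRF.
Qed.

Lemma haar_DLH p : haar (DL (mH K) p) = 0.
Proof.
have -> : mH K = mE K *m mF K - mF K *m mE K.
  by rewrite /mE /mF /mH !mk2E; congr mk2; ring.
by rewrite -DL_comm haarD haarN haar_DLE haar_DLF subr0.
Qed.

(** The integral over [0, 1], computed from the coefficients below n. *)
Definition intg n (q : {poly K}) := \sum_(i < n) q`_i / i.+1%:R.

Lemma intgB n p q : intg n (p - q) = intg n p - intg n q.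
Proof. by rewrite -sumrB; apply: eq_bigr => i _; rewrite coefB mulrBl. Qed.

(** Euler's beta integral; [i + j < n] ensures that no coefficient is cut off. *)
Lemma intg_beta n i j : (i + j < n)%N ->
  intg n ((1 - 'X) ^+ i * 'X^j) = (i`! * j`!)%:R / ((i + j).+1)`!%:R.
Proof.
elim: i j => [|i IH] j ijn.
  rewrite expr0 mul1r /intg (bigD1 (Ordinal ijn)) //= big1 ?addr0 => [|l lj].
    rewrite coefXn eqxx factS fact0 mul1n add0n natrM invfM mulrCA mulfV ?mulr1 ?mul1r //.
    by rewrite pnatr_eq0 -lt0n fact_gt0.
  by rewrite coefXn; case: eqP => [e|_]; [case/eqP: lj; apply: val_inj | rewrite mul0r].
have -> : (1 - 'X) ^+ i.+1 * 'X^j = (1 - 'X) ^+ i * 'X^j - (1 - 'X) ^+ i * 'X^(j.+1) :> {poly K}.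
  by rewrite exprSr exprS; ring.
have nz k : k`!%:R != 0 :> K by rewrite pnatr_eq0 -lt0n fact_gt0.
rewrite intgB !IH; [|by rewrite addnS -addSn|by apply: ltnW].
rewrite addSn addnS !factS !natrM.
have nz1 : (i + j).+1%:R != 0 :> K by rewrite pnatr_eq0.
have nz2 : (i + j).+2%:R != 0 :> K by rewrite pnatr_eq0.
have e1 : (i + j).+2%:R = i.+1%:R + j.+1%:R :> K by rewrite -natrD addSn addnS.
move: (nz i) (nz j) (nz (i + j)%N) nz1 nz2; rewrite e1 => {e1}.
move: i`!%:R j`!%:R (i + j)`!%:R (i + j).+1%:R i.+1%:R j.+1%:R => x y w u s t *.
by field; apply/and3P.
Qed.

Lemma big_mxvec_prod (F : 'I_(2 * 2) -> K) : \prod_k F k = F va * F vb * (F vc * F vd).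
Proof. exact: big_mxvec. Qed.

(** On SU(2) one has ad = 1 - s and bc = -s with s uniform on [0, 1], the phases being independent.
    Algebraically, averaging over the phases extracts the part of weight 0 under two tori, and the
    remaining integral over s is a beta integral, which reproduces [hw]. *)
Lemma haar_eqSL p q : eqSL p q -> haar p = haar q.
Proof.
move=> pq; apply/eqP; rewrite -subr_eq0 -haarN -haarD; apply/eqP.
have {pq} : eqSL (p - q) 0 by move=> g g1; rewrite mevalB pq // subrr meval0.
move: (p - q) => {p} p {q} p0.
pose e1 (m : 'X_{1..2 * 2}) : int := (m va)%:Z + (m vb)%:Z - (m vc)%:Z - (m vd)%:Z.
pose e2 (m : 'X_{1..2 * 2}) : int := (m va)%:Z - (m vb)%:Z + (m vc)%:Z - (m vd)%:Z.
pose S (s : K) (m : 'X_{1..2 * 2}) := p@_m * ((1 - s) ^+ m va * (- s) ^+ m vb).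
have H1 s z w : z != 0 -> w != 0 -> \sum_(m <- msupp p) S s m * w ^ e2 m * z ^ e1 m = 0.
  (* Two torus parameters z and w on top of ad = 1 - s, bc = -s; [e1] and [e2] are the exponents of
     z and w in a monomial. *)
  move=> z0 w0; pose g := mk2 (z * w * (1 - s)) (- s * (z / w)) (w / z) (z * w)^-1.
  have g1 : \det g = 1 by rewrite det_mk2; field; rewrite z0 w0.
  rewrite -[RHS](meval0 (fun k => mxvec g 0 k)) -(p0 _ g1) mevalE.
  apply: eq_bigr => m _; rewrite big_mxvec_prod !mxvecE !mxE /= /S -!mulrA; congr (_ * _).
  rewrite /e1 /e2 !expfzDr // -!exprz_inv -!exprnP.
  rewrite !invfM !exprMn; move: (w ^+ m va) (w^-1 ^+ m vb) (w ^+ m vc) (w^-1 ^+ m vd)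
    (z ^+ m va) (z ^+ m vb) (z^-1 ^+ m vc) (z^-1 ^+ m vd) ((1 - s) ^+ m va) ((- s) ^+ m vb).
  by move=> *; ring.
have H2 s w : w != 0 -> \sum_(m <- [seq m <- msupp p | e1 m == 0]) S s m * w ^ e2 m = 0.
  by move=> w0; rewrite big_filter; apply: laurent_coef => z z0; apply: H1.
have H3 s : \sum_(m <- [seq m <- [seq m <- msupp p | e1 m == 0] | e2 m == 0]) S s m = 0.
  by rewrite big_filter; apply: laurent_coef => z z0; apply: H2.
pose n := (msize p).*2.
pose Q := \sum_(m <- [seq m <- [seq m <- msupp p | e1 m == 0] | e2 m == 0])
  (p@_m * (-1) ^+ m vb) *: ((1 - 'X) ^+ m va * 'X^(m vb)) : {poly K}.
have Q0 : Q = 0.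
  apply: poly_ext => s; rewrite horner0 -[RHS](H3 s) horner_sum; apply: eq_bigr => m _.
  rewrite hornerZ hornerM hornerXn horner_exp hornerD hornerN hornerX hornerC /S.
  rewrite (exprNn s); move: (p@_m) ((-1) ^+ m vb) ((1 - s) ^+ m va) (s ^+ m vb).
  by move=> *; ring.
have : intg n Q = 0 by rewrite Q0 /intg big1 // => i _; rewrite coef0 mul0r.
have intg0 : intg n 0 = 0 by rewrite /intg big1 // => i _; rewrite coef0 mul0r.
have intgD q1 q2 : intg n (q1 + q2) = intg n q1 + intg n q2.
  by rewrite -big_split; apply: eq_bigr => i _; rewrite coefD mulrDl.
have intgZ c q : intg n (c *: q) = c * intg n q.
  by rewrite /intg mulr_sumr; apply: eq_bigr => i _; rewrite coefZ mulrA.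
rewrite (big_morph _ intgD intg0) => intgQ; rewrite -[RHS]intgQ /haar.
rewrite !big_filter_cond /= [LHS]big_seq_cond [RHS]big_seq_cond big_mkcond [RHS]big_mkcond.
apply: eq_bigr => m _ /=; rewrite !andbT.
case: (boolP (m \in msupp p)) => //= /msize_mdeg_lt; rewrite mdegE /hwt /hw.
rewrite big_mxvec /= => lt_m.
have -> : (e1 m == 0) && (e2 m == 0) = (m va == m vd) && (m vb == m vc).
  rewrite /e1 /e2; apply/andP/andP => -[/eqP ? /eqP ?]; split; apply/eqP; lia.
case: ifP => _; last by rewrite mulr0.
rewrite intgZ intg_beta ?mulrA //; rewrite /n -addnn.
by apply: leq_trans (leq_addr _ _); apply: leq_ltn_trans lt_m; rewrite leq_addr.
Qed.

End Haar.

(** * Polynomial representations *)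

Section SL2Generation.
Context (K : numClosedFieldType).
Implicit Types (g A : 'M[K]_2) (t : K).

Lemma unipE t : 1%:M + t *: mE K = mk2 1 t 0 1.
Proof. by rewrite !mk2E; congr mk2; ring. Qed.

Lemma unipF t : 1%:M + t *: mF K = mk2 1 0 t 1.
Proof. by rewrite !mk2E; congr mk2; ring. Qed.

Lemma det_mk2E g : \det g = g 0 0 * g 1 1 - g 0 1 * g 1 0.
Proof. by rewrite {1}(mk2_eta g) det_mk2. Qed.

(** If the lower left entry is nonzero, g is a product of an upper, a lower and an upper unipotent;
    otherwise multiplying by 1 + F on the right makes that entry nonzero. *)
Lemma SL2_ind (P : 'M[K]_2 -> Prop) :
  (forall t, P (1%:M + t *: mE K)) -> (forall t, P (1%:M + t *: mF K)) ->
  (forall g h, \det g = 1 -> \det h = 1 -> P g -> P h -> P (g *m h)) ->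
  forall g, \det g = 1 -> P g.
Proof.
move=> PE PF PM.
have H g : \det g = 1 -> g 1 0 != 0 -> P g.
  move=> g1 c0.
  have -> : g = (1%:M + ((g 0 0 - 1) / g 1 0) *: mE K) *m (1%:M + g 1 0 *: mF K)
              *m (1%:M + ((g 1 1 - 1) / g 1 0) *: mE K).
    move: g1; rewrite det_mk2E => g1.
    rewrite !unipE unipF !mk2M {1}(mk2_eta g); congr mk2.
    - by field.
    - have -> : g 0 1 = (g 0 0 * g 1 1 - 1) / g 1 0 by rewrite -g1; field.
      by field.
    - by field.
    - by field.
  have dE t := @det_unip _ _ t (nilpE K); have dF t := @det_unip _ _ t (nilpF K).
  by apply: (PM) => //; [rewrite det_mulmx dE dF mulr1 | apply: PM].
move=> g g1; have [c0|] := eqVneq (g 1 0) 0; last exact: H.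
have d0 : g 1 1 != 0.
  apply: contra_eq_neq g1 => d0; rewrite det_mk2E c0 d0 !mulr0 subrr eq_sym.
  exact: oner_neq0.
have -> : g = g *m (1%:M + 1 *: mF K) *m (1%:M + (- 1) *: mF K).
  by rewrite !unipF {1 2}(mk2_eta g) !mk2M; congr mk2; ring.
apply: PM; rewrite ?det_mulmx ?det_unip ?mulr1 //; try exact: nilpF.
apply: H; first by rewrite det_mulmx det_unip ?mulr1 //; exact: nilpF.
by rewrite unipF {1}(mk2_eta g) mk2M mxE /= c0 mul0r add0r mulr1.
Qed.

End SL2Generation.

Section Representation.
Context (K : numClosedFieldType).
Local Notation MP := {mpoly K[2 * 2]}.
Local Notation mev g p := (meval (fun k => mxvec g 0 k) p).

(** [act] is constrained only on SL_2. The representing polynomials are data rather than an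
    existence statement, so that [dr] can be defined by differentiating them. *)
Record polyrep n := PolyRep {
  act :> 'M[K]_2 -> 'M[K]_n;
  coefs : 'M[MP]_n;
  act1 : act 1%:M = 1%:M;
  actM : forall g h, \det g = 1 -> \det h = 1 -> act (g *m h) = act g *m act h;
  actE : forall g, \det g = 1 -> forall i j, act g i j = mev g (coefs i j)
}.

Lemma std_rep_subproof g : \det g = 1 -> forall i j, g i j = mev g (gX K i j).
Proof. by move=> _ i j; rewrite mev_gX. Qed.

Definition std_rep : polyrep 2 :=
  @PolyRep 2 id (gX K) erefl (fun g h _ _ => erefl) std_rep_subproof.

Section OneRep.
Context (n : nat) (r : polyrep n).
Implicit Types (g A B : 'M[K]_2) (t : K).

(** The differential at the identity. It is linear on all 2 x 2 matrices, but independence from the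
    representing polynomials and compatibility with brackets belong to sl_2, whence the hypotheses
    [\tr A = 0] below. *)
Definition dr A : 'M[K]_n := \matrix_(i, j) mev 1%:M (DL A (coefs r i j)).

Lemma drD A B : dr (A + B) = dr A + dr B.
Proof. by apply/matrixP => i j; rewrite !mxE mevDLD. Qed.

Lemma drZ k A : dr (k *: A) = k *: dr A.
Proof. by apply/matrixP => i j; rewrite !mxE mevDLZ. Qed.

Lemma dr0 : dr 0 = 0.
Proof. by rewrite -(scale0r 0) drZ scale0r. Qed.

Lemma drN A : dr (- A) = - dr A.
Proof. by rewrite -scaleN1r drZ scaleN1r. Qed.

Lemma drEFN A : \tr A = 0 -> dr A =
  (A 0 1 + A 0 0) *: dr (mE K) + (A 1 0 - A 0 0) *: dr (mF K) + A 0 0 *: dr (mN K).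
Proof. by move=> trA; rewrite {1}(sl2_decomp trA) 2!drD 3!drZ. Qed.

Lemma det_invmx g : \det g = 1 -> \det (invmx g) = 1.
Proof. by move=> g1; rewrite det_inv g1 invr1. Qed.

Lemma SL_unit g : \det g = 1 -> g \in unitmx.
Proof. by rewrite unitmxE => ->; rewrite unitr1. Qed.

Lemma actK g : \det g = 1 -> r g *m r (invmx g) = 1%:M.
Proof. by move=> g1; rewrite -actM ?det_invmx // mulmxV ?SL_unit // act1. Qed.

Lemma actVK g : \det g = 1 -> r (invmx g) *m r g = 1%:M.
Proof. by move=> g1; rewrite -actM ?det_invmx // mulVmx ?SL_unit // act1. Qed.

Lemma act_unit g : \det g = 1 -> r g \in unitmx.
Proof. by move=> /actK /mulmx1_unit[]. Qed.

Lemma DL_coefs g A i j : \det g = 1 -> \tr A = 0 ->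
  mev g (DL A (coefs r i j)) = (r g *m dr A) i j.
Proof.
move=> g1 trA.
have Hn B : nilp B -> mev g (DL B (coefs r i j)) = (r g *m dr B) i j.
  move=> nB; rewrite -deriv_lineR.
  have -> : lineR g B (coefs r i j) = \sum_k r g i k *: lineR 1%:M B (coefs r k j).
    apply: poly_ext => t; rewrite horner_lineR horner_sum -actE; last first.
      by rewrite det_mulmx g1 mul1r det_unip.
    rewrite actM ?det_unip // mxE; apply: eq_bigr => k _.
    by rewrite hornerZ horner_lineR mul1mx -actE ?det_unip.
  rewrite raddf_sum horner_sum mxE; apply: eq_bigr => k _.
  by rewrite /= derivZ hornerZ deriv_lineR mxE.
have Hd p : mev g (DL A p) = (A 0 1 + A 0 0) * mev g (DL (mE K) p) +
    (A 1 0 - A 0 0) * mev g (DL (mF K) p) + A 0 0 * mev g (DL (mN K) p).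
  by rewrite {1}(sl2_decomp trA) 2!mevDLD 3!mevDLZ.
rewrite Hd (Hn _ (nilpE K)) (Hn _ (nilpF K)) (Hn _ (nilpN K)).
rewrite (drEFN trA) 2!mulmxDr -!scalemxAr [RHS]mxE [X in _ = X + _]mxE.
by congr (_ + _ + _); rewrite [RHS]mxE.
Qed.

Lemma tr_conj g A : \det g = 1 -> \tr (g *m A *m invmx g) = \tr A.
Proof. by move=> g1; rewrite mxtrace_mulC mulmxA mulVmx ?SL_unit // mul1mx. Qed.

Lemma DR_coefs g A i j : \det g = 1 -> \tr A = 0 ->
  mev g (DR A (coefs r i j)) = (dr A *m r g) i j.
Proof.
move=> g1 trA.
have Hn B : nilp B -> mev g (DR B (coefs r i j)) = (dr B *m r g) i j.
  move=> nB; rewrite -deriv_lineL.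
  have -> : lineL g B (coefs r i j) = \sum_k r g k j *: lineR 1%:M B (coefs r i k).
    apply: poly_ext => t; rewrite horner_lineL horner_sum -actE; last first.
      by rewrite det_mulmx g1 mulr1 det_unip.
    rewrite actM ?det_unip // mxE; apply: eq_bigr => k _.
    by rewrite hornerZ horner_lineR mul1mx -actE ?det_unip // mulrC.
  rewrite raddf_sum horner_sum mxE; apply: eq_bigr => k _.
  by rewrite /= derivZ hornerZ deriv_lineR mxE mulrC.
have mevDRD B B' p : mev g (DR (B + B') p) = mev g (DR B p) + mev g (DR B' p).
  rewrite (mevDR g (B + B')) (mevDR g B) (mevDR g B') -big_split.
  by apply: eq_bigr => k _ /=; rewrite mulmxDl mxvecD mxE mulrDl.
have mevDRZ k B p : mev g (DR (k *: B) p) = k * mev g (DR B p).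
  rewrite (mevDR g (k *: B)) (mevDR g B) mulr_sumr.
  by apply: eq_bigr => l _ /=; rewrite -scalemxAl mxvecZ mxE mulrA.
have Hd p : mev g (DR A p) = (A 0 1 + A 0 0) * mev g (DR (mE K) p) +
    (A 1 0 - A 0 0) * mev g (DR (mF K) p) + A 0 0 * mev g (DR (mN K) p).
  by rewrite {1}(sl2_decomp trA) 2!mevDRD 3!mevDRZ.
rewrite Hd (Hn _ (nilpE K)) (Hn _ (nilpF K)) (Hn _ (nilpN K)).
rewrite (drEFN trA) 2!mulmxDl -!scalemxAl [RHS]mxE [X in _ = X + _]mxE.
by congr (_ + _ + _); rewrite [RHS]mxE.
Qed.

(** The left invariant field of A and the right invariant field of gAg^-1 coincide at g. *)
Lemma dr_conj g A : \det g = 1 -> \tr A = 0 ->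
  r g *m dr A = dr (g *m A *m invmx g) *m r g.
Proof.
move=> g1 trA; apply/matrixP => i j.
by rewrite -DL_coefs // -DR_coefs ?tr_conj // mevDRE.
Qed.

Lemma dr_comm A B : \tr A = 0 -> \tr B = 0 ->
  dr A *m dr B - dr B *m dr A = dr (A *m B - B *m A).
Proof.
move=> trA trB; apply/matrixP => i j; rewrite [RHS]mxE -DL_comm mevalB.
have H A' B' : \tr A' = 0 -> \tr B' = 0 ->
    mev 1%:M (DL A' (DL B' (coefs r i j))) = (dr A' *m dr B') i j.
  move=> trA' trB'.
  have e : eqSL (DL B' (coefs r i j)) (\sum_k coefs r i k * (dr B' k j)%:MP).
    move=> g g1; rewrite DL_coefs // mxE raddf_sum; apply: eq_bigr => k _ /=.
    by rewrite mevalM mevalC -actE.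
  rewrite (eqSL_DL trA' e) ?det1 // DL_sum raddf_sum mxE; apply: eq_bigr => k _ /=.
  by rewrite DLM DLC mulr0 addr0 mevalM mevalC DL_coefs ?det1 // act1 mul1mx.
by rewrite !H // mxE [X in _ + X]mxE.
Qed.

(** The coefficient of t^k in r(1 + tA); for nilpotent A it is dr(A)^k / k!, by [ucoefS]. *)
Definition ucoef A k : 'M[K]_n := \matrix_(i, j) (lineR 1%:M A (coefs r i j))`_k.

Lemma ucoef0 A : ucoef A 0 = 1%:M.
Proof.
apply/matrixP => i j; rewrite mxE -horner_coef0 horner_lineR scale0r addr0 mulmx1.
by rewrite -actE ?det1 // act1.
Qed.

Lemma ucoefS A k : nilp A -> k.+1%:R *: ucoef A k.+1 = dr A *m ucoef A k.
Proof.
move=> nA; have [trA _] := nA.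
apply/matrixP => i j; rewrite !mxE.
have <- : ((lineR 1%:M A (coefs r i j))^`())`_k =
    k.+1%:R * (lineR 1%:M A (coefs r i j))`_k.+1 by rewrite coef_deriv mulr_natl.
have -> : (lineR 1%:M A (coefs r i j))^`() =
    \sum_l dr A i l *: lineR 1%:M A (coefs r l j).
  apply: poly_ext => t; rewrite deriv_mline horner_sum.
  have g1 : \det (1%:M + t *: A) = 1 by rewrite det_unip.
  transitivity (mev (1%:M + t *: A) (DR A (coefs r i j))).
    rewrite mevDR; apply: eq_bigr => l _.
    rewrite mulmxDr mulmx1 -scalemxAr (nilp_sq nA) scaler0 addr0 mul1mx.
    by congr (_ * _); apply: meval_eq => k'; rewrite mxvecD mxvecZ !mxE.
  rewrite DR_coefs // mxE; apply: eq_bigr => l _.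
  by rewrite hornerZ horner_lineR mul1mx -actE.
by rewrite coef_sum; apply: eq_bigr => l _; rewrite coefZ [ucoef _ _ _ _]mxE.
Qed.

Lemma ucoef_bound A : exists N, forall k, (N <= k)%N -> ucoef A k = 0.
Proof.
exists (\max_(i < n) \max_(j < n) size (lineR 1%:M A (coefs r i j))) => k kN.
apply/matrixP => i j; rewrite !mxE nth_default //; apply: leq_trans kN.
by apply: leq_trans (leq_bigmax i); apply: leq_trans (leq_bigmax j).
Qed.

Lemma act_unip A t N : nilp A -> (forall k, (N <= k)%N -> ucoef A k = 0) ->
  r (1%:M + t *: A) = \sum_(k < N) t ^+ k *: ucoef A k.
Proof.
move=> nA HN; apply/matrixP => i j; rewrite actE ?det_unip // summxE.
rewrite -[1%:M + _]mul1mx -horner_lineR (@horner_coef_wide _ N); last first.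
  apply/leq_sizeP => k kN; have := congr1 (fun B : 'M_n => B i j) (HN k kN).
  by rewrite !mxE.
by apply: eq_bigr => k _; rewrite !mxE mulrC.
Qed.

Lemma dr_nilpotent A : nilp A -> exists N, iter N (mulmx (dr A)) 1%:M = 0 :> 'M_n.
Proof.
move=> nA; have [N HN] := ucoef_bound A; exists N.
have H k : iter k (mulmx (dr A)) 1%:M = k`!%:R *: ucoef A k.
  elim: k => [|k IH]; first by rewrite /= fact0 scale1r ucoef0.
  by rewrite iterS IH -scalemxAr -(ucoefS _ nA) scalerA factS natrM mulrC.
by rewrite H HN // scaler0.
Qed.

End OneRep.

(** For A = E and A = F, r(1 + tA) is the exponential series of [dr r A], so the relation passes
    from the differentials to these unipotents, which generate SL_2. *)
Lemma intertwine n m (r : polyrep n) (s : polyrep m) (X : 'M[K]_(n, m)) :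
  dr r (mE K) *m X = X *m dr s (mE K) -> dr r (mF K) *m X = X *m dr s (mF K) ->
  forall g, \det g = 1 -> r g *m X = X *m s g.
Proof.
move=> XE XF.
have H A t : nilp A -> dr r A *m X = X *m dr s A ->
    r (1%:M + t *: A) *m X = X *m s (1%:M + t *: A).
  move=> nA XA; have [N1 H1] := ucoef_bound r A; have [N2 H2] := ucoef_bound s A.
  have cX k : ucoef r A k *m X = X *m ucoef s A k.
    elim: k => [|k IH]; first by rewrite !ucoef0 mul1mx mulmx1.
    apply: (@scalerI _ _ k.+1%:R); first by rewrite pnatr_eq0.
    rewrite scalemxAl ucoefS // -mulmxA IH mulmxA XA -mulmxA -ucoefS //.
    by rewrite -scalemxAr.
  rewrite (@act_unip _ r A t (maxn N1 N2)) //; last first.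
    by move=> k; rewrite geq_max => /andP[/H1].
  rewrite (@act_unip _ s A t (maxn N1 N2)) //; last first.
    by move=> k; rewrite geq_max => /andP[_ /H2].
  rewrite mulmx_suml mulmx_sumr; apply: eq_bigr => k _.
  by rewrite -scalemxAl -scalemxAr cX.
apply: SL2_ind => [t|t|g h g1 h1 Hg Hh].
- exact: H (nilpE K) XE.
- exact: H (nilpF K) XF.
- by rewrite !actM // -mulmxA Hh mulmxA Hg -mulmxA.
Qed.

End Representation.

(** * Tangency *)

Section Tangency.
Context (K : numClosedFieldType) (n : nat) (r : polyrep K n).
Local Notation MP := {mpoly K[2 * 2]}.
Local Notation mev g p := (meval (fun k => mxvec g 0 k) p).
Implicit Types (g A : 'M[K]_2) (v x : 'cV[K]_n) (M : 'M[K]_n) (t : K).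

Definition orbit_fun v (i : 'I_n) : MP := \sum_j coefs r i j * (v j 0)%:MP.

Lemma mev_orbit_fun v g i : \det g = 1 -> mev g (orbit_fun v i) = (r g *m v) i 0.
Proof.
move=> g1; rewrite raddf_sum mxE; apply: eq_bigr => j _ /=.
by rewrite mevalM mevalC -actE.
Qed.

Lemma mev_DL_orbit_fun v g A i : \det g = 1 -> \tr A = 0 ->
  mev g (DL A (orbit_fun v i)) = (r g *m (dr r A *m v)) i 0.
Proof.
move=> g1 trA; rewrite DL_sum raddf_sum mulmxA mxE; apply: eq_bigr => j _ /=.
by rewrite DLM DLC mulr0 addr0 mevalM mevalC DL_coefs.
Qed.

(** Where the linear form vanishes, g_10 is nonzero, and along g(1 + tE) the form becomes t g_10; so
    q vanishes there for t nonzero, hence at t = 0. The cells used are a = 0 and a = 1. *)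
Lemma mev_line_vanish (q : MP) (a : K) :
  (forall g, \det g = 1 -> a * g 1 0 + g 1 1 != 0 -> mev g q = 0) ->
  forall g, \det g = 1 -> mev g q = 0.
Proof.
move=> Hq g g1; have [z|] := eqVneq (a * g 1 0 + g 1 1) 0; last exact: Hq.
have c0 : g 1 0 != 0.
  apply: contra_eq_neq g1 => c0; rewrite det_mk2E c0.
  by move: z; rewrite c0 mulr0 add0r => ->; rewrite !mulr0 subrr eq_sym oner_neq0.
have -> : mev g q = (lineR g (mE K) q).[0].
  by rewrite horner_lineR scale0r addr0 mulmx1.
rewrite (_ : lineR _ _ _ = 0) ?horner0 //; apply: poly_nz_ext => t t0.
rewrite horner_lineR horner0 Hq //; first by rewrite det_mulmx g1 det_unip ?mulr1 //; apply: nilpE.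
rewrite unipE {1 2}(mk2_eta g) mk2M !mxE /=.
have -> : a * (g 1 0 * 1 + g 1 1 * 0) + (g 1 0 * t + g 1 1 * 1) =
   (a * g 1 0 + g 1 1) + g 1 0 * t by ring.
by rewrite z add0r mulf_neq0.
Qed.

Definition mvec x : 'I_n -> K := fun i => x i 0.

Lemma orbit_dense (T : Type) (H : T -> 'M[K]_2) v (a : K) :
  (forall g, \det g = 1 -> a * g 1 0 + g 1 1 != 0 ->
    exists u, r g *m v = r (H u) *m v) ->
  forall G : {mpoly K[n]}, (forall u, G.@[mvec (r (H u) *m v)] = 0) ->
  forall g, \det g = 1 -> G.@[mvec (r g *m v)] = 0.
Proof.
move=> dense G G0 g g1.
have Hq h : \det h = 1 -> mev h (mcomp (orbit_fun v) G) = G.@[mvec (r h *m v)].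
  by move=> h1; rewrite meval_mcomp; apply: meval_eq => i; rewrite mev_orbit_fun.
rewrite -Hq //; apply: (@mev_line_vanish _ a) => // h h1 hn.
by rewrite Hq //; have [u ->] := dense h h1 hn.
Qed.

Lemma mderiv_mline m (p : {mpoly K[m]}) (u : 'I_m -> K) j :
  p^`M(j).@[u] = (mline u (fun k => (k == j)%:R) p)^`().[0].
Proof.
rewrite deriv_mline (bigD1 j) //= eqxx mul1r big1 ?addr0 => [|k /negPf ->].
  by apply: meval_eq => k; rewrite mul0r addr0.
by rewrite mul0r.
Qed.

(* A polynomial curve in the orbit is tangent to it: otherwise moving the curve
   by the chart [H] would give a map of rank [1 + d] into the closure of the
   [d]-dimensional image of the chart. *)
Lemma tangent_span d (Hp : 'M[{mpoly K[d]}]_2) (H : ('I_d -> K) -> 'M[K]_2)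
    (B : 'I_d -> 'M[K]_2) v (y : 'I_n -> {poly K}) :
  (forall u i j, (Hp i j).@[u] = H u i j) -> (forall u, \det (H u) = 1) ->
  (forall j, nilp (B j)) -> H (fun=> 0) = 1%:M ->
  (forall j t, H (fun k => t * (k == j)%:R) = 1%:M + t *: B j) ->
  (forall G : {mpoly K[n]}, (forall u, G.@[mvec (r (H u) *m v)] = 0) ->
    forall g, \det g = 1 -> G.@[mvec (r g *m v)] = 0) ->
  (forall t, exists2 g, \det g = 1 & \col_i (y i).[t] = r g *m v) ->
  \col_i (y i).[0] = v ->
  row_free (\matrix_j (dr r (B j) *m v)^T) ->
  (\row_i (y i)^`().[0]%R <= \matrix_j (dr r (B j) *m v)^T)%MS.
Proof.
move=> HpE detH nB H0 HB dense yO y0 freeU.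
have Hext u w : u =1 w -> H u = H w.
  by move=> uw; apply/matrixP => i j; rewrite -!HpE; apply: meval_eq.
set U := \matrix_j _ in freeU *; set eta := \row_i _.
(* Testing against every linear map [L] to 1 + d coordinates turns the rank bound into determinants:
   a matrix of full row rank has a right inverse [L], which would give determinant 1. *)
have LW (L : 'M[K]_(n, 1 + d)) : \det (col_mx eta U *m L) = 0.
  pose lft (u : 'I_(1 + d) -> K) : 'I_d -> K := fun j => u (rshift 1 j).
  pose cm i j := mcomp (fun l => mxvec Hp 0 l) (coefs r i j).
  (* [Phi] is the chart followed by [L], in d parameters. [Psi] lets the chart act on the curve,
     whose parameter is the additional first variable; its values lie in the image of the orbit, so
     it satisfies the relations of [Phi]. *)
  pose Phi (i : 'I_(1 + d)) : {mpoly K[d]} :=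
    \sum_k L k i *: \sum_j cm k j * (v j 0)%:MP.
  pose shp : {mpoly K[d]} -> {mpoly K[1 + d]} := mcomp (fun j => 'X_(rshift 1 j)).
  pose yp j : {mpoly K[1 + d]} :=
    \sum_(l < size (y j)) (y j)`_l *: 'X_(lshift d 0) ^+ l.
  pose Psi (i : 'I_(1 + d)) : {mpoly K[1 + d]} :=
    \sum_k L k i *: \sum_j shp (cm k j) * yp j.
  have cmE u k j : (cm k j).@[u] = r (H u) k j.
    rewrite meval_mcomp actE //; apply: meval_eq => l.
    by case/mxvec_indexP: l => a b; rewrite !mxvecE HpE.
  have PhiE u i : (Phi i).@[u] = \sum_k L k i * (r (H u) *m v) k 0.
    rewrite raddf_sum; apply: eq_bigr => k _; rewrite /= mevalZ raddf_sum mxE.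
    by congr (_ * _); apply: eq_bigr => j _; rewrite /= mevalM mevalC cmE.
  have PsiE u i : (Psi i).@[u] =
      \sum_k L k i * (r (H (lft u)) *m \col_j (y j).[u (lshift d 0)]) k 0.
    rewrite raddf_sum; apply: eq_bigr => k _; rewrite /= mevalZ raddf_sum mxE.
    congr (_ * _); apply: eq_bigr => j _; rewrite /= mevalM meval_mcomp.
    congr (_ * _).
      by rewrite -cmE; apply: meval_eq => l; rewrite mevalXU.
    rewrite mxE horner_coef raddf_sum; apply: eq_bigr => l _ /=.
    by rewrite mevalZ rmorphXn /= mevalXU.
  have hyp F : mcomp Phi F = 0 -> mcomp Psi F = 0.
    move=> F0; apply: meval_ext0 => u.
    pose G : {mpoly K[n]} := mcomp (fun i => \sum_k L k i *: 'X_k) F.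
    have GE x : G.@[mvec x] = F.@[fun i => \sum_k L k i * x k 0].
      rewrite meval_mcomp; apply: meval_eq => i; rewrite raddf_sum.
      by apply: eq_bigr => k _ /=; rewrite mevalZ mevalXU.
    have G0 : forall g, \det g = 1 -> G.@[mvec (r g *m v)] = 0.
      apply: dense => w; rewrite GE; have := congr1 (meval w) F0.
      rewrite meval_mcomp meval0 => F0w; rewrite -[RHS]F0w.
      by apply: meval_eq => i; rewrite PhiE.
    have [g g1 yg] := yO (u (lshift d 0)).
    rewrite meval_mcomp -(G0 (H (lft u) *m g)) ?det_mulmx ?detH ?mul1r // GE.
    by apply: meval_eq => i; rewrite PsiE yg actM // mulmxA.
  have /= := @jacobian_eq0 K d Phi Psi (fun=> 0) hyp.
  rewrite -det_tr => <-; congr (\det _); apply/matrixP => j i; rewrite !mxE.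
  symmetry; rewrite mderiv_mline; case: (@split_ordP 1 d j) => {}j ->.
    rewrite (ord1 j) (_ : mline _ _ _ = \sum_k L k i *: y k); last first.
      apply: poly_ext => t; rewrite horner_mline PsiE horner_sum.
      apply: eq_bigr => k _; rewrite hornerZ; congr (_ * _).
      rewrite (_ : H _ = 1%:M); last first.
        rewrite -H0; apply: Hext => l; rewrite /lft add0r.
        by rewrite -val_eqE /= mulr0.
      by rewrite act1 mul1mx mxE eqxx mulr1 add0r.
    rewrite raddf_sum horner_sum; apply: eq_bigr => k _ /=.
    by rewrite derivZ hornerZ col_mxEu mxE mulrC.
  rewrite (_ : mline _ _ _ = \sum_k L k i *: \sum_l v l 0 *:
     lineR 1%:M (B j) (coefs r k l)); last first.
    apply: poly_ext => t; rewrite horner_mline PsiE horner_sum.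
    apply: eq_bigr => k _; rewrite hornerZ; congr (_ * _).
    rewrite (Hext _ (fun k => t * (k == j)%:R)); last first.
      by move=> l; rewrite /lft add0r (inj_eq (@rshift_inj 1 d)).
    rewrite (_ : \col__ _ = v); last first.
      rewrite -[RHS]y0; apply/colP => l; rewrite !mxE add0r.
      by rewrite -val_eqE /= mulr0.
    rewrite HB mxE horner_sum; apply: eq_bigr => l _.
    by rewrite hornerZ horner_lineR mul1mx actE ?det_unip // mulrC.
  rewrite raddf_sum horner_sum; apply: eq_bigr => k _ /=.
  rewrite derivZ hornerZ col_mxEd !mxE mulrC raddf_sum horner_sum.
  congr (_ * _); apply: eq_bigr => l _ /=.
  by rewrite derivZ hornerZ deriv_lineR mxE mulrC.
have rkW : (\rank (col_mx eta U) < 1 + d)%N.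
  rewrite ltn_neqAle rank_leq_row andbT; apply/negP => /row_freeP[L WL].
  by have := LW L; rewrite WL det1 => /eqP; rewrite oner_eq0.
have sU : (U <= col_mx eta U)%MS by rewrite -addsmxE addsmxSr.
have rkU : \rank U = d by apply/eqP.
have /eqmxP : (U == col_mx eta U)%MS.
  rewrite -(geq_leqif (mxrank_leqif_eq sU)) rkU.
  by rewrite -ltnS.
by move=> ->; rewrite -addsmxE addsmxSl.
Qed.

End Tangency.

(** * Weights *)

Section Weights.
Context (K : numClosedFieldType) (n : nat) (r : polyrep K n).
Local Notation MP := {mpoly K[2 * 2]}.
Local Notation mev g p := (meval (fun k => mxvec g 0 k) p).
Implicit Types (g A : 'M[K]_2) (v x : 'cV[K]_n) (z : K) (k : int).

Definition tz z : 'M[K]_2 := mk2 z 0 0 z^-1.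

Lemma det_tz z : z != 0 -> \det (tz z) = 1.
Proof. by move=> z0; rewrite det_mk2 mulfV // mulr0 subr0. Qed.

Lemma tz1 : tz 1 = 1%:M.
Proof. by rewrite mk2_1 /tz invr1. Qed.

Definition mweight (m : 'X_{1..2 * 2}) : int := (m (@va))%:Z - (m vd)%:Z.
Definition mdiag (m : 'X_{1..2 * 2}) := (m vb == 0%N) && (m vc == 0%N).

(** The coefficient of z^k in p(diag(z, 1/z)): the off-diagonal entries vanish there, and a^i d^j
    becomes z^(i - j). *)
Definition wcoef k (p : MP) : K :=
  \sum_(m <- msupp p | mdiag m && (mweight m == k)) p@_m.

Lemma sum_by_weight N (F : 'X_{1..2 * 2} -> K) (p : MP) : (msize p <= N)%N ->
  \sum_(m <- msupp p | mdiag m) F m =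
  \sum_(l < N.*2.+1) \sum_(m <- msupp p | mdiag m && (mweight m == l%:Z - N%:Z)) F m.
Proof.
move=> pN; rewrite (exchange_big_dep mdiag) /=; last by move=> i j _ /andP[].
rewrite [LHS]big_seq_cond [RHS]big_seq_cond; apply: eq_bigr => m /andP[mp dm].
have lm : (mdeg m < N)%N by apply: leq_trans pN; apply: msize_mdeg_lt.
have wm : (`|mweight m| <= N)%N.
  by move: lm; rewrite mdegE big_mxvec /mweight /=; lia.
have lN : (absz (mweight m + N%:Z)%R < N.*2.+1)%N by lia.
rewrite (bigD1 (Ordinal lN)) /=; last by rewrite dm; apply/eqP; lia.
rewrite big1 ?addr0 // => i /andP[/andP[_ /eqP e] ni].
by case/eqP: ni; apply: val_inj => /=; lia.
Qed.

Lemma mev_tz z m : z != 0 ->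
  mev (tz z) ('X_[m] : MP) = if mdiag m then z ^ mweight m else 0.
Proof.
move=> z0; rewrite mevalX big_mxvec_prod !mxvecE !mxE /= /mdiag /mweight.
case: (m vb) => [|b]; last by rewrite exprS mul0r mulr0 mul0r.
case: (m vc) => [|c]; last by rewrite !expr0n /= mul0r mulr0.
by rewrite !expr0 mulr1 mul1r expfzDr // -exprz_inv -!exprnP.
Qed.

Lemma DLH_X m : DL (mH K) 'X_[m] =
  ((m va)%:R - (m vb)%:R + (m vc)%:R - (m vd)%:R) *: 'X_[m].
Proof.
have H i : 'X_i * ('X_[m])^`M(i) = (m i)%:R *: 'X_[m] :> MP.
  rewrite mderivX -scalerAr -mpolyXD; case: (posnP (m i)) => [->|mi].
    by rewrite !scale0r.
  congr (_ *: 'X_[_]); apply/mnmP => j; rewrite mnmDE mnmBE mnm1E.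
  by case: eqP => [<-|_]; [rewrite add1n subn1 prednK | rewrite add0n subn0].
rewrite DLE mul_gX_mk2 Der4 !mxE /= !scale0r !scale1r !scaleN1r !addr0 !add0r !mulNr.
by rewrite !H -!scaleNr -!scalerDl addrA.
Qed.

Lemma mev_tz_sum N p z : (msize p <= N)%N -> z != 0 ->
  mev (tz z) p = \sum_(l < N.*2.+1) wcoef (l%:Z - N%:Z) p * z ^ (l%:Z - N%:Z).
Proof.
move=> pN z0; rewrite {1}[p]mpolyE raddf_sum /=.
transitivity (\sum_(m <- msupp p | mdiag m) p@_m * z ^ mweight m).
  rewrite [RHS]big_mkcond /=; apply: eq_bigr => m _; rewrite mevalZ mev_tz //.
  by case: ifP => // _; rewrite mulr0.
rewrite (sum_by_weight _ pN); apply: eq_bigr => l _.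
by rewrite mulr_suml; apply: eq_bigr => m /andP[_ /eqP ->].
Qed.

Lemma mev_tz_DLH N p z : (msize p <= N)%N -> z != 0 ->
  mev (tz z) (DL (mH K) p) =
  \sum_(l < N.*2.+1) (l%:Z - N%:Z)%:~R * (wcoef (l%:Z - N%:Z) p * z ^ (l%:Z - N%:Z)).
Proof.
move=> pN z0; rewrite {1}[p]mpolyE DL_sum raddf_sum /=.
transitivity (\sum_(m <- msupp p | mdiag m) (mweight m)%:~R * (p@_m * z ^ mweight m)).
  rewrite [RHS]big_mkcond /=; apply: eq_bigr => m _.
  rewrite -mul_mpolyC DLM DLC mul0r add0r mevalM mevalC DLH_X mevalZ mev_tz //.
  rewrite /mdiag /mweight; case: eqP => [->|]; case: eqP => [->|] /=; rewrite ?mulr0 //.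
  by rewrite subr0 addr0 intrB mulrCA.
rewrite (sum_by_weight _ pN); apply: eq_bigr => l _.
rewrite mulr_suml mulr_sumr; apply: eq_bigr => m /andP[_ /eqP ->].
by [].
Qed.

Definition wvec v k : 'cV[K]_n := \col_i wcoef k (orbit_fun r v i).

(** All weights lie between -N and N for this N, hence the sums over l < 2N + 1 with weight l -
    N. *)
Definition wbound v := \max_i msize (orbit_fun r v i).

Lemma act_tz v z : z != 0 ->
  let N := wbound v in
  r (tz z) *m v = \sum_(l < N.*2.+1) z ^ (l%:Z - N%:Z) *: wvec v (l%:Z - N%:Z).
Proof.
move=> z0 N; apply/colP => i; rewrite -mev_orbit_fun ?det_tz //.
rewrite (@mev_tz_sum N) //; last exact: leq_bigmax.
by rewrite summxE; apply: eq_bigr => l _; rewrite !mxE mulrC.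
Qed.

Lemma tr_mH : \tr (mH K) = 0. Proof. by rewrite tr_mk2 subrr. Qed.

Lemma act_tz_H v z : z != 0 ->
  let N := wbound v in
  r (tz z) *m (dr r (mH K) *m v) =
  \sum_(l < N.*2.+1) z ^ (l%:Z - N%:Z) *: ((l%:Z - N%:Z)%:~R *: wvec v (l%:Z - N%:Z)).
Proof.
move=> z0 N; apply/colP => i; rewrite -mev_DL_orbit_fun ?det_tz ?tr_mH //.
rewrite (@mev_tz_DLH N) //; last exact: leq_bigmax.
by rewrite summxE; apply: eq_bigr => l _; rewrite !mxE [LHS]mulrA [LHS]mulrC.
Qed.

Lemma laurent_vec N (W : int -> 'cV[K]_n) :
  (forall z, z != 0 -> \sum_(l < N.*2.+1) z ^ (l%:Z - N%:Z) *: W (l%:Z - N%:Z) = 0) ->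
  forall l : nat, (l < N.*2.+1)%N -> W (l%:Z - N%:Z) = 0.
Proof.
move=> H l lN; apply/colP => i; rewrite mxE.
have := @laurent_coef K _ (index_enum 'I_(N.*2.+1)) (fun l => W (l%:Z - N%:Z) i 0)
  (fun l => l%:Z - N%:Z) (l%:Z - N%:Z).
rewrite (big_pred1 (Ordinal lN)) => [|j]; last first.
  by apply/eqP/eqP => [e|->//]; apply: val_inj => /=; lia.
apply=> z z0; have := congr1 (fun u : 'cV_n => u i 0) (H z z0).
rewrite mxE summxE => e; rewrite -[RHS]e; apply: eq_bigr => j _.
by rewrite mxE mulrC.
Qed.

Lemma wvec_out v k : (wbound v < `|k|)%N -> wvec v k = 0.
Proof.
move=> kN; apply/colP => i; rewrite !mxE /wcoef big_seq_cond big1 // => m.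
case/andP => mp /andP[_ /eqP wm].
have : (mdeg m < wbound v)%N.
  by apply: leq_trans (msize_mdeg_lt mp) _; exact: leq_bigmax.
by move: wm; rewrite mdegE big_mxvec /mweight /=; lia.
Qed.

Lemma all_weights v (P : int -> Prop) :
  (forall k, wvec v k = 0 -> P k) ->
  (forall l : nat, (l < (wbound v).*2.+1)%N -> P (l%:Z - (wbound v)%:Z)) ->
  forall k, P k.
Proof.
move=> P0 PI k; have [kN|kN] := leqP `|k|%N (wbound v); last by apply/P0/wvec_out.
have -> : k = (absz (k + (wbound v)%:Z))%:Z - (wbound v)%:Z by lia.
by apply: PI; lia.
Qed.

(** With t(z) = diag(z, 1/z), which commutes with H, expand H t(z) v = t(z) H v in powers of z; the
    right side is z d/dz of t(z) v. *)
Lemma wvecH v k : dr r (mH K) *m wvec v k = k%:~R *: wvec v k.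
Proof.
apply: (@all_weights v (fun k => dr r (mH K) *m wvec v k = k%:~R *: wvec v k)).
  by move=> {}k ->; rewrite mulmx0 scaler0.
move=> l lN; apply/eqP; rewrite -subr_eq0; apply/eqP.
apply: (@laurent_vec _ (fun k => dr r (mH K) *m wvec v k - k%:~R *: wvec v k)) l lN.
move=> z z0; under eq_bigr => l _ do rewrite scalerBr scalemxAr.
rewrite sumrB -mulmx_sumr -act_tz // -act_tz_H // !mulmxA dr_conj ?det_tz ?tr_mH //.
suff -> : tz z *m mH K *m invmx (tz z) = mH K by rewrite subrr.
apply: (can_inj (mulmxK (SL_unit (det_tz z0)))).
by rewrite mulmxKV ?SL_unit ?det_tz // /tz /mH !mk2M; congr mk2; ring.
Qed.

(** Conjugation by diag(z, 1/z) only scales E, so E kills diag(z, 1/z) v for all z, hence each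
    coefficient. *)
Lemma wvecE v : dr r (mE K) *m v = 0 -> forall k, dr r (mE K) *m wvec v k = 0.
Proof.
move=> Ev; apply: (@all_weights v (fun k => dr r (mE K) *m wvec v k = 0)).
  by move=> k ->; rewrite mulmx0.
apply: (@laurent_vec _ (fun k => dr r (mE K) *m wvec v k)) => z z0.
under eq_bigr => l _ do rewrite scalemxAr.
rewrite -mulmx_sumr -act_tz //.
have e : tz z *m (z ^- 2 *: mE K) *m invmx (tz z) = mE K.
  apply: (can_inj (mulmxK (SL_unit (det_tz z0)))).
  rewrite mulmxKV ?SL_unit ?det_tz // /tz /mE !mk2E.
  by congr mk2; field.
have [trE _] := nilpE K.
rewrite mulmxA -{1}e -dr_conj ?det_tz ?linearZ /= ?trE ?mulr0 //.
by rewrite drZ -mulmxA -scalemxAl Ev scaler0 mulmx0.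
Qed.

Lemma wvec_sum v : v = \sum_(l < (wbound v).*2.+1) wvec v (l%:Z - (wbound v)%:Z).
Proof.
have := @act_tz v 1 (oner_neq0 _); rewrite tz1 act1 mul1mx => {1}->.
by apply: eq_bigr => l _; rewrite exp1rz scale1r.
Qed.

Lemma wvecH0 v : dr r (mH K) *m v = 0 -> forall k, k != 0 -> wvec v k = 0.
Proof.
move=> Hv k k0; suff : k%:~R *: wvec v k = 0.
  by move/eqP; rewrite scaler_eq0 intr_eq0 (negPf k0) => /eqP.
apply: (@all_weights v (fun k => k%:~R *: wvec v k = 0)) => [j ->|].
  by rewrite scaler0.
apply: (@laurent_vec _ (fun k => k%:~R *: wvec v k)) => z z0.
by rewrite -act_tz_H // Hv mulmx0.
Qed.

Lemma act_tz_fix v z : dr r (mH K) *m v = 0 -> z != 0 -> r (tz z) *m v = v.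
Proof.
move=> Hv z0; rewrite [RHS]wvec_sum act_tz //; apply: eq_bigr => l _.
have [->|k0] := eqVneq (l%:Z - (wbound v)%:Z) 0; first by rewrite scale1r.
by rewrite wvecH0 // scaler0.
Qed.

End Weights.

(** * Affine maps preserving an orbit, and their tangency *)

Section AffineStabilizer.
Context (K : numClosedFieldType) (n : nat) (r : polyrep K n).
Local Notation MP := {mpoly K[2 * 2]}.
Local Notation mev g p := (meval (fun k => mxvec g 0 k) p).
Implicit Types (g h A : 'M[K]_2) (v x y c : 'cV[K]_n) (M : 'M[K]_n) (t : K).

Definition orbit v x := exists2 g, \det g = 1 & x = r g *m v.

Definition stabilizes v M c :=
  [/\ M \in unitmx, forall x, orbit v x -> orbit v (M *m x + c)
    & forall y, orbit v y -> orbit v (invmx M *m (y - c))].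

(** The fields Y_A take at v values in sl_2 v, the tangent space of the orbit. *)
Definition tangent_at v M c := forall A, \tr A = 0 ->
  exists2 X, \tr X = 0 & invmx M *m (dr r A *m (M *m v + c)) = dr r X *m v.

Lemma orbit_refl v : orbit v v.
Proof. by exists 1%:M; rewrite ?det1 // act1 mul1mx. Qed.

Lemma orbit_act v x g : \det g = 1 -> orbit v x -> orbit v (r g *m x).
Proof.
by move=> g1 [h h1 ->]; exists (g *m h); rewrite ?det_mulmx ?g1 ?mul1r // actM // mulmxA.
Qed.

Lemma orbit_base v g x : \det g = 1 -> orbit (r g *m v) x <-> orbit v x.
Proof.
move=> g1; split=> -[h h1 ->].
  exists (h *m g); first by rewrite det_mulmx g1 h1 mulr1.
  by rewrite actM // mulmxA.
exists (h *m invmx g); first by rewrite det_mulmx h1 det_invmx // mulr1.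
by rewrite actM ?det_invmx // -!mulmxA [r (invmx g) *m _]mulmxA actVK // mul1mx.
Qed.

Lemma stabilizes_base v M c g : \det g = 1 ->
  stabilizes v M c -> stabilizes (r g *m v) M c.
Proof.
by move=> g1 [uM fO fV]; split=> // x /(orbit_base v x g1) xO;
  apply/(orbit_base v _ g1); auto.
Qed.

Lemma invmxM (B D : 'M[K]_n) : B \in unitmx -> D \in unitmx ->
  invmx (B *m D) = invmx D *m invmx B.
Proof.
move=> uB uD; apply: (can_inj (mulmxK (_ : B *m D \in unitmx))).
  by rewrite unitmx_mul uB.
by rewrite mulVmx ?unitmx_mul ?uB // -mulmxA (mulmxA (invmx B)) mulVmx // mul1mx mulVmx.
Qed.

Lemma inv_act g : \det g = 1 -> invmx (r g) = r (invmx g).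
Proof.
move=> g1; apply: (can_inj (mulmxK (act_unit r g1))).
by rewrite mulVmx ?act_unit // actVK.
Qed.

Lemma stabilizes_act v M c g : \det g = 1 ->
  stabilizes v M c -> stabilizes v (M *m r g) c.
Proof.
move=> g1 [uM fO fV]; split=> [|x xO|y yO].
- by rewrite unitmx_mul uM act_unit.
- by rewrite -mulmxA; apply: fO; apply: orbit_act.
- rewrite invmxM ?act_unit // inv_act // -mulmxA.
  by apply: orbit_act; rewrite ?det_invmx //; apply: fV.
Qed.

Lemma dr_sum (I : Type) (s : seq I) (P : pred I) (f : I -> 'M[K]_2) :
  dr r (\sum_(i <- s | P i) f i) = \sum_(i <- s | P i) dr r (f i).
Proof. exact: (big_morph _ (drD r) (dr0 r)). Qed.

(** With f(x) = Mx + c and A nilpotent, the curve t |-> f^-1((1 + tA) f(v)) is polynomial, lies in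
    the orbit and has velocity Y_A(v) at t = 0, so [tangent_span] applies; nilpotents span sl_2. *)
Lemma tangent_chart d (Hp : 'M[{mpoly K[d]}]_2) (H : ('I_d -> K) -> 'M[K]_2)
    (B : 'I_d -> 'M[K]_2) v (a : K) :
  (forall u i j, (Hp i j).@[u] = H u i j) -> (forall u, \det (H u) = 1) ->
  (forall j, nilp (B j)) -> H (fun=> 0) = 1%:M ->
  (forall j t, H (fun k => t * (k == j)%:R) = 1%:M + t *: B j) ->
  (forall g, \det g = 1 -> a * g 1 0 + g 1 1 != 0 ->
    exists u, r g *m v = r (H u) *m v) ->
  row_free (\matrix_j (dr r (B j) *m v)^T) ->
  forall M c, stabilizes v M c -> tangent_at v M c.
Proof.
move=> HpE detH nB H0 HB dense freeU M c [uM fO fV].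
set U := \matrix_j _ in freeU.
have Hn A : nilp A -> ((invmx M *m (dr r A *m (M *m v + c)))^T <= U)%MS.
  move=> nA; pose z := M *m v + c.
  pose y (i : 'I_n) : {poly K} := \sum_k invmx M i k *:
    (\sum_l z l 0 *: lineR 1%:M A (coefs r k l) - (c k 0)%:P).
  have yE t : \col_i (y i).[t] = invmx M *m (r (1%:M + t *: A) *m z - c).
    apply/colP => i; rewrite !mxE horner_sum; apply: eq_bigr => k _.
    rewrite hornerZ hornerD hornerN hornerC !mxE horner_sum; congr (_ * (_ - _)).
    apply: eq_bigr => l _; rewrite hornerZ horner_lineR mul1mx mulrC.
    by rewrite -actE ?det_unip.
  have yO t : orbit v (\col_i (y i).[t]).
    rewrite yE; apply: fV; apply: orbit_act; first exact: det_unip.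
    by apply: fO; apply: orbit_refl.
  have y0 : \col_i (y i).[0] = v.
    by rewrite yE scale0r addr0 act1 mul1mx /z addrK mulmxA mulVmx // mul1mx.
  have := tangent_span HpE detH nB H0 HB (orbit_dense dense) yO y0 freeU.
  suff -> : \row_i (y i)^`().[0]%R = (invmx M *m (dr r A *m z))^T by [].
  apply/rowP => i; rewrite !mxE raddf_sum horner_sum; apply: eq_bigr => k _ /=.
  rewrite derivZ hornerZ mxE; congr (_ * _).
  rewrite derivB derivC subr0 raddf_sum horner_sum; apply: eq_bigr => l _ /=.
  by rewrite derivZ hornerZ deriv_lineR [dr r A k l]mxE mulrC.
move=> A trA.
have /submxP[w wE] : ((invmx M *m (dr r A *m (M *m v + c)))^T <= U)%MS.
  move: (M *m v + c) Hn => z Hn.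
  rewrite (drEFN r trA) !mulmxDl !mulmxDr -!scalemxAl -!scalemxAr !linearD !linearZ /=.
  by rewrite !addmx_sub ?scalemx_sub ?(Hn _ (nilpE K)) ?(Hn _ (nilpF K)) ?(Hn _ (nilpN K)).
exists (\sum_j w 0 j *: B j).
  rewrite raddf_sum big1 // => j _; rewrite /= mxtraceZ.
  by have [-> _] := nB j; rewrite mulr0.
rewrite dr_sum mulmx_suml; apply: trmx_inj; rewrite wE mulmx_sum_row raddf_sum /=.
by apply: eq_bigr => j _; rewrite rowK drZ -scalemxAl linearZ.
Qed.

Lemma row_free2 (d : nat) (u : 'I_d -> 'cV[K]_n) :
  (forall w : 'rV[K]_d, \sum_j w 0 j *: u j = 0 -> w = 0) ->
  row_free (\matrix_j (u j)^T).
Proof.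
move=> H; apply/inj_row_free => w w0; apply: H; apply: trmx_inj.
rewrite trmx0 -[RHS]w0 mulmx_sum_row raddf_sum; apply: eq_bigr => j _ /=.
by rewrite rowK linearZ.
Qed.

Lemma SL2_EFN g : \det g = 1 -> g 1 0 + g 1 1 != 0 ->
  exists s t u, g = mk2 (1 + s * t) s t 1 *m (1%:M + u *: mN K).
Proof.
move=> g1 e0; pose e := g 1 0 + g 1 1; pose m := g 0 0 + g 0 1.
(* Chosen so that g(1 - uN) has lower right entry 1; right multiplication by 1 + uN does not change
   g_10 + g_11. *)
pose u := (1 - g 1 1) / e.
exists (g 0 0 * u + g 0 1 * (1 + u)), (g 1 0 - 1 + g 1 1), u.
have -> : 1%:M + u *: mN K = mk2 (1 + u) (- u) u (1 - u).
  by rewrite !mk2E; congr mk2; ring.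
rewrite mk2M [LHS](_ : _ = mk2 (g 0 0) (g 0 1) (g 1 0) (g 1 1)); last exact: mk2_eta.
have e1 : g 1 1 = e - g 1 0 by rewrite /e; ring.
have e2 : g 0 1 = m - g 0 0 by rewrite /m; ring.
have e3 : g 0 0 = (1 + g 1 0 * m) / e.
  apply: (mulIf e0); rewrite mulfVK // -g1 det_mk2E /e /m; ring.
have ne0 : e != 0 := e0.
rewrite /u e2 e3 e1; move: ne0; generalize (g 1 0) m e => c' m' e' ne0.
by congr mk2; field.
Qed.

(** The third chart direction is N rather than H, because the chart has to be polynomial with
    nilpotent coordinate directions. Its image contains the cell where g_10 + g_11 is nonzero. *)
Lemma tangent_dim3 v :
  (forall A, \tr A = 0 -> dr r A *m v = 0 -> A = 0) ->
  forall M c, stabilizes v M c -> tangent_at v M c.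
Proof.
move=> free.
pose B (j : 'I_3) := if j == 0 then mE K else if j == 1 then mF K else mN K.
pose H (u : 'I_3 -> K) :=
  (1%:M + u 0 *: mE K) *m (1%:M + u 1 *: mF K) *m (1%:M + u 2 *: mN K).
pose x (i : 'I_3) : {mpoly K[3]} := 'X_i.
pose Hp := mk2 1 (x 0) 0 1 *m mk2 1 0 (x 1) 1 *m mk2 (1 + x 2) (- x 2) (x 2) (1 - x 2).
have unipN t : 1%:M + t *: mN K = mk2 (1 + t) (- t) t (1 - t).
  by rewrite !mk2E; congr mk2; ring.
have nB j : nilp (B j).
  rewrite /B; case: eqP => _; first exact: nilpE.
  by case: eqP => _; [apply: nilpF | apply: nilpN].
apply: (@tangent_chart 3 Hp H B v 1) => //.
- move=> u i j; rewrite /Hp /H unipE unipF unipN !mk2M; move: i j.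
  apply: ord2P; apply: ord2P; rewrite !mxE /=;
  by rewrite !(mevalD, mevalB, mevalN, mevalM, meval1, meval0, mevalXU).
- move=> u; rewrite /H !det_mulmx !det_unip ?mulr1 //;
    [exact: nilpN | exact: nilpF | exact: nilpE].
- by rewrite /H !scale0r !addr0 !mulmx1.
- move=> j t; rewrite /H /B; case: j => -[|[|[|//]]] lj.
  + by rewrite /= !mulr0 !scale0r !addr0 !mulmx1 mulr1.
  + by rewrite /= !mulr0 !scale0r !addr0 !mulmx1 mul1mx mulr1.
  + by rewrite /= !mulr0 !scale0r !addr0 !mul1mx mulr1.
- move=> g g1; rewrite mul1r => /(SL2_EFN g1)[s [t [u ->]]].
  exists (fun i : 'I_3 => if i == 0 then s else if i == 1 then t else u).
  congr (r _ *m v); rewrite /H /= unipE unipF mk2M; congr (mk2 _ _ _ _ *m _); ring.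
- apply: row_free2 => w w0.
  have trB : \tr (\sum_j w 0 j *: B j) = 0.
    rewrite raddf_sum big1 // => j _; rewrite /= mxtraceZ.
    by have [-> _] := nB j; rewrite mulr0.
  have /(free _ trB) : dr r (\sum_j w 0 j *: B j) *m v = 0.
    rewrite dr_sum mulmx_suml -[RHS]w0; apply: eq_bigr => j _.
    by rewrite drZ -scalemxAl.
  rewrite !big_ord_recl big_ord0 addr0 /B /= !mk2E => /matrixP e.
  have := e 0 0; have := e 0 1; have := e 1 0; rewrite !mxE /=.
  rewrite !mulr0 !mulr1 !add0r mulrN1 => e10 e01 e00.
  move: e10 e01; rewrite e00 oppr0 !addr0 => e10 e01.
  apply/rowP => j; rewrite mxE; case: j => -[|[|[|//]]] lj.
  + by rewrite -[RHS]e01; congr (w _ _); apply: val_inj.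
  + by rewrite -[RHS]e10; congr (w _ _); apply: val_inj.
  + by rewrite -[RHS]e00; congr (w _ _); apply: val_inj.
Qed.

(** A dense part of the orbit must be reached by (1 + sE)(1 + tF) alone, the stabilizer supplying
    the missing direction: a = 0 when it is the torus, a = 1 when it consists of the 1 + uN. *)
Lemma tangent_dim2 v (a : K) :
  (forall s t, dr r (s *: mE K + t *: mF K) *m v = 0 -> s = 0 /\ t = 0) ->
  (forall g, \det g = 1 -> a * g 1 0 + g 1 1 != 0 ->
    exists s t, r g *m v = r (mk2 (1 + s * t) s t 1) *m v) ->
  forall M c, stabilizes v M c -> tangent_at v M c.
Proof.
move=> free dense.
pose B (j : 'I_2) := if j == 0 then mE K else mF K.
pose H (u : 'I_2 -> K) := (1%:M + u 0 *: mE K) *m (1%:M + u 1 *: mF K).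
pose x (i : 'I_2) : {mpoly K[2]} := 'X_i.
pose Hp := mk2 1 (x 0) 0 1 *m mk2 1 0 (x 1) 1.
have nB j : nilp (B j).
  by rewrite /B; case: eqP => _; [apply: nilpE | apply: nilpF].
apply: (@tangent_chart 2 Hp H B v a) => //.
- move=> u i j; rewrite /Hp /H unipE unipF !mk2M; move: i j.
  apply: ord2P; apply: ord2P; rewrite !mxE /=;
  by rewrite !(mevalD, mevalB, mevalN, mevalM, meval1, meval0, mevalXU).
- by move=> u; rewrite /H !det_mulmx !det_unip ?mulr1 //; [exact: nilpF | exact: nilpE].
- by rewrite /H !scale0r !addr0 !mulmx1.
- move=> j t; rewrite /H /B; case: j => -[|[|//]] lj.
  + by rewrite /= !mulr0 !scale0r !addr0 !mulmx1 mulr1.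
  + by rewrite /= !mulr0 !scale0r !addr0 !mul1mx mulr1.
- move=> g g1 /(dense g g1)[s [t ->]].
  exists (fun i : 'I_2 => if i == 0 then s else t).
  by congr (r _ *m v); rewrite /H /= unipE unipF mk2M; congr mk2; ring.
- apply: row_free2 => w; rewrite !big_ord_recl big_ord0 addr0 /B /= !scalemxAl -!drZ.
  rewrite -mulmxDl -drD => /free[e0 e1].
  apply/rowP => j; rewrite mxE; case: j => -[|[|//]] lj.
  + by rewrite -[RHS]e0; congr (w _ _); apply: val_inj.
  + by rewrite -[RHS]e1; congr (w _ _); apply: val_inj.
Qed.

(** Tangency at v is applied to f composed with g, which also preserves the orbit and sends v to
    f(gv); g then transports the conclusion. *)
Lemma tangent_orbit v g M c : \det g = 1 ->
  (forall M c, stabilizes v M c -> tangent_at v M c) ->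
  stabilizes v M c -> tangent_at (r g *m v) M c.
Proof.
move=> g1 tan st A trA.
have [X trX XE] := tan _ _ (stabilizes_act g1 st) A trA.
exists (g *m X *m invmx g); first by rewrite tr_conj.
have [uM _ _] := st.
rewrite [RHS]mulmxA -dr_conj // -[RHS]mulmxA -XE invmxM ?act_unit // !mulmxA.
by rewrite mulmxV ?act_unit // mul1mx.
Qed.

End AffineStabilizer.

(** * Divergence of the conjugated fields *)

Section Divergence.
Context (K : numClosedFieldType) (n : nat) (r : polyrep K n).
Local Notation MP := {mpoly K[2 * 2]}.
Local Notation mev g p := (meval (fun k => mxvec g 0 k) p).
Local Notation E := (mE K).
Local Notation F := (mF K).
Local Notation H := (mH K).
Implicit Types (g h A B : 'M[K]_2) (v x y c : 'cV[K]_n) (M : 'M[K]_n) (t : K).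

Lemma lin3E (a b d : K) (x y z : 'cV[K]_n) i :
  (a *: x + b *: y + d *: z) i 0 = a * x i 0 + b * y i 0 + d * z i 0.
Proof. by rewrite !mxE. Qed.

Lemma vsubE (x y : 'cV[K]_n) i : (x - y) i 0 = x i 0 - y i 0.
Proof. by rewrite !mxE. Qed.

Lemma trE : \tr E = 0. Proof. by case: (nilpE K). Qed.
Lemma trF : \tr F = 0. Proof. by case: (nilpF K). Qed.
Lemma trH : \tr H = 0. Proof. exact: tr_mH. Qed.

Lemma unip_fix A t x : nilp A -> dr r A *m x = 0 -> r (1%:M + t *: A) *m x = x.
Proof.
move=> nA Ax; have [N HN] := ucoef_bound r A.
rewrite (@act_unip _ _ r A t N.+1) //; last by move=> k /ltnW; apply: HN.
rewrite mulmx_suml big_ord_recl expr0 scale1r ucoef0 mul1mx big1 ?addr0 // => i _.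
suff u0 k : ucoef r A k.+1 *m x = 0 by rewrite -scalemxAl u0 scaler0.
have : k.+1%:R *: (ucoef r A k.+1 *m x) = 0.
  elim: k => [|k IH]; rewrite scalemxAl ucoefS // -mulmxA.
    by rewrite ucoef0 mul1mx.
  by move/eqP: IH; rewrite scaler_eq0 pnatr_eq0 /= => /eqP ->; rewrite mulmx0.
by move/eqP; rewrite scaler_eq0 pnatr_eq0 /= => /eqP.
Qed.

Lemma fixed_by_sl2 x : dr r E *m x = 0 -> dr r F *m x = 0 ->
  forall g, \det g = 1 -> r g *m x = x.
Proof.
move=> Ex Fx.
apply: SL2_ind => [t|t|g h g1 h1 Hg Hh].
- exact: unip_fix (nilpE K) Ex.
- exact: unip_fix (nilpF K) Fx.
- by rewrite actM // -mulmxA Hh Hg.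
Qed.

Lemma no_zero_DL (q : MP) : (forall g, \det g = 1 -> mev g q != 0) ->
  forall A, \tr A = 0 -> forall g, \det g = 1 -> mev g (DL A q) = 0.
Proof.
move=> q0 A trA g g1.
have Hn B : nilp B -> mev g (DL B q) = 0.
  move=> nB; rewrite -deriv_lineR poly_no_root ?horner0 // => t.
  by rewrite horner_lineR q0 // det_mulmx g1 mul1r det_unip.
rewrite (sl2_decomp trA) mevDLD mevDLD !mevDLZ (Hn _ (nilpE K)) (Hn _ (nilpF K)).
by rewrite (Hn _ (nilpN K)) !mulr0 !addr0.
Qed.

Section Frame.
Context (v : 'cV[K]_n) (M : 'M[K]_n) (c : 'cV[K]_n).
Hypothesis uM : M \in unitmx.

(* [vfield A] is the conjugate by [x |-> M x + c] of the linear vector field [A]. *)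
Definition vfield A x : 'cV[K]_n := invmx M *m (dr r A *m (M *m x + c)).

(** Polynomial coordinates of Y_A along the orbit in the left invariant frame: the field attached to
    X takes the value g X v at gv. *)
Definition frame A (bE bF bH : MP) := forall g, \det g = 1 ->
  vfield A (r g *m v) = r g *m (mev g bE *: (dr r E *m v) + mev g bF *: (dr r F *m v)
                              + mev g bH *: (dr r H *m v)).

Definition vfield_fun A i : MP :=
  \sum_k (invmx M *m dr r A *m M) i k *: orbit_fun r v k
  + ((invmx M *m (dr r A *m c)) i 0)%:MP.

Lemma mev_vfield_fun A g i : \det g = 1 ->
  mev g (vfield_fun A i) = vfield A (r g *m v) i 0.
Proof.
move=> g1; rewrite mevalD mevalC /vfield !mulmxDr [RHS]mxE; congr (_ + _).
rewrite !mulmxA -(mulmxA _ (r g)) [RHS]mxE raddf_sum; apply: eq_bigr => k _ /=.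
by rewrite mevalZ mev_orbit_fun.
Qed.

Lemma DL_orbit_fun2 A B g i : \tr A = 0 -> \tr B = 0 -> \det g = 1 ->
  mev g (DL A (DL B (orbit_fun r v i))) = (r g *m (dr r A *m (dr r B *m v))) i 0.
Proof.
move=> trA trB g1.
have e : eqSL (DL B (orbit_fun r v i)) (orbit_fun r (dr r B *m v) i).
  by move=> h h1; rewrite mev_DL_orbit_fun // mev_orbit_fun.
by rewrite (eqSL_DL trA e) // mev_DL_orbit_fun.
Qed.

Lemma frame_eqSL A bE bF bH i : frame A bE bF bH ->
  eqSL (vfield_fun A i) (bE * DL E (orbit_fun r v i) + bF * DL F (orbit_fun r v i)
    + bH * DL H (orbit_fun r v i)).
Proof.
move=> fA g g1; rewrite mev_vfield_fun // fA // !mevalD !mevalM.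
rewrite !mev_DL_orbit_fun ?trE ?trF ?trH // !mulmxDr -!scalemxAr !mxE.
by congr (_ * _ + _ * _ + _ * _); rewrite !mxE.
Qed.

Definition div (bE bF bH : MP) := DL E bE + DL F bF + DL H bH.

(** Left translation of g, whose derivative is [DR A], does not change the average of gv; so the
    averaged vector is killed by A. *)
Lemma haar_DR_orbit A : (forall p : MP, haar (DR A p) = 0) -> \tr A = 0 ->
  dr r A *m (\col_i haar (orbit_fun r v i)) = 0.
Proof.
move=> hA trA; apply/colP => i; rewrite !mxE -[RHS](hA (orbit_fun r v i)).
rewrite [RHS](@haar_eqSL _ _ (\sum_k dr r A i k *: orbit_fun r v k)).
  by rewrite haar_sum; apply: eq_bigr => k _; rewrite haarZ; congr (_ * _); rewrite mxE.
move=> g g1.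
have -> : mev g (DR A (orbit_fun r v i)) = (dr r A *m (r g *m v)) i 0.
  rewrite mulmxA mxE DRE Der_sum raddf_sum; apply: eq_bigr => k _ /=.
  by rewrite DerM DerC mulr0 addr0 mevalM mevalC -DRE DR_coefs.
rewrite mxE raddf_sum; apply: eq_bigr => k _ /=.
by rewrite mevalZ mev_orbit_fun.
Qed.

Lemma div0_translation A bE bF bH :
  (forall x, (forall g, \det g = 1 -> r g *m x = x) -> x = 0) ->
  frame A bE bF bH -> eqSL (div bE bF bH) 0 -> dr r A *m c = 0.
Proof.
move=> noinv fA d0.
have h0 : \col_i haar (orbit_fun r v i) = 0.
  apply: noinv; apply: fixed_by_sl2; apply: haar_DR_orbit; rewrite ?trE ?trF //.
    exact: haar_DRE.
  exact: haar_DRF.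
have hx i : haar (orbit_fun r v i) = 0.
  by have /colP/(_ i) := h0; rewrite !mxE.
suff : invmx M *m (dr r A *m c) = 0.
  by move/(congr1 (mulmx M)); rewrite mulmxA mulmxV // mul1mx mulmx0.
apply/colP => i; rewrite [RHS]mxE.
transitivity (haar (vfield_fun A i)).
  rewrite haarD haarC haar_sum big1 ?add0r // => k _.
  by rewrite haarZ hx mulr0.
rewrite (haar_eqSL (frame_eqSL i fA)); move: (orbit_fun r v i) => q.
(* Integration by parts: the three [DL] terms have integral 0, so Y_A applied to the coordinate q
   integrates to minus the integral of the divergence times q. *)
have -> : bE * DL E q + bF * DL F q + bH * DL H q =
    DL E (bE * q) + DL F (bF * q) + DL H (bH * q) - div bE bF bH * q.
  rewrite /div !DLM.
  move: (DL E bE) (DL F bF) (DL H bH) (DL E q) (DL F q) (DL H q) => ? ? ? ? ? ?.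
  by ring.
rewrite !haarD haarN haar_DLE haar_DLF haar_DLH !add0r.
rewrite (@haar_eqSL _ _ 0) ?haar0 ?oppr0 // => g g1.
by rewrite mevalM d0 // meval0 mul0r.
Qed.

Definition nabla g (aE aF aH q : MP) :=
  mev g aE * mev g (DL E q) + mev g aF * mev g (DL F q) + mev g aH * mev g (DL H q).

Lemma dr_brackets :
  [/\ dr r E *m dr r F = dr r F *m dr r E + dr r H,
      dr r H *m dr r E = dr r E *m dr r H + 2%:R *: dr r E &
      dr r H *m dr r F = dr r F *m dr r H - 2%:R *: dr r F].
Proof.
have EF : E *m F - F *m E = H by rewrite /mE /mF /mH !mk2E; congr mk2; ring.
have HE : H *m E - E *m H = 2%:R *: E by rewrite /mE /mH !mk2E; congr mk2; ring.
have HF : H *m F - F *m H = - (2%:R *: F) by rewrite /mF /mH !mk2E; congr mk2; ring.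
split.
- by rewrite -EF -dr_comm ?trE ?trF // addrC subrK.
- by rewrite -drZ -HE -dr_comm ?trE ?trH // addrC subrK.
- by rewrite -drZ -drN -HF -dr_comm ?trF ?trH // addrC subrK.
Qed.

(** Coordinates of [Y_A, Y_B] = Y_(BA - AB), the bracket of linear fields having the sign opposite
    to that of matrices. The conclusion is a linear relation because E v, F v, H v are dependent
    when the stabilizer is a torus, a case it also has to serve. *)
Lemma frame_bracket A B aE aF aH bE bF bH (cE cF cH : K) g :
  \tr A = 0 -> \tr B = 0 -> \det g = 1 ->
  frame A aE aF aH -> frame B bE bF bH ->
  vfield (B *m A - A *m B) (r g *m v) = r g *m (cE *: (dr r E *m v) +
     cF *: (dr r F *m v) + cH *: (dr r H *m v)) ->
  (nabla g aE aF aH bE - nabla g bE bF bH aE +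
     2%:R * (mev g aH * mev g bE - mev g aE * mev g bH) - cE) *: (dr r E *m v) +
  (nabla g aE aF aH bF - nabla g bE bF bH aF -
     2%:R * (mev g aH * mev g bF - mev g aF * mev g bH) - cF) *: (dr r F *m v) +
  (nabla g aE aF aH bH - nabla g bE bF bH aH +
     (mev g aE * mev g bF - mev g aF * mev g bE) - cH) *: (dr r H *m v) = 0.
Proof.
move=> trA trB g1 fA fB fC.
apply: (can_inj (mulKmx (act_unit r g1))); rewrite mulmx0.
have [EF HE HF] := dr_brackets.
pose p X := r g *m (dr r X *m v).
pose pp X Y := r g *m (dr r X *m (dr r Y *m v)).
have key C dE dF dH X i : frame C dE dF dH -> \tr X = 0 ->
    ((invmx M *m dr r C *m M) *m p X) i 0 =
    mev g (DL X dE) * p E i 0 + mev g dE * pp X E i 0 +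
    (mev g (DL X dF) * p F i 0 + mev g dF * pp X F i 0) +
    (mev g (DL X dH) * p H i 0 + mev g dH * pp X H i 0).
  move=> fC' trX; have := eqSL_DL trX (frame_eqSL i fC') g1.
  rewrite !DLD !DLM !mevalD !mevalM !DL_orbit_fun2 ?trE ?trF ?trH //.
  rewrite !mev_DL_orbit_fun ?trE ?trF ?trH // => <-.
  rewrite DLC meval0 addr0 DL_sum raddf_sum mxE; apply: eq_bigr => k _ /=.
  by rewrite -mul_mpolyC DLM DLC mul0r add0r mevalM mevalC mev_DL_orbit_fun.
have comb C dE dF dH D eE eF eH i : frame C dE dF dH -> frame D eE eF eH ->
   ((invmx M *m dr r C *m M) *m vfield D (r g *m v)) i 0 =
     mev g eE * ((invmx M *m dr r C *m M) *m p E) i 0 +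
     mev g eF * ((invmx M *m dr r C *m M) *m p F) i 0 +
     mev g eH * ((invmx M *m dr r C *m M) *m p H) i 0.
  by move=> _ fD; rewrite fD // !mulmxDr -!scalemxAr lin3E.
have lie : vfield (B *m A - A *m B) (r g *m v) =
   (invmx M *m dr r B *m M) *m vfield A (r g *m v) -
   (invmx M *m dr r A *m M) *m vfield B (r g *m v).
  rewrite /vfield -dr_comm //; set z := _ + c.
  by rewrite mulmxBl mulmxBr -!mulmxA !(mulKVmx uM).
apply/colP => i.
have := congr1 (fun u : 'cV_n => u i 0) lie.
rewrite fC vsubE (comb _ _ _ _ _ _ _ _ i fB fA) (comb _ _ _ _ _ _ _ _ i fA fB).
rewrite !(key _ _ _ _ _ i fA) ?trE ?trF ?trH // !(key _ _ _ _ _ i fB) ?trE ?trF ?trH //.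
have EFi : pp E F i 0 = pp F E i 0 + p H i 0.
  by rewrite /pp /p [dr r E *m _]mulmxA EF mulmxDl mulmxDr -mulmxA mxE.
have HEi : pp H E i 0 = pp E H i 0 + 2%:R * p E i 0.
  rewrite /pp /p [dr r H *m _]mulmxA HE mulmxDl mulmxDr -mulmxA -scalemxAl -scalemxAr.
  by rewrite mxE; congr (_ + _); rewrite mxE.
have HFi : pp H F i 0 = pp F H i 0 - 2%:R * p F i 0.
  rewrite /pp /p [dr r H *m _]mulmxA HF mulmxBl mulmxBr -mulmxA -scalemxAl -scalemxAr.
  by rewrite mxE; congr (_ + _); rewrite mxE; congr (- _); rewrite mxE.
rewrite EFi HEi HFi !mulmxDr -!scalemxAr -/(p E) -/(p F) -/(p H) !lin3E.
rewrite /nabla => /eqP; rewrite -subr_eq0 => /eqP e0.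
rewrite [RHS]mxE -[RHS]oppr0 -e0.
move: (p E i 0) (p F i 0) (p H i 0) => pE pF pH.
move: (pp F E i 0) (pp E E i 0) (pp F F i 0) (pp H H i 0) (pp E H i 0) (pp F H i 0).
move=> pFE pEE pFF pHH pEH pFH {e0 EFi HEi HFi}.
move: (mev g aE) (mev g aF) (mev g aH) (mev g bE) (mev g bF) (mev g bH).
move=> xaE xaF xaH xbE xbF xbH.
move: (mev g (DL E aE)) (mev g (DL E aF)) (mev g (DL E aH)).
move: (mev g (DL F aE)) (mev g (DL F aF)) (mev g (DL F aH)).
move: (mev g (DL H aE)) (mev g (DL H aF)) (mev g (DL H aH)).
move: (mev g (DL E bE)) (mev g (DL E bF)) (mev g (DL E bH)).
move: (mev g (DL F bE)) (mev g (DL F bF)) (mev g (DL F bH)).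
move: (mev g (DL H bE)) (mev g (DL H bF)) (mev g (DL H bH)).
move=> *; ring.
Qed.


End Frame.
End Divergence.

(** * Determinant identities behind the vanishing divergence *)

Section SmallDet.
Context (K : numClosedFieldType).

Lemma null_vector3 (a0 a1 a2 b0 b1 b2 c0 c1 c2 : K) :
  a0 * (b1 * c2 - b2 * c1) - a1 * (b0 * c2 - b2 * c0) + a2 * (b0 * c1 - b1 * c0) = 0 ->
  exists x y z : K, [/\ (x, y, z) != (0, 0, 0), x * a0 + y * b0 + z * c0 = 0,
    x * a1 + y * b1 + z * c1 = 0 & x * a2 + y * b2 + z * c2 = 0].
Proof.
move=> d0.
pose A : 'M[K]_3 := \matrix_(i, j) nth 0 (nth [::] [:: [:: a0; a1; a2]; [:: b0; b1; b2];
  [:: c0; c1; c2]] i) j.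
have /eqP/det0P[w w0 wA] : \det A = 0.
  rewrite -[RHS]d0 (expand_det_row _ 0) !big_ord_recl big_ord0 /cofactor !det_mk2E.
  by rewrite !mxE /=; ring.
have wj j := congr1 (fun u : 'rV_3 => u 0 j) wA.
exists (w 0 ord0), (w 0 (lift ord0 ord0)), (w 0 (lift ord0 (lift ord0 ord0))).
have e j : w 0 ord0 * A ord0 j + w 0 (lift ord0 ord0) * A (lift ord0 ord0) j
    + w 0 (lift ord0 (lift ord0 ord0)) * A (lift ord0 (lift ord0 ord0)) j = 0.
  transitivity ((0 : 'rV[K]_3) 0 j); last by rewrite mxE.
  by rewrite -(wj j) [RHS]mxE !big_ord_recl big_ord0 addr0 addrA.
split; last 3 first.
- by have := e 0; rewrite !mxE.
- by have := e 1; rewrite !mxE.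
- by have := e 2; rewrite !mxE.
apply: contra_neq w0 => -[w0 w1 w2]; apply/rowP => j; rewrite mxE.
case: j => -[|[|[|//]]] lj.
+ by rewrite -[RHS]w0; congr (w _ _); apply: val_inj.
+ by rewrite -[RHS]w1; congr (w _ _); apply: val_inj.
+ by rewrite -[RHS]w2; congr (w _ _); apply: val_inj.
Qed.

(* With [a_jm] the derivative of [e_j] in the direction [m], the traces of the
   two bracket terms vanish and only the divergence [a11 + a22 + a33] survives. *)
Lemma trace_identity3 (e1 e2 e3 f1 f2 f3 h1 h2 h3 a11 a12 a13 a21 a22 a23 a31 a32 a33
    x1 x2 x3 y1 y2 y3 s t : K) :
  x1 - (f1 * a11 + f2 * a12 + f3 * a13) + 2%:R * (e3 * f1 - e1 * f3) - s * h1 = 0 ->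
  x2 - (f1 * a21 + f2 * a22 + f3 * a23) - 2%:R * (e3 * f2 - e2 * f3) - s * h2 = 0 ->
  x3 - (f1 * a31 + f2 * a32 + f3 * a33) + (e1 * f2 - e2 * f1) - s * h3 = 0 ->
  y1 - (h1 * a11 + h2 * a12 + h3 * a13) + 2%:R * (e3 * h1 - e1 * h3) - t * e1 = 0 ->
  y2 - (h1 * a21 + h2 * a22 + h3 * a23) - 2%:R * (e3 * h2 - e2 * h3) - t * e2 = 0 ->
  y3 - (h1 * a31 + h2 * a32 + h3 * a33) + (e1 * h2 - e2 * h1) - t * e3 = 0 ->
  (e1 * a11 + e2 * a12 + e3 * a13) * (f2 * h3 - f3 * h2)
  + e1 * ((x2 * h3 + f2 * y3) - (x3 * h2 + f3 * y2))
  - ((e1 * a21 + e2 * a22 + e3 * a23) * (f1 * h3 - f3 * h1)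
     + e2 * ((x1 * h3 + f1 * y3) - (x3 * h1 + f3 * y1)))
  + ((e1 * a31 + e2 * a32 + e3 * a33) * (f1 * h2 - f2 * h1)
     + e3 * ((x1 * h2 + f1 * y2) - (x2 * h1 + f2 * y1))) =
  (a11 + a22 + a33) *
  (e1 * (f2 * h3 - f3 * h2) - e2 * (f1 * h3 - f3 * h1) + e3 * (f1 * h2 - f2 * h1)).
Proof.
have sub0 (x y z w : K) : x - y + z - w = 0 -> x = y - z + w.
  by move/eqP; rewrite subr_eq0 => /eqP <-; ring.
have sub1 (x y z w : K) : x - y - z - w = 0 -> x = y + z + w.
  by move/eqP; rewrite subr_eq0 => /eqP <-; ring.
by move=> /sub0-> /sub1-> /sub0-> /sub0-> /sub1-> /sub0->; ring.
Qed.

(* The same for two columns, where [q] is the discriminant of the kernel. *)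
Lemma trace_identity2 (s e1 e2 f1 f2 h1 h2 a11 a12 a21 a22 x1 x2 y1 y2 : K) :
  x1 = f1 * a11 + f2 * a12 + s * h1 -> x2 = f1 * a21 + f2 * a22 + s * h2 ->
  y1 = h1 * a11 + h2 * a12 - 2%:R * s * e1 ->
  y2 = h1 * a21 + h2 * a22 - 2%:R * s * e2 ->
  let z1 := e1 * a11 + e2 * a12 in let z2 := e1 * a21 + e2 * a22 in
  let ef := e1 * f2 - e2 * f1 in let fh := f1 * h2 - f2 * h1 in
  let he := h1 * e2 - h2 * e1 in
  (z1 * f2 + e1 * x2 - (z2 * f1 + e2 * x1)) * ef
  + ef * (z1 * f2 + e1 * x2 - (z2 * f1 + e2 * x1)) +
  ((x1 * h2 + f1 * y2 - (x2 * h1 + f2 * y1)) * he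
  + fh * (y1 * e2 + h1 * z2 - (y2 * e1 + h2 * z1))) =
  2%:R * (a11 + a22) * (ef * ef + fh * he).
Proof. by move=> -> -> -> ->; cbv zeta; ring. Qed.

End SmallDet.

(** * Orbits with trivial or torus stabilizer *)

Section FiniteOrTorusStabilizer.
Context (K : numClosedFieldType) (n : nat) (r : polyrep K n).
Local Notation MP := {mpoly K[2 * 2]}.
Local Notation mev g p := (meval (fun k => mxvec g 0 k) p).
Local Notation E := (mE K).
Local Notation F := (mF K).
Local Notation H := (mH K).
Implicit Types (g h A : 'M[K]_2) (t : K).
Context (v : 'cV[K]_n) (M : 'M[K]_n) (c : 'cV[K]_n).
Hypothesis st : stabilizes r v M c.

Lemma invmx_mk2 g : \det g = 1 -> invmx g = mk2 (g 1 1) (- g 0 1) (- g 1 0) (g 0 0).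
Proof.
move=> g1; apply: (can_inj (mulmxK (SL_unit g1))); rewrite mulVmx ?SL_unit //.
move: g1; rewrite det_mk2E => g1; rewrite [X in _ = _ *m X](mk2_eta g) mk2M mk2_1.
by congr mk2; rewrite -?g1; ring.
Qed.

(** For determinant 1 the inverse is the adjugate, so r(g^-1) is also polynomial in the entries of
    g. *)
Definition coefsV k l : MP := mcomp (fun i => mxvec (mk2 (gX K 1 1) (- gX K 0 1)
  (- gX K 1 0) (gX K 0 0)) 0 i) (coefs r k l).

Lemma mev_coefsV g k l : \det g = 1 -> mev g (coefsV k l) = r (invmx g) k l.
Proof.
move=> g1; rewrite meval_mcomp actE ?det_invmx //; apply: meval_eq => i.
rewrite invmx_mk2 //; case/mxvec_indexP: i => i j; rewrite !mxvecE; move: i j.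
by apply: ord2P; apply: ord2P; rewrite ![mk2 _ _ _ _ _ _]mxE /= ?mevalN mev_gX.
Qed.

(** By tangency g^-1 Y_A(gv) lies in sl_2 v. A right inverse of the matrix of a basis of sl_2 v
    reads off the coordinates linearly, so they are polynomial in the entries of g. *)
Lemma frame_exists d (B : 'I_d -> 'M[K]_2) :
  row_free (\matrix_j (dr r (B j) *m v)^T) ->
  (forall X, \tr X = 0 -> exists w : 'I_d -> K, dr r X *m v = \sum_j w j *: (dr r (B j) *m v)) ->
  (forall g, \det g = 1 -> tangent_at r (r g *m v) M c) ->
  exists b : 'M[K]_2 -> 'I_d -> MP, forall A, \tr A = 0 -> forall g, \det g = 1 ->
    vfield r M c A (r g *m v) = r g *m \sum_j mev g (b A j) *: (dr r (B j) *m v).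
Proof.
set U := \matrix_j _ => /row_freeP[R UR] span tan.
exists (fun A j => \sum_i R i j *: \sum_k coefsV i k * vfield_fun r v M c A k).
move=> A trA g g1.
have [X trX XE] := tan g g1 A trA.
pose y := r (invmx g) *m vfield r M c A (r g *m v).
have vfE : vfield r M c A (r g *m v) = r g *m y by rewrite /y mulmxA actK // mul1mx.
have [w wE] : exists w : 'I_d -> K, y = \sum_j w j *: (dr r (B j) *m v).
  have [|w wE] := span (invmx g *m X *m invmx (invmx g)).
    by rewrite tr_conj ?det_invmx.
  exists w; rewrite -wE /y /vfield XE !mulmxA dr_conj ?det_invmx //.
  by rewrite -(mulmxA _ (r (invmx g)) (r g)) actVK // mulmx1.
rewrite vfE; congr (_ *m _); rewrite [LHS]wE; apply: eq_bigr => j _; congr (_ *: _).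
have yU : y^T = (\row_j w j) *m U.
  rewrite mulmx_sum_row wE raddf_sum; apply: eq_bigr => l _ /=.
  by rewrite rowK mxE linearZ.
have : (y^T *m R) 0 j = w j by rewrite yU -mulmxA UR mulmx1 mxE.
move=> <-; rewrite mxE raddf_sum; apply: eq_bigr => i _ /=.
rewrite mevalZ mulrC; congr (_ * _); rewrite mxE /y mxE raddf_sum.
by apply: eq_bigr => k _ /=; rewrite mevalM mev_coefsV // mev_vfield_fun.
Qed.

Lemma vfield_lin (x y z : K) (u : 'cV[K]_n) :
  vfield r M c (x *: E + y *: F + z *: H) u =
  x *: vfield r M c E u + y *: vfield r M c F u + z *: vfield r M c H u.
Proof.
by rewrite /vfield; move: (M *m u + c) => w;
  rewrite 2!drD 3!drZ 2!mulmxDl 2!mulmxDr -!scalemxAl -!scalemxAr.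
Qed.

Lemma vfield_combo (x y z : K) eE eF eH fE fF fH hE hF hH g : \det g = 1 ->
  frame r v M c E eE eF eH -> frame r v M c F fE fF fH -> frame r v M c H hE hF hH ->
  vfield r M c (x *: E + y *: F + z *: H) (r g *m v) = r g *m (
    (x * mev g eE + y * mev g fE + z * mev g hE) *: (dr r E *m v) +
    (x * mev g eF + y * mev g fF + z * mev g hF) *: (dr r F *m v) +
    (x * mev g eH + y * mev g fH + z * mev g hH) *: (dr r H *m v)).
Proof.
move=> g1 frE frF frH; rewrite vfield_lin frE // frF // frH //.
move: (dr r E *m v) (dr r F *m v) (dr r H *m v) => p1 p2 p3.
apply/colP => i; rewrite !mulmxDr -!scalemxAr 5!lin3E.
move: ((r g *m p1) i 0) ((r g *m p2) i 0) ((r g *m p3) i 0) => q1 q2 q3.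
move: (mev g eE) (mev g eF) (mev g eH) (mev g fE) (mev g fF) (mev g fH).
move: (mev g hE) (mev g hF) (mev g hH) => *; ring.
Qed.

Lemma vfieldZ (x : K) A (u : 'cV[K]_n) : vfield r M c (x *: A) u = x *: vfield r M c A u.
Proof. by rewrite /vfield drZ -scalemxAl -scalemxAr. Qed.

(** Since f(gv) = hv for some h, Y_N(gv) = 0 means that N kills hv; the kernel of N |-> Y_N(gv) thus
    lies in the conjugate by h of the stabilizer of v. *)
Lemma vfield_eq0 g : \det g = 1 -> exists2 h, \det h = 1 & forall N, \tr N = 0 ->
  vfield r M c N (r g *m v) = 0 -> dr r (invmx h *m N *m h) *m v = 0.
Proof.
have [uM fO _] := st.
move=> g1; have [h h1 hE] : orbit r v (M *m (r g *m v) + c).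
  by apply: fO; exists g.
exists h => // N trN; rewrite /vfield hE => /(congr1 (mulmx M)).
rewrite mulKVmx // mulmx0 => /(congr1 (mulmx (r (invmx h)))).
rewrite mulmx0 !mulmxA dr_conj ?det_invmx // -(mulmxA _ (r (invmx h)) (r h)) actVK // mulmx1.
by rewrite invmxK.
Qed.

Lemma nablaM g aE aF aH p q : nabla g aE aF aH (p * q) =
  nabla g aE aF aH p * mev g q + mev g p * nabla g aE aF aH q.
Proof. by rewrite /nabla !DLM !mevalD !mevalM; ring. Qed.

Lemma nablaD g aE aF aH p q : nabla g aE aF aH (p + q) =
  nabla g aE aF aH p + nabla g aE aF aH q.
Proof. by rewrite /nabla !DLD !mevalD; ring. Qed.

Lemma nablaB g aE aF aH p q : nabla g aE aF aH (p - q) =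
  nabla g aE aF aH p - nabla g aE aF aH q.
Proof. by rewrite /nabla !DLD !DLN !mevalB; ring. Qed.

Lemma nabla_no_zero q g aE aF aH : (forall g, \det g = 1 -> mev g q != 0) ->
  \det g = 1 -> nabla g aE aF aH q = 0.
Proof.
move=> q0 g1; rewrite /nabla !(no_zero_DL q0) ?trE ?trF ?trH //; ring.
Qed.

Lemma comm_FE : F *m E - E *m F = (-1) *: H.
Proof. by rewrite /mE /mF /mH !mk2E; congr mk2; ring. Qed.
Lemma comm_HE : H *m E - E *m H = 2%:R *: E.
Proof. by rewrite /mE /mH !mk2E; congr mk2; ring. Qed.
Lemma comm_EF : E *m F - F *m E = 1 *: H.
Proof. by rewrite /mE /mF /mH !mk2E; congr mk2; ring. Qed.
Lemma comm_HF : H *m F - F *m H = (- 2%:R) *: F.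
Proof. by rewrite /mF /mH !mk2E; congr mk2; ring. Qed.

Lemma frame_comm A B D (k : K) aE aF aH bE bF bH dE dF dH g :
  \tr A = 0 -> \tr B = 0 -> \det g = 1 ->
  frame r v M c A aE aF aH -> frame r v M c B bE bF bH -> frame r v M c D dE dF dH ->
  B *m A - A *m B = k *: D ->
  (nabla g aE aF aH bE - nabla g bE bF bH aE +
     2%:R * (mev g aH * mev g bE - mev g aE * mev g bH) - k * mev g dE) *: (dr r E *m v) +
  (nabla g aE aF aH bF - nabla g bE bF bH aF -
     2%:R * (mev g aH * mev g bF - mev g aF * mev g bH) - k * mev g dF) *: (dr r F *m v) +
  (nabla g aE aF aH bH - nabla g bE bF bH aH +
     (mev g aE * mev g bF - mev g aF * mev g bE) - k * mev g dH) *: (dr r H *m v) = 0.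
Proof.
have [uM _ _] := st.
move=> trA trB g1 fA fB fD BA; apply: (frame_bracket uM trA trB g1 fA fB).
by rewrite BA vfieldZ fD // scalemxAr !scalerDr !scalerA.
Qed.

Lemma lin_EFH (x y z : K) : dr r (x *: E + y *: F + z *: H) *m v =
  x *: (dr r E *m v) + y *: (dr r F *m v) + z *: (dr r H *m v).
Proof. by rewrite 2!drD 3!drZ 2!mulmxDl -!scalemxAl. Qed.

Lemma tr_EFH (x y z : K) : \tr (x *: E + y *: F + z *: H) = 0.
Proof. by rewrite 2!mxtraceD 3!mxtraceZ trE trF trH !mulr0 !addr0. Qed.

Lemma EFH_eq0 (x y z : K) : x *: E + y *: F + z *: H = 0 -> [/\ x = 0, y = 0 & z = 0].
Proof.
move=> /matrixP e; have := e 0 0; have := e 0 1; have := e 1 0.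
rewrite !mxE /= !mulr0 !mulr1 !add0r !addr0 => -> -> ->.
by [].
Qed.

(** * Stabilizer 0 in sl_2 *)

Section FiniteStabilizer.
Hypothesis free : forall A, \tr A = 0 -> dr r A *m v = 0 -> A = 0.
Hypothesis noinv : forall x : 'cV[K]_n, (forall g, \det g = 1 -> r g *m x = x) -> x = 0.

Lemma indep3 (x y z : K) :
  x *: (dr r E *m v) + y *: (dr r F *m v) + z *: (dr r H *m v) = 0 ->
  [/\ x = 0, y = 0 & z = 0].
Proof. by rewrite -lin_EFH => /(free (tr_EFH x y z))/EFH_eq0. Qed.

Definition det3 (eE eF eH fE fF fH hE hF hH : MP) : MP :=
  eE * (fF * hH - fH * hF) - eF * (fE * hH - fH * hE) + eH * (fE * hF - fF * hE).

(** ad A sends B to a multiple of D, D to a multiple of A and A to 0, so it is traceless. By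
    [trace_identity3] the divergence times the determinant is the derivative of the determinant
    along Y_A, which is 0. *)
Lemma div_own A B D (s t : K) eE eF eH fE fF fH hE hF hH :
  \tr A = 0 -> \tr B = 0 -> \tr D = 0 ->
  frame r v M c A eE eF eH -> frame r v M c B fE fF fH -> frame r v M c D hE hF hH ->
  B *m A - A *m B = s *: D -> D *m A - A *m D = t *: A ->
  (forall g, \det g = 1 -> mev g (det3 eE eF eH fE fF fH hE hF hH) != 0) ->
  eqSL (div eE eF eH) 0.
Proof.
move=> trA trB trD frA frB frD BA DA q0 g g1; rewrite meval0; apply: (mulIf (q0 g g1)).
have [n1 n2 n3] := indep3 (frame_comm trA trB g1 frA frB frD BA).
have [m1 m2 m3] := indep3 (frame_comm trA trD g1 frA frD frA DA).
have := nabla_no_zero eE eF eH q0 g1; rewrite /det3 /div mul0r.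
rewrite !(nablaB, nablaD, nablaM) !(mevalB, mevalD, mevalM) => e0.
by rewrite -[RHS]e0 -(trace_identity3 n1 n2 n3 m1 m2 m3) /nabla.
Qed.

Lemma finite_stabilizer_translation : c = 0.
Proof.
have tan g : \det g = 1 -> tangent_at r (r g *m v) M c.
  by move=> g1; apply: tangent_orbit => //; apply: tangent_dim3.
pose B (j : 'I_3) := if j == 0 then E else if j == 1 then F else H.
have sumB (T : lmodType K) (w : 'I_3 -> K) (f : 'M[K]_2 -> T) :
    \sum_j w j *: f (B j) = w 0 *: f E + w 1 *: f F + w 2 *: f H.
  rewrite !big_ord_recl big_ord0 addr0 /B /= addrA.
  by congr (w _ *: _ + w _ *: _ + w _ *: _); apply: val_inj.
have [||//|b bE] := @frame_exists 3 B.
- apply: row_free2 => w; rewrite (sumB _ _ (fun X => dr r X *m v)) => /indep3[e0 e1 e2].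
  apply/rowP => j; rewrite mxE; case: j => -[|[|[|//]]] lj.
  + by rewrite -[RHS]e0; congr (w _ _); apply: val_inj.
  + by rewrite -[RHS]e1; congr (w _ _); apply: val_inj.
  + by rewrite -[RHS]e2; congr (w _ _); apply: val_inj.
- move=> X trX; exists (fun j : 'I_3 => if j == 0 then X 0 1 else if j == 1 then X 1 0 else X 0 0).
  by rewrite (sumB _ _ (fun X => dr r X *m v)) /= -lin_EFH -sl2_decompH.
have fr A : \tr A = 0 -> frame r v M c A (b A 0) (b A 1) (b A 2).
  by move=> trA g g1; rewrite bE // (sumB _ _ (fun X => dr r X *m v)).
move: (fr E (trE K)) (fr F (trF K)) (fr H (trH K)).
move: (b E 0) (b E 1) (b E 2) (b F 0) (b F 1) (b F 2) (b H 0) (b H 1) (b H 2).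
move=> eE eF eH fE fF fH hE hF hH frE frF frH {fr bE b}.
(* A linear relation between the three fields at gv is an N with Y_N(gv) = 0; a conjugate of N kills
   v, so N = 0. *)
have q0 g : \det g = 1 -> mev g (det3 eE eF eH fE fF fH hE hF hH) != 0.
  move=> g1; apply/eqP; rewrite /det3 !(mevalB, mevalD, mevalM) => /null_vector3.
  case=> x [y [z [/eqP nz e0 e1 e2]]]; apply: nz.
  have : vfield r M c (x *: E + y *: F + z *: H) (r g *m v) = 0.
    by rewrite (vfield_combo x y z g1 frE frF frH) // e0 e1 e2 !scale0r !addr0 mulmx0.
  have [h h1 stab] := vfield_eq0 g1; move/(stab _ (tr_EFH x y z)).
  have th : \tr (invmx h *m (x *: E + y *: F + z *: H) *m h) = 0.
    by rewrite mxtrace_mulC mulmxA mulmxV ?SL_unit // mul1mx tr_EFH.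
  move/(free th)/(congr1 (fun X => h *m X *m invmx h)).
  rewrite -!mulmxA mulmxV ?SL_unit // mulmx1 mulmxA mulmxV ?SL_unit // mul1mx.
  by rewrite mul0mx mulmx0 => /EFH_eq0[-> -> ->].
have q0' g : \det g = 1 -> mev g (det3 fE fF fH eE eF eH hE hF hH) != 0.
  move=> g1; apply: contraNneq (q0 g g1); rewrite /det3 !(mevalB, mevalD, mevalM) => e0.
  by rewrite -oppr_eq0 -[X in _ == X]e0; apply/eqP; ring.
have [uM _ _] := st.
have cE := div0_translation uM noinv frE
  (div_own (trE K) (trF K) (trH K) frE frF frH comm_FE comm_HE q0).
have cF := div0_translation uM noinv frF
  (div_own (trF K) (trE K) (trH K) frF frE frH comm_EF comm_HF q0').
by apply: noinv; apply: fixed_by_sl2.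
Qed.

End FiniteStabilizer.

(** * Stabilizer spanned by H *)

Section TorusStabilizer.
Hypothesis Hv : dr r H *m v = 0.
Hypothesis stabH : forall A, \tr A = 0 -> dr r A *m v = 0 -> exists k, A = k *: H.
Hypothesis noinv : forall x : 'cV[K]_n, (forall g, \det g = 1 -> r g *m x = x) -> x = 0.

Lemma indep2 (x y : K) : x *: (dr r E *m v) + y *: (dr r F *m v) = 0 -> x = 0 /\ y = 0.
Proof.
move=> e; have [|k] := @stabH (x *: E + y *: F + 0 *: H) (tr_EFH x y 0).
  by rewrite lin_EFH scale0r addr0.
move/eqP; rewrite -subr_eq0 -scaleNr -addrA -scalerDl => /eqP/EFH_eq0[-> ->].
by [].
Qed.

(** The cross product (x, y, z) of the two rows of coordinates of Y_E, Y_F, Y_H makes xE + yF + zH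
    an element of the kernel of A |-> Y_A(gv); this is z^2 + xy, minus the determinant of that
    element, which vanishes exactly when it is nilpotent. *)
Definition disc (eE eF fE fF hE hF : MP) : MP :=
  (eE * fF - eF * fE) * (eE * fF - eF * fE) + (fE * hF - fF * hE) * (hE * eF - hF * eE).

(** As H v = 0, the coordinate along H is chosen to be 0. The discriminant is quadratic in the 2 x 2
    minors, so its derivative along Y_A is twice the divergence times itself. *)
Lemma div_own2 A B D (s : K) eE eF fE fF hE hF :
  \tr A = 0 -> \tr B = 0 -> \tr D = 0 ->
  frame r v M c A eE eF 0 -> frame r v M c B fE fF 0 -> frame r v M c D hE hF 0 ->
  B *m A - A *m B = s *: D -> D *m A - A *m D = (- (2%:R * s)) *: A ->
  (forall g, \det g = 1 -> mev g (disc eE eF fE fF hE hF) != 0) ->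
  eqSL (div eE eF 0) 0.
Proof.
move=> trA trB trD frA frB frD BA DA q0 g g1; rewrite meval0; apply: (mulIf (q0 g g1)).
have := frame_comm trA trB g1 frA frB frD BA.
have := frame_comm trA trD g1 frA frD frA DA.
rewrite Hv !scaler0 !addr0 !meval0 => /indep2[m1 m2] /indep2[n1 n2].
have two : 2%:R != 0 :> K by rewrite pnatr_eq0.
apply: (mulfI two); rewrite mul0r mulr0.
have := nabla_no_zero eE eF 0 q0 g1; rewrite /disc.
rewrite !(nablaB, nablaD, nablaM) !(mevalB, mevalD, mevalM) => e0.
rewrite -[RHS]e0 /div DLC meval0 addr0 mulrA.
have res (x y z u w k : K) : x - y + 2%:R * (0 * z - u * 0) - k * w = 0 -> x = y + k * w.
  by move/eqP; rewrite mulr0 mul0r subr0 mulr0 addr0 subr_eq0 subr_eq addrC => /eqP.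
have res' (x y z u w k : K) : x - y - 2%:R * (0 * z - u * 0) - k * w = 0 -> x = y + k * w.
  by move/eqP; rewrite mulr0 mul0r !subr0 mulr0 subr0 subr_eq0 subr_eq addrC => /eqP.
move: n1 n2 m1 m2 => /res n1 /res' n2 /res m1 /res' m2.
symmetry; move: n1 n2 m1 m2; rewrite /nabla !meval0 !mul0r !addr0 => n1 n2 m1 m2.
by apply: (@trace_identity2 _ s); rewrite ?n1 ?n2 ?m1 ?m2 // mulNr.
Qed.

Lemma torus_stabilizer_translation : c = 0.
Proof.
have tan g : \det g = 1 -> tangent_at r (r g *m v) M c.
  move=> g1; apply: tangent_orbit => //; apply: (@tangent_dim2 _ _ _ _ 0) => [s t|h h1].
    by rewrite drD !drZ mulmxDl -!scalemxAl => /indep2.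
  rewrite mul0r add0r => d0.
  (* From h = (1 + sE)(1 + tF) diag(1/h_11, h_11) on the cell where h_11 is nonzero; the torus
     factor fixes v. *)
  exists (h 0 1 / h 1 1), (h 1 0 * h 1 1).
  have z0 : (h 1 1)^-1 != 0 by rewrite invr_eq0.
  rewrite -{2}(act_tz_fix Hv z0) mulmxA -actM ?det_tz //; last first.
    by rewrite det_mk2; ring.
  congr (r _ *m v); rewrite /tz mk2M invrK.
  rewrite [LHS](_ : _ = mk2 (h 0 0) (h 0 1) (h 1 0) (h 1 1)); last exact: mk2_eta.
  move: h1; rewrite det_mk2E => h1.
  have -> : h 0 0 = (1 + h 0 1 * h 1 0) / h 1 1 by rewrite -h1; field.
  by congr mk2; field.
pose B (j : 'I_2) := if j == 0 then E else F.
have sumB (w : 'I_2 -> K) : \sum_j w j *: (dr r (B j) *m v) =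
    w 0 *: (dr r E *m v) + w 1 *: (dr r F *m v).
  rewrite !big_ord_recl big_ord0 addr0 /B /=.
  by congr (w _ *: _ + w _ *: _); apply: val_inj.
have [||//|b bE] := @frame_exists 2 B.
- apply: row_free2 => w; rewrite sumB => /indep2[e0 e1].
  apply/rowP => j; rewrite mxE; case: j => -[|[|//]] lj.
  + by rewrite -[RHS]e0; congr (w _ _); apply: val_inj.
  + by rewrite -[RHS]e1; congr (w _ _); apply: val_inj.
- move=> X trX; exists (fun j : 'I_2 => if j == 0 then X 0 1 else X 1 0).
  by rewrite sumB /= {1}(sl2_decompH trX) lin_EFH Hv scaler0 addr0.
have fr A : \tr A = 0 -> frame r v M c A (b A 0) (b A 1) 0.
  by move=> trA g g1; rewrite bE // sumB Hv scaler0 addr0.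
move: (fr E (trE K)) (fr F (trF K)) (fr H (trH K)).
move: (b E 0) (b E 1) (b F 0) (b F 1) (b H 0) (b H 1).
move=> eE eF fE fF hE hF frE frF frH {fr bE b}.
have q0 g : \det g = 1 -> mev g (disc eE eF fE fF hE hF) != 0.
  move=> g1; apply/eqP; rewrite /disc !(mevalB, mevalD, mevalM).
  have [h h1 stab] := vfield_eq0 g1.
  have rel x y z : x * mev g eE + y * mev g fE + z * mev g hE = 0 ->
      x * mev g eF + y * mev g fF + z * mev g hF = 0 ->
      exists k, x *: E + y *: F + z *: H = k *: (h *m H *m invmx h).
    move=> e0 e1; have trN := tr_EFH x y z.
    have : vfield r M c (x *: E + y *: F + z *: H) (r g *m v) = 0.
      by rewrite (vfield_combo x y z g1 frE frF frH) // e0 e1 Hv scaler0 !scale0r !addr0 mulmx0.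
    move/(stab _ trN)/stabH; rewrite mxtrace_mulC mulmxA mulmxV ?SL_unit // mul1mx trN.
    case=> // k kE; exists k; rewrite scalemxAl scalemxAr -kE !mulmxA.
    by rewrite mulmxV ?SL_unit // mul1mx mulmxK ?SL_unit.
  have det_rel x y z k : x *: E + y *: F + z *: H = k *: (h *m H *m invmx h) ->
      z * z + x * y = k * k.
    move/(congr1 (fun A : 'M[K]_2 => - \det A)).
    rewrite detZ !det_mulmx h1 det_invmx // mulr1 mul1r /mE /mF /mH !mk2E !det_mk2.
    by move=> e; apply: (etrans _ (etrans e _)); ring.
  move: (mev g eE) (mev g eF) (mev g fE) (mev g fF) (mev g hE) (mev g hF) rel.
  move=> e1 e2 f1 f2 h1' h2 rel e0.
  have rel0 x y z : x * e1 + y * f1 + z * h1' = 0 -> x * e2 + y * f2 + z * h2 = 0 ->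
      z * z + x * y = 0 -> [/\ x = 0, y = 0 & z = 0].
    move=> r1 r2; have [k kE] := rel x y z r1 r2; rewrite (det_rel _ _ _ _ kE).
    move/eqP; rewrite mulf_eq0 orbb => /eqP k0; move: kE; rewrite k0 scale0r.
    exact: EFH_eq0.
  (* A vanishing discriminant makes the cross product nilpotent, yet it is a multiple of a conjugate
     of H; so it is 0 and the two rows are proportional. *)
  have [|||fh he ef] := rel0 (f1 * h2 - f2 * h1') (h1' * e2 - h2 * e1) (e1 * f2 - e2 * f1).
  - by ring.
  - by ring.
  - by [].
  (* Proportional rows with p, the coordinate of Y_E in one of them, nonzero would give two
     independent kernel vectors, whereas the kernel lies in the line of hHh^-1. *)
  have contra (p f h' : K) : p != 0 ->
      (exists k, f *: E + (- p) *: F + 0 *: H = k *: (h *m H *m invmx h)) ->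
      (exists k, h' *: E + 0 *: F + (- p) *: H = k *: (h *m H *m invmx h)) -> False.
    move=> p0 [k1 k1E] [k2 k2E].
    have : k2 *: (f *: E + (- p) *: F + 0 *: H) = k1 *: (h' *: E + 0 *: F + (- p) *: H).
      by rewrite k1E k2E !scalerA mulrC.
    move=> /matrixP/(_ 1 0); rewrite !mxE /= => e10.
    have /eqP : k2 * p = 0 by apply: (etrans (esym (opprK _))); rewrite -[RHS]oppr0;
      congr (- _); apply: (etrans _ (etrans e10 _)); ring.
    rewrite mulf_eq0 (negPf p0) orbF => /eqP k20.
    rewrite k20 in k2E; have [_ _ /eqP] := EFH_eq0 (etrans k2E (scale0r _)).
    by rewrite oppr_eq0 (negPf p0).
  have sgn (x y : K) : x - y = 0 -> y - x = 0 by move=> xy; rewrite -opprB xy oppr0.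
  have [e10|e1n] := eqVneq e1 0; last first.
    apply: (contra e1 f1 h1' e1n); apply: rel; first [by ring | idtac].
    - by rewrite -[RHS](sgn _ _ ef); ring.
    - by rewrite -[RHS]he; ring.
  have [e20|e2n] := eqVneq e2 0; last first.
    apply: (contra e2 f2 h2 e2n); apply: rel; first [by ring | idtac].
    - by rewrite -[RHS]ef; ring.
    - by rewrite -[RHS](sgn _ _ he); ring.
  (* Otherwise E itself lies in the kernel, which contains no nonzero nilpotent. *)
  have [|||/eqP] := rel0 1 0 0; try by rewrite ?e10 ?e20; ring.
  by rewrite oner_eq0.
have q0' g : \det g = 1 -> mev g (disc fE fF eE eF hE hF) != 0.
  move=> g1; have := q0 g g1; rewrite /disc !(mevalB, mevalD, mevalM).
  by apply: contraNneq => e0; apply/eqP; rewrite -[RHS]e0; ring.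
have [uM _ _] := st.
have two : 2%:R = - (2%:R * -1) :> K by rewrite mulrN1 opprK.
have HE : H *m E - E *m H = (- (2%:R * -1)) *: E by rewrite -two comm_HE.
have HF : H *m F - F *m H = (- (2%:R * 1)) *: F by rewrite mulr1 comm_HF.
have cE := div0_translation uM noinv frE
  (div_own2 (trE K) (trF K) (trH K) frE frF frH comm_FE HE q0).
have cF := div0_translation uM noinv frF
  (div_own2 (trF K) (trE K) (trH K) frF frE frH comm_EF HF q0').
by apply: noinv; apply: fixed_by_sl2.
Qed.

End TorusStabilizer.
End FiniteOrTorusStabilizer.

(** * Unipotent stabilizers *)

Section Functionals.
Context (K : numClosedFieldType) (n : nat).
Implicit Types (u y : 'cV[K]_n) (l : 'rV[K]_n).

Lemma span2 u1 u2 y : (forall l, l *m u1 = 0 -> l *m u2 = 0 -> l *m y = 0) ->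
  exists a b : K, y = a *: u1 + b *: u2.
Proof.
move=> H; pose U := col_mx u1^T u2^T.
have /submxP[w yE] : (y^T <= U)%MS.
  rewrite submxE; apply/eqP/rowP => j; rewrite mxE.
  have /eqP := mulmx_coker U; rewrite mul_col_mx -[0 in X in X -> _]col_mx0 => /eqP/eq_col_mx[c1 c2].
  have lj u : u^T *m cokermx U = 0 -> (col j (cokermx U))^T *m u = 0.
    by move=> e; apply: trmx_inj; rewrite trmx_mul trmxK colE mulmxA e mul0mx trmx0.
  have := congr1 (fun B : 'M_1 => B 0 0) (H _ (lj _ c1) (lj _ c2)).
  rewrite !mxE => e; rewrite -[RHS]e; apply: eq_bigr => i _.
  by rewrite !mxE mulrC.
exists (w 0 (lshift 1 0)), (w 0 (rshift 1 0)); apply: trmx_inj.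
rewrite yE -[w]hsubmxK mul_row_col linearD !linearZ /= hsubmxK.
by congr (_ + _); rewrite -mul_scalar_mx; congr (_ *m _);
  apply/matrixP => i j; rewrite !ord1 !mxE eqxx mulr1n.
Qed.

Lemma dual2 u1 u2 : (forall a b : K, a *: u1 + b *: u2 = 0 -> a = 0 /\ b = 0) ->
  exists l1 l2, [/\ l1 *m u1 = 0, l1 *m u2 = 1%:M, l2 *m u1 = 1%:M & l2 *m u2 = 0].
Proof.
move=> indep; pose u (j : 'I_2) := if j == 0 then u1 else u2.
have /row_freeP[R UR] : row_free (\matrix_j (u j)^T).
  apply: row_free2 => w; rewrite big_ord_recl big_ord1 /u /= => /indep[e0 e1].
  apply/rowP => j; rewrite mxE; case: j => -[|[|//]] lj.
  + by rewrite -[RHS]e0; congr (w _ _); apply: val_inj.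
  + by rewrite -[RHS]e1; congr (w _ _); apply: val_inj.
have luE i j : (col i R)^T *m u j = (j == i)%:R%:M.
  apply/matrixP => a b; rewrite !ord1 !mxE eqxx mulr1n.
  have := congr1 (fun B : 'M_2 => B j i) UR; rewrite !mxE => <-.
  by apply: eq_bigr => k _; rewrite !mxE mulrC.
exists (col 1 R)^T, (col 0 R)^T.
by split; [rewrite (luE 1 0) | rewrite (luE 1 1) | rewrite (luE 0 0) | rewrite (luE 0 1)];
  rewrite /= ?scalemx1 ?raddf0.
Qed.

End Functionals.

Section UnipotentStabilizer.
Context (K : numClosedFieldType) (n : nat) (r : polyrep K n).
Local Notation MP := {mpoly K[2 * 2]}.
Local Notation mev g p := (meval (fun k => mxvec g 0 k) p).
Local Notation E := (mE K).
Local Notation F := (mF K).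
Local Notation H := (mH K).
Local Notation rE := (dr r (mE K)).
Local Notation rF := (dr r (mF K)).
Local Notation rH := (dr r (mH K)).
Implicit Types (g h A : 'M[K]_2) (t z : K) (u x y : 'cV[K]_n).
Hypothesis noinv : forall x : 'cV[K]_n, (forall g, \det g = 1 -> r g *m x = x) -> x = 0.

Lemma iterF_H u (k : K) j : rH *m u = k *: u ->
  rH *m iter j (mulmx rF) u = (k - j%:R * 2%:R) *: iter j (mulmx rF) u.
Proof.
move=> Hu; elim: j => [|j IH]; first by rewrite mul0r subr0.
have [_ _ HF] := dr_brackets r.
rewrite iterS mulmxA HF mulmxBl -mulmxA IH -scalemxAr -scalemxAl -scalerBl.
by rewrite -natr1; congr (_ *: _); ring.
Qed.

Lemma iterF_E u (k : K) j : rE *m u = 0 -> rH *m u = k *: u ->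
  rE *m iter j.+1 (mulmx rF) u = (j.+1%:R * (k - j%:R)) *: iter j (mulmx rF) u.
Proof.
move=> Eu Hu; have [EF _ _] := dr_brackets r.
elim: j => [|j IH].
  by rewrite /= mulmxA EF mulmxDl -mulmxA Eu mulmx0 add0r Hu subr0 mul1r.
rewrite iterS mulmxA EF mulmxDl -mulmxA IH (iterF_H _ Hu) -scalemxAr -iterS -scalerDl.
by congr (_ *: _); rewrite -!natr1; ring.
Qed.

(** The F-string of u ends, which makes k a natural number; k = 0 would mean F u = 0 and u
    invariant. *)
Lemma highest_weight u (k : K) : rE *m u = 0 -> rH *m u = k *: u -> u != 0 ->
  exists m : nat, [/\ k = m.+1%:R, iter m.+1 (mulmx rF) u != 0
    & iter m.+2 (mulmx rF) u = 0].
Proof.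
move=> Eu Hu u0.
have [N FN] := dr_nilpotent r (nilpF K).
have exj : exists j, iter j.+1 (mulmx rF) u == 0.
  exists N; have -> : iter N.+1 (mulmx rF) u = rF *m (iter N (mulmx rF) 1%:M *m u).
    rewrite iterS; congr (_ *m _); elim: N {FN} => [|N IH]; first by rewrite mul1mx.
    by rewrite !iterS IH mulmxA.
  by rewrite FN mul0mx mulmx0.
have [j /eqP Fj minj] := ex_minnP exj.
have nz : iter j (mulmx rF) u != 0.
  by case: j Fj minj => // j _ minj; apply/negP => /minj; rewrite ltnn.
have := iterF_E j Eu Hu; rewrite Fj mulmx0 => /esym/eqP.
rewrite scaler_eq0 (negPf nz) orbF mulf_eq0 pnatr_eq0 /= subr_eq0 => /eqP kj.
case: j kj nz Fj {minj} => [k0 _ Fu|m km nz Fm]; last by exists m.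
case/eqP: u0; apply: noinv; exact: fixed_by_sl2.
Qed.

Context (v : 'cV[K]_n).
Hypothesis Ev : rE *m v = 0.
Hypothesis v0 : v != 0.

Let N := wbound r v.
Definition hwv (m : nat) : 'cV[K]_n := wvec r v m%:Z.
Definition hcurve z : 'cV[K]_n := \sum_(m < N.+1) z ^+ m *: hwv m.

Lemma hwvE m : rE *m hwv m = 0.
Proof. exact: wvecE. Qed.

Lemma hwvH m : rH *m hwv m = m%:R *: hwv m.
Proof. exact: wvecH. Qed.

Lemma wvec_pos k : wvec r v k != 0 -> exists m : nat, k = m.+1%:Z.
Proof.
move=> w0; have [m [km _ _]] := highest_weight (wvecE Ev k) (wvecH r v k) w0.
by exists m; apply/eqP; rewrite -(eqr_int K) km.
Qed.

Lemma hwv0 : hwv 0 = 0.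
Proof. by apply/eqP; apply: contraT => /wvec_pos[]. Qed.

Lemma hcurveE z : z != 0 -> hcurve z = r (tz z) *m v.
Proof.
move=> z0; rewrite act_tz // -/N.
rewrite -(big_mkord xpredT (fun l => z ^ (l%:Z - N%:Z) *: wvec r v (l%:Z - N%:Z))).
rewrite (@big_cat_nat _ _ _ N) //=; last by lia.
rewrite [X in _ = X + _]big_nat big1 ?add0r => [|l /andP[_ lN]]; last first.
  have [->|/wvec_pos[m e]] := eqVneq (wvec r v (l%:Z - N%:Z)) 0; first exact: scaler0.
  by lia.
rewrite -[X in \sum_(X <= _ < _) _]add0n big_addn (_ : (N.*2.+1 - N = N.+1)%N); last by lia.
rewrite big_mkord; apply: eq_bigr => m _.
have -> : (m + N)%N%:Z - N%:Z = m%:Z by lia.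
by [].
Qed.

Lemma hcurve0 : hcurve 0 = 0.
Proof.
rewrite /hcurve big_ord_recl expr0 hwv0 scaler0 add0r big1 // => i _.
by rewrite lift0 expr0n scale0r.
Qed.

Lemma hwv_sum : v = \sum_(m < N.+1) hwv m.
Proof.
have := hcurveE (oner_neq0 K); rewrite tz1 act1 mul1mx => <-.
by apply: eq_bigr => m _; rewrite expr1n scale1r.
Qed.

Lemma exists_hwv : exists m, hwv m != 0.
Proof.
have [/existsP[m]|] := boolP [exists m : 'I_N.+1, hwv m != 0]; first by exists m.
rewrite negb_exists => /forallP w0; case/eqP: v0; rewrite hwv_sum big1 // => m _.
by apply/eqP; have := w0 m; rewrite negbK.
Qed.

Definition minw := ex_minn exists_hwv.

Lemma minw_neq0 : hwv minw != 0.
Proof. by rewrite /minw; case: ex_minnP. Qed.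

Lemma minw_min m : (m < minw)%N -> hwv m = 0.
Proof.
rewrite /minw; case: ex_minnP => k _ mink mk; apply/eqP; apply: contraT => /mink.
by rewrite leqNgt mk.
Qed.

Lemma minw_pos : (0 < minw)%N.
Proof. by rewrite lt0n; apply: contraNneq minw_neq0 => ->; rewrite hwv0. Qed.

Lemma hwv_string m : hwv m != 0 ->
  iter m (mulmx rF) (hwv m) != 0 /\ iter m.+1 (mulmx rF) (hwv m) = 0.
Proof.
move=> w0; have [k [/eqP km Fk Fk1]] := highest_weight (hwvE m) (hwvH m) w0.
by move: km; rewrite eqr_nat => /eqP e; rewrite {1 3}e.
Qed.

Lemma Hv_neq0 : rH *m v != 0.
Proof.
apply/eqP => /wvecH0 H0; case/eqP: minw_neq0; apply: H0.
by rewrite eqz_nat -lt0n minw_pos.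
Qed.

(** Applying E to X v = 0 leaves a multiple of H v, nonzero because all weights of v are positive;
    so the coefficient of F vanishes, and then that of H. *)
Lemma stab_unipotent X : \tr X = 0 -> dr r X *m v = 0 -> X = X 0 1 *: E.
Proof.
move=> trX; rewrite {1}(sl2_decompH trX) lin_EFH Ev scaler0 add0r => Xv.
have [EF HE _] := dr_brackets r.
have x10 : X 1 0 = 0.
  have := congr1 (mulmx rE) Xv; rewrite mulmxDr -!scalemxAr mulmx0 mulmxA EF mulmxDl.
  rewrite -mulmxA Ev mulmx0 add0r [rE *m (rH *m v)]mulmxA.
  have -> : rE *m rH = rH *m rE - 2%:R *: rE by rewrite HE addrK.
  rewrite mulmxBl -mulmxA -scalemxAl Ev mulmx0 scaler0 subr0 scaler0 addr0.
  by move/eqP; rewrite scaler_eq0 (negPf Hv_neq0) orbF => /eqP.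
move: Xv; rewrite x10 scale0r add0r => /eqP; rewrite scaler_eq0 (negPf Hv_neq0) orbF.
by move/eqP => x00; rewrite {1}(sl2_decompH trX) x10 x00 !scale0r !addr0.
Qed.

Context (M : 'M[K]_n) (c : 'cV[K]_n).
Hypothesis st : stabilizes r v M c.

Lemma tangent_unipotent g : \det g = 1 -> tangent_at r (r g *m v) M c.
Proof.
(* The chart of [tangent_dim2] moves in the directions E and F, but E kills v. At g0 v the
   stabilizer is spanned by g0 E g0^-1 = -N, which is not in the span of E and F. *)
pose g0 := 1%:M + 1 *: F; have g01 : \det g0 = 1 by apply/det_unip/nilpF.
have conjE : g0 *m E *m invmx g0 = (-1) *: mN K.
  apply: (can_inj (mulmxK (SL_unit g01))); rewrite mulmxKV ?SL_unit //.
  by rewrite /g0 unipF /mE /mN !mk2E; congr mk2; ring.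
have Nv : dr r (mN K) *m (r g0 *m v) = 0.
  have : dr r (g0 *m E *m invmx g0) *m (r g0 *m v) = 0.
    by rewrite mulmxA -dr_conj ?trE // -mulmxA Ev mulmx0.
  by rewrite conjE drZ -scalemxAl scaleN1r => /eqP; rewrite oppr_eq0 => /eqP.
have tan0 : forall M' c', stabilizes r (r g0 *m v) M' c' -> tangent_at r (r g0 *m v) M' c'.
  apply: (@tangent_dim2 _ _ _ _ 1) => [s t Xv|h h1]; last first.
    rewrite mul1r => /(SL2_EFN h1)[s [t [w hE]]]; exists s, t.
    have d1 : \det (mk2 (1 + s * t) s t 1) = 1 by rewrite det_mk2; ring.
    have d2 : \det (1%:M + w *: mN K) = 1 by apply/det_unip/nilpN.
    by rewrite {1}hE (actM r d1 d2) -mulmxA (unip_fix w (nilpN K) Nv).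
  pose X := invmx g0 *m (s *: E + t *: F) *m g0.
  have trEF : \tr (s *: E + t *: F) = 0 by rewrite mxtraceD !mxtraceZ trE trF !mulr0 addr0.
  have trX : \tr X = 0 by rewrite /X mxtrace_mulC mulmxA mulmxV ?SL_unit // mul1mx.
  have : dr r X *m v = 0.
    have := dr_conj r (det_invmx g01) trEF; rewrite invmxK => e.
    have -> : v = r (invmx g0) *m (r g0 *m v) by rewrite mulmxA actVK // mul1mx.
    by rewrite mulmxA -e -mulmxA Xv mulmx0.
  move/(stab_unipotent trX) => XE.
  have : s *: E + t *: F = X 0 1 *: (g0 *m E *m invmx g0).
    by rewrite scalemxAl scalemxAr -XE /X !mulmxA mulmxV ?SL_unit // mul1mx mulmxK ?SL_unit.
  rewrite conjE scalerA mulrN1 scaleNr => /eqP; rewrite -addr_eq0 => /eqP.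
  rewrite /mE /mF /mN !mk2E => /matrixP e.
  have := e 0 0; have := e 0 1; have := e 1 0; rewrite !mxE /=.
  rewrite !mulr0 !mulr1 !add0r => e10 e01 e00; rewrite e00 in e10 e01.
  by move: e10 e01; rewrite mul0r !addr0.
move=> g1.
have -> : r g *m v = r (g *m invmx g0) *m (r g0 *m v).
  rewrite actM ?det_invmx // -!mulmxA; congr (_ *m _).
  by rewrite mulmxA actVK // mul1mx.
apply: tangent_orbit => //; first by rewrite det_mulmx g1 det_invmx ?mulr1.
exact: stabilizes_base.
Qed.

Lemma minw_bound : (minw <= N)%N.
Proof.
rewrite leqNgt; apply/negP => lt; case/eqP: minw_neq0.
exact: wvec_out.
Qed.

Local Notation w := (hwv minw).

Lemma Fw_neq0 : rF *m w != 0.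
Proof.
have [+ _] := hwv_string minw_neq0; apply: contraNneq => Fw.
have : iter minw.-1.+1 (mulmx rF) w = 0.
  by elim: minw.-1 => [|j IH] //; rewrite iterS IH mulmx0.
by rewrite (prednK minw_pos) => ->.
Qed.

Lemma Hw : rH *m w = minw%:R *: w. Proof. exact: hwvH. Qed.

Lemma HFw : rH *m (rF *m w) = (minw%:R - 2%:R) *: (rF *m w).
Proof. by have := iterF_H 1 Hw; rewrite mul1r. Qed.

Lemma indep_wFw (x y : K) : x *: w + y *: (rF *m w) = 0 -> x = 0 /\ y = 0.
Proof.
move=> e; have := congr1 (mulmx rH) e.
rewrite mulmxDr -!scalemxAr Hw HFw mulmx0 => e'.
have : (2%:R * x) *: w = 0.
  rewrite -[RHS]subr0 -{1}e' -(scaler0 _ (minw%:R - 2%:R)) -e.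
  move: (rF *m w) w (minw%:R : K) => b a k.
  by apply/colP => i; rewrite !mxE; ring.
move/eqP; rewrite scaler_eq0 (negPf minw_neq0) orbF mulf_eq0 pnatr_eq0 /= => /eqP x0.
split=> //; move/eqP: e; rewrite x0 scale0r add0r scaler_eq0 (negPf Fw_neq0) orbF.
by move/eqP.
Qed.

(** The curve divided by z^minw. For m < minw the truncated exponent is 0, but there [hwv m = 0]. *)
Definition hq z : 'cV[K]_n := \sum_(m < N.+1) z ^+ (m - minw) *: hwv m.

Lemma hcurve_hq z : hcurve z = z ^+ minw *: hq z.
Proof.
rewrite scaler_sumr; apply: eq_bigr => m _; rewrite scalerA -exprD.
have [lt|le] := ltnP m minw; first by rewrite minw_min // !scaler0.
by rewrite subnKC.
Qed.

Lemma hq0 : hq 0 = w.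
Proof.
have lt : (minw < N.+1)%N by rewrite ltnS minw_bound.
rewrite /hq (bigD1 (Ordinal lt)) //= subnn expr0 scale1r big1 ?addr0 // => m mk.
have [le|lt'] := leqP m minw.
  rewrite minw_min ?scaler0 // ltn_neqAle le andbT.
  by apply: contraNneq mk => e; apply/eqP/val_inj.
by rewrite expr0n subn_eq0 leqNgt lt' scale0r.
Qed.

Definition vpoly (l : 'rV[K]_n) (e : nat -> nat) : {poly K} :=
  \sum_(m < N.+1) (l *m hwv m) 0 0 *: 'X^(e m).

Lemma horner_vpoly l e z :
  (vpoly l e).[z] = (l *m \sum_(m < N.+1) z ^+ e m *: hwv m) 0 0.
Proof.
rewrite horner_sum mulmx_sumr summxE; apply: eq_bigr => m _.
by rewrite hornerZ hornerXn mulrC -scalemxAr [RHS]mxE.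
Qed.

(** At the point g^-1 diag(z, 1/z) v, tangency puts g Y_A in the span of F [hq z] and H [hq z]. As z
    -> 0 these tend to F w and minw w, while g Y_A tends to g M^-1 A c because the curve tends to
    0. *)
Lemma tangent_limit A g : \tr A = 0 -> \det g = 1 ->
  exists x y : K, r g *m (invmx M *m (dr r A *m c)) = x *: w + y *: (rF *m w).
Proof.
move=> trA g1; set y0 := r g *m _.
pose h := invmx g; have h1 : \det h = 1 by apply: det_invmx.
pose L := r g *m invmx M *m dr r A *m M *m r h.
have y_span z : z != 0 ->
    exists x y : K, L *m hcurve z + y0 = x *: (rF *m hq z) + y *: (rH *m hq z).
  move=> z0; have hz1 : \det (h *m tz z) = 1 by rewrite det_mulmx h1 det_tz ?mulr1.
  have [X trX XE] := tangent_unipotent hz1 trA.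
  pose X' := g *m X *m invmx g.
  have trX' : \tr X' = 0 by rewrite tr_conj.
  have -> : L *m hcurve z + y0 = dr r X' *m hcurve z.
    rewrite hcurveE // /y0 /L; have := congr1 (mulmx (r g)) XE.
    rewrite [X in _ = X]mulmxA dr_conj // -/X' actM ?det_tz // -!mulmxA.
    rewrite [r g *m (r h *m _)]mulmxA actK // mul1mx => <-.
    by rewrite !mulmxDr.
  rewrite (sl2_decompH trX') lin_EFH.
  have -> : rE *m hcurve z = 0.
    by rewrite mulmx_sumr big1 // => m _; rewrite -scalemxAr hwvE scaler0.
  rewrite scaler0 add0r hcurve_hq -!scalemxAr !scalerA.
  by exists (X' 1 0 * z ^+ minw), (X' 0 0 * z ^+ minw).
(* The limit is taken on a determinant: l1 kills w and F w, and l2, l3 are dual to them. The 3 x 3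
   determinant of the three vectors under l1, l2, l3 is a polynomial in z, zero for z nonzero, and
   at z = 0 it equals minw times the value of l1. *)
apply: span2 => l1 l1w l1F.
have [l2 [l3 [l2w l2F l3w l3F]]] := dual2 indep_wFw.
pose ap l : {poly K} := vpoly (l *m L) id + ((l *m y0) 0 0)%:P.
pose bp l := vpoly (l *m rF) (subn^~ minw).
pose cp l := vpoly (l *m rH) (subn^~ minw).
have apE l z : (ap l).[z] = (l *m (L *m hcurve z + y0)) 0 0.
  by rewrite /ap hornerD hornerC horner_vpoly mulmxDr [RHS]mxE mulmxA.
have bpE l z : (bp l).[z] = (l *m (rF *m hq z)) 0 0 by rewrite horner_vpoly mulmxA.
have cpE l z : (cp l).[z] = (l *m (rH *m hq z)) 0 0 by rewrite horner_vpoly mulmxA.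
clearbody ap bp cp.
have det3 (p1 p2 p3 q1 q2 q3 s1 s2 s3 : {poly K}) z :
    (p1 * (q2 * s3 - q3 * s2) - p2 * (q1 * s3 - q3 * s1) + p3 * (q1 * s2 - q2 * s1)).[z] =
    p1.[z] * (q2.[z] * s3.[z] - q3.[z] * s2.[z]) - p2.[z] * (q1.[z] * s3.[z] - q3.[z] * s1.[z])
    + p3.[z] * (q1.[z] * s2.[z] - q2.[z] * s1.[z]).
  by rewrite !(hornerD, hornerN, hornerM).
have D0 : ap l1 * (bp l2 * cp l3 - bp l3 * cp l2) - ap l2 * (bp l1 * cp l3 - bp l3 * cp l1)
    + ap l3 * (bp l1 * cp l2 - bp l2 * cp l1) = 0.
  apply: poly_nz_ext => z z0; rewrite horner0 det3 !apE.
  have [x [y ->]] := y_span z z0.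
  have lin l : (l *m (x *: (rF *m hq z) + y *: (rH *m hq z))) 0 0 =
      x * (bp l).[z] + y * (cp l).[z].
    by rewrite bpE cpE mulmxDr -!scalemxAr; move: (l *m _) (l *m _) => s t; rewrite !mxE.
  by rewrite !lin; ring.
have := det3 (ap l1) (ap l2) (ap l3) (bp l1) (bp l2) (bp l3) (cp l1) (cp l2) (cp l3) 0.
rewrite D0 horner0 !apE !bpE !cpE hq0 hcurve0 mulmx0 add0r Hw.
rewrite -!scalemxAr l1w l1F l2w l2F l3w l3F scaler0.
have e1 : (1%:M : 'M[K]_1) 0 0 = 1 by rewrite mxE.
have e0 : (0 : 'M[K]_1) 0 0 = 0 by rewrite mxE.
have eZ (k : K) (s : 'M[K]_1) : (k *: s) 0 0 = k * s 0 0 by rewrite mxE.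
rewrite !eZ e1 e0; set k := minw%:R; set a := (l1 *m y0) 0 0.
have k0 : k != 0 :> K by rewrite pnatr_eq0 -lt0n minw_pos.
move/esym=> e; have /eqP : a * k = 0 by rewrite -[RHS]e; ring.
rewrite mulf_eq0 (negPf k0) orbF => /eqP a0.
by apply/matrixP => i j; rewrite !ord1 [RHS]mxE.
Qed.

(** Modulo the span, g(1 + tF) b vanishes identically in t; its coefficient at t is the claim. *)
Lemma derivF_span b :
  (forall g, \det g = 1 -> exists x y : K, r g *m b = x *: w + y *: (rF *m w)) ->
  forall g, \det g = 1 -> exists x y : K, r g *m (rF *m b) = x *: w + y *: (rF *m w).
Proof.
move=> bS g g1; apply: span2 => l lw lF.
have [B HB] := ucoef_bound r F.
(* Raising the bound to at least 2 keeps the coefficient of t in range. *)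
have HB2 k : (B.+2 <= k)%N -> ucoef r F k = 0 by move=> kB; apply: HB; lia.
pose p : {poly K} := \poly_(k < B.+2) (l *m r g *m ucoef r F k *m b) 0 0.
have p0 : p = 0.
  apply: poly_ext => t; rewrite horner0 horner_poly.
  have t1 : \det (1%:M + t *: F) = 1 by apply/det_unip/nilpF.
  have gt1 : \det (g *m (1%:M + t *: F)) = 1 by rewrite det_mulmx g1 t1 mulr1.
  have [x [y e]] := bS _ gt1.
  have : (l *m (r (g *m (1%:M + t *: F)) *m b)) 0 0 = 0.
    by rewrite e mulmxDr -!scalemxAr lw lF !scaler0 addr0 mxE.
  rewrite actM // (act_unip t (nilpF K) HB2) => e0; rewrite -[RHS]e0.
  rewrite mulmx_sumr mulmx_suml mulmx_sumr summxE; apply: eq_bigr => k _.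
  by rewrite -!scalemxAr -scalemxAl -scalemxAr !mulmxA [RHS]mxE mulrC.
have := congr1 (fun q : {poly K} => q`_1) p0; rewrite coef0 coef_poly /= => e.
have u1 : ucoef r F 1 = rF.
  by have := ucoefS r 0 (nilpF K); rewrite scale1r ucoef0 mulmx1.
by apply/matrixP => i j; rewrite !ord1 [RHS]mxE -[RHS]e u1 !mulmxA.
Qed.

Lemma F2w_span (x y z : K) : z *: (rF *m (rF *m w)) = x *: w + y *: (rF *m w) ->
  z *: (rF *m (rF *m w)) = 0.
Proof.
have HF2 : rH *m (rF *m (rF *m w)) = (minw%:R - 2%:R * 2%:R) *: (rF *m (rF *m w)).
  exact: (iterF_H 2 Hw).
move=> e; have e1 := congr1 (mulmx rH) e; have e2 := congr1 (mulmx rH) e1.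
move: e1 e2; rewrite !(mulmxDr, =^~ scalemxAr) !(HF2, Hw, HFw).
rewrite !(mulmxDr, =^~ scalemxAr) !(HF2, Hw, HFw).
move: w (rF *m w) (rF *m (rF *m w)) (minw%:R : K) e => a b d k e e1 e2.
apply/colP => i; have := congr1 (fun s : 'cV_n => s i 0) e; have := congr1 (fun s : 'cV_n => s i 0) e1.
have := congr1 (fun s : 'cV_n => s i 0) e2; rewrite !mxE.
move: (a i 0) (b i 0) (d i 0) => {}a {}b {}d {}e2 {}e1 {}e.
(* 8 is the value at the weight k - 4 of F^2 w of the polynomial (x - k)(x - k + 2), which vanishes
   at the weights of w and F w. *)
apply: (mulfI (_ : 8%:R != 0)); first by rewrite pnatr_eq0.
rewrite mulr0.
have -> : 8%:R * (z * d) = z * ((k - 2%:R * 2%:R) * ((k - 2%:R * 2%:R) * d))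
  - (2%:R * k - 2%:R) * (z * ((k - 2%:R * 2%:R) * d)) + k * (k - 2%:R) * (z * d) by ring.
by rewrite e2 e1 e; ring.
Qed.

(** b = M^-1 A c, F b and F^2 b all lie in the span of w and F w. As F^2 w is nonzero and of another
    weight, both coordinates of b vanish. *)
Lemma translation_minw_ge2 : (1 < minw)%N -> c = 0.
Proof.
move=> k1; have F2 : rF *m (rF *m w) != 0.
  have [+ _] := hwv_string minw_neq0; apply: contraNneq => Fw.
  move: w Fw => u Fu; case: minw k1 => [|[|m]] // _; apply/eqP.
  by elim: m => [|m IH] //; rewrite iterS IH mulmx0.
suff drc A : \tr A = 0 -> dr r A *m c = 0.
  by apply: noinv; apply: fixed_by_sl2; apply: drc; rewrite ?trE ?trF.
move=> trA; pose b := invmx M *m (dr r A *m c).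
have bS := tangent_limit trA; rewrite -/b in bS.
have b1S := derivF_span bS; have b2S := derivF_span b1S.
have at1 u : (forall g, \det g = 1 -> exists x y : K, r g *m u = x *: w + y *: (rF *m w)) ->
    exists x y : K, u = x *: w + y *: (rF *m w).
  by move=> /(_ 1%:M (det1 _ _)); rewrite act1 mul1mx.
have [x [y be]] := at1 _ bS; have [x1 [y1 b1e]] := at1 _ b1S; have [x2 [y2 b2e]] := at1 _ b2S.
have y0 : y = 0.
  have : y *: (rF *m (rF *m w)) = x1 *: w + (y1 - x) *: (rF *m w).
    rewrite scalerBl addrA -b1e be mulmxDr -!scalemxAr.
    by rewrite addrAC subrr add0r.
  by move/F2w_span/eqP; rewrite scaler_eq0 (negPf F2) orbF => /eqP.
have x0 : x = 0.
  have : x *: (rF *m (rF *m w)) = x2 *: w + y2 *: (rF *m w).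
    by rewrite -b2e be y0 scale0r addr0 -!scalemxAr.
  by move/F2w_span/eqP; rewrite scaler_eq0 (negPf F2) orbF => /eqP.
have [Mu _ _] := st.
have b0 : b = 0 by rewrite be x0 y0 !scale0r addr0.
by rewrite -[dr r A *m c]mul1mx -(mulmxV Mu) -mulmxA -/b b0 mulmx0.
Qed.

End UnipotentStabilizer.

(** * The Casimir operator and the projection to weight 1 *)

Section Casimir.
Context (K : numClosedFieldType) (n : nat) (r : polyrep K n).
Local Notation rE := (dr r (mE K)).
Local Notation rF := (dr r (mF K)).
Local Notation rH := (dr r (mH K)).
Implicit Types (g : 'M[K]_2) (u : 'cV[K]_n).

(** H^2 + 2(EF + FE), rewritten with E on the right so that highest weight vectors are visibly
    eigenvectors. *)
Definition casimir : 'M[K]_n := rH *m rH + 2%:R *: rH + 4%:R *: (rF *m rE).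

Lemma casimir_E : rE *m casimir = casimir *m rE.
Proof.
have [EF HE _] := dr_brackets r.
have HHE : rH *m rH *m rE = rE *m rH *m rH + 4%:R *: (rE *m rH) + 4%:R *: rE.
  rewrite -mulmxA HE mulmxDr mulmxA HE -scalemxAr HE mulmxDl -scalemxAl.
  move: (rE *m rH *m rH) (rE *m rH) rE => x y z.
  by apply/matrixP => i j; rewrite !mxE; ring.
have EFE : rE *m (rF *m rE) = rF *m rE *m rE + rE *m rH + 2%:R *: rE.
  by rewrite mulmxA EF mulmxDl HE addrA.
rewrite /casimir !mulmxDr !mulmxDl -!scalemxAr -!scalemxAl HHE EFE HE mulmxA.
move: (rE *m rH *m rH) (rE *m rH) (rF *m rE *m rE) rE => x y z t.
by apply/matrixP => i j; rewrite !mxE; ring.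
Qed.

Lemma casimir_F : rF *m casimir = casimir *m rF.
Proof.
have [EF _ HF] := dr_brackets r.
have HHF : rH *m rH *m rF = rF *m rH *m rH - 4%:R *: (rF *m rH) + 4%:R *: rF.
  rewrite -mulmxA HF mulmxBr mulmxA HF -scalemxAr HF mulmxBl -scalemxAl.
  move: (rF *m rH *m rH) (rF *m rH) rF => x y z.
  by apply/matrixP => i j; rewrite !mxE; ring.
have FEF : rF *m rE *m rF = rF *m (rF *m rE) + rF *m rH.
  by rewrite -mulmxA EF mulmxDr.
rewrite /casimir !mulmxDr !mulmxDl -!scalemxAr -!scalemxAl HHF FEF HF mulmxA.
move: (rF *m rH *m rH) (rF *m rH) (rF *m (rF *m rE)) rF => x y z t.
by apply/matrixP => i j; rewrite !mxE; ring.
Qed.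

Lemma casimir_act g : \det g = 1 -> r g *m casimir = casimir *m r g.
Proof. exact: (intertwine casimir_E casimir_F). Qed.

Lemma casimir_highest u (k : K) : rE *m u = 0 -> rH *m u = k *: u ->
  casimir *m u = (k * (k + 2%:R)) *: u.
Proof.
move=> Eu Hu; rewrite /casimir !mulmxDl -!scalemxAl -!mulmxA Eu Hu -scalemxAr Hu.
by rewrite mulmx0 scaler0 addr0 !scalerA -scalerDl; congr (_ *: _); ring.
Qed.

(** P is the product over m = 2, ..., J of (C - m(m + 2)) / (3 - m(m + 2)), where C is the Casimir
    operator and 3 = 1(1 + 2) its eigenvalue in weight 1; being a polynomial in C, it commutes with
    the group. *)
Lemma weight1_projection J : exists P : 'M[K]_n, [/\
  forall g, \det g = 1 -> r g *m P = P *m r g,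
  forall u, rE *m u = 0 -> rH *m u = u -> P *m u = u &
  forall m u, (1 < m <= J)%N -> rE *m u = 0 -> rH *m u = m%:R *: u -> P *m u = 0].
Proof.
elim: J => [|J [P [Pg P1 P0]]].
  exists 1%:M; split=> [g _|u _ _|m u]; rewrite ?mul1mx ?mulmx1 //.
  by rewrite ltnNge => /andP[/negP + le]; rewrite (leq_trans le).
have [J0|Jpos] := posnP J.
  exists P; split=> // m u; rewrite J0 => /andP[lt le].
  by have := leq_trans lt le; rewrite ltnn.
pose e : K := J.+1%:R * (J.+1%:R + 2%:R).
have e3 : 3%:R - e != 0.
  rewrite /e -!natrD -natrM subr_eq0 eqr_nat; apply/eqP; nia.
pose P' := (3%:R - e)^-1 *: (P *m (casimir - e%:M)).
have P'u u k : rE *m u = 0 -> rH *m u = k *: u ->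
    P' *m u = ((3%:R - e)^-1 * (k * (k + 2%:R) - e)) *: (P *m u).
  move=> Eu Hu; rewrite -scalemxAl -mulmxA mulmxBl (casimir_highest Eu Hu) mul_scalar_mx.
  by rewrite -scalerBl -scalemxAr scalerA.
exists P'; split=> [g g1|u Eu Hu|m u].
- rewrite -scalemxAr mulmxA (Pg _ g1) -!scalemxAl -!mulmxA; congr (_ *: (_ *m _)).
  by rewrite mulmxBr mulmxBl casimir_act // scalar_mxC.
- rewrite (P'u _ 1) ?scale1r // P1 //.
  have -> : 1 * (1 + 2%:R) - e = 3%:R - e by rewrite mul1r.
  by rewrite mulVf // scale1r.
- rewrite (leq_eqVlt m) ltnS => /andP[lt /orP[/eqP mJ|le]] Eu Hu; rewrite (P'u _ _ Eu Hu).
    by rewrite mJ subrr mulr0 scale0r.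
  by rewrite (P0 m) ?lt // scaler0.
Qed.

End Casimir.

(** * Unipotent stabilizer with minimal weight 1 *)

Section MinimalWeightOne.
Context (K : numClosedFieldType) (n : nat) (r : polyrep K n).
Local Notation MP := {mpoly K[2 * 2]}.
Local Notation mev g p := (meval (fun k => mxvec g 0 k) p).
Local Notation E := (mE K).
Local Notation F := (mF K).
Local Notation rE := (dr r (mE K)).
Local Notation rF := (dr r (mF K)).
Local Notation rH := (dr r (mH K)).
Implicit Types (g h A : 'M[K]_2) (t z a b : K) (u x y : 'cV[K]_n) (l : 'rV[K]_n).
Hypothesis noinv : forall x : 'cV[K]_n, (forall g, \det g = 1 -> r g *m x = x) -> x = 0.
Context (v : 'cV[K]_n).
Hypothesis Ev : rE *m v = 0.
Hypothesis v0 : v != 0.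
Let N := wbound r v.
Local Notation hwv := (hwv r v).
Local Notation hcurve := (hcurve r v).

(** The sum of a^(m - j) b^j F^j v_m / j!. For a nonzero it is (1 + (b/a)F) diag(a, 1/a) v; the
    denominators disappear because F^j v_m = 0 for j > m. *)
Definition orbit_map a b : 'cV[K]_n :=
  \sum_(m < N.+1) \sum_(j < m.+1) (a ^+ (m - j) * b ^+ j) *: (ucoef r F j *m hwv m).

Lemma ucoef_hwv m j : (m < j)%N -> ucoef r F j *m hwv m = 0.
Proof.
have iterE k : k`!%:R *: (ucoef r F k *m hwv m) = iter k (mulmx rF) (hwv m).
  elim: k => [|k IH]; first by rewrite fact0 scale1r ucoef0 mul1mx.
  rewrite iterS -IH -scalemxAr mulmxA -(ucoefS r k (nilpF K)) -scalemxAl scalerA.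
  by rewrite factS mulnC natrM.
move=> mj; have [->|w0] := eqVneq (hwv m) 0; first exact: mulmx0.
have [_ F0] := hwv_string noinv Ev w0.
have : iter j (mulmx rF) (hwv m) = 0.
  rewrite -(subnK mj) iterD F0; elim: (j - m.+1)%N => [|k IH] //.
  by rewrite iterS IH mulmx0.
rewrite -iterE => /eqP; rewrite scaler_eq0 pnatr_eq0 => /orP[/eqP f0|/eqP //].
by have := fact_gt0 j; rewrite f0.
Qed.

Lemma act_orbit_map_generic g : \det g = 1 -> g 0 0 != 0 ->
  r g *m v = orbit_map (g 0 0) (g 1 0).
Proof.
move=> g1 a0; set a := g 0 0 in a0 *; set b := g 1 0; pose s := b / a.
have d1 : \det (1%:M + s *: F) = 1 by apply/det_unip/nilpF.
have d2 : \det (1%:M + (g 0 1 / a) *: E) = 1 by apply/det_unip/nilpE.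
have gE : g = (1%:M + s *: F) *m tz a *m (1%:M + (g 0 1 / a) *: E).
  rewrite unipF unipE /tz !mk2M.
  rewrite [LHS](_ : _ = mk2 a (g 0 1) b (g 1 1)); last exact: mk2_eta.
  have dE : g 1 1 = (1 + g 0 1 * b) / a.
    by apply: (mulIf a0); rewrite mulfVK // -g1 det_mk2E -/a -/b; ring.
  by rewrite dE /s; congr mk2; field.
rewrite gE !actM ?det_mulmx ?d1 ?det_tz ?mul1r // -!mulmxA (unip_fix _ (nilpE K) Ev) -hcurveE //.
have [B HB] := ucoef_bound r F.
pose B' := (B + N.+1)%N; have HB' k : (B' <= k)%N -> ucoef r F k = 0 by move=> kB; apply: HB; lia.
rewrite (act_unip _ (nilpF K) HB') mulmx_sumr; apply: eq_bigr => m _.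
rewrite mulmx_suml (big_ord_widen B' (fun j => (a ^+ (m - j) * b ^+ j) *: (ucoef r F j *m hwv m)));
  last exact: leq_trans (ltn_ord m) (leq_addl _ _).
rewrite [RHS]big_mkcond /=; apply: eq_bigr => j _.
rewrite -scalemxAl -scalemxAr; case: ltnP => [jm|mj]; last by rewrite ucoef_hwv ?scaler0.
rewrite scalerA; congr (_ *: _).
have -> : a ^+ m = a ^+ (m - j) * a ^+ j by rewrite -exprD subnK.
by rewrite /s expr_div_n mulrCA divfK // expf_neq0.
Qed.

Definition orbit_poly l (p q : {poly K}) : {poly K} :=
  \sum_(m < N.+1) \sum_(j < m.+1) (l *m (ucoef r F j *m hwv m)) 0 0 *: (p ^+ (m - j) * q ^+ j).

Lemma horner_orbit_poly l p q z :
  (orbit_poly l p q).[z] = (l *m orbit_map p.[z] q.[z]) 0 0.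
Proof.
rewrite /orbit_poly /orbit_map horner_sum mulmx_sumr summxE; apply: eq_bigr => m _.
rewrite horner_sum mulmx_sumr summxE; apply: eq_bigr => j _.
by rewrite hornerZ hornerM !horner_exp -scalemxAr [RHS]mxE mulrC.
Qed.

Lemma eq_functional x y : (forall l, (l *m x) 0 0 = (l *m y) 0 0) -> x = y.
Proof.
move=> H; apply/colP => i; have := H (delta_mx 0 i).
by rewrite -!rowE !mxE.
Qed.

(** Points with a = 0 are reached along (1 + tE)g, whose first column is (tb, b): both sides are
    polynomials in t that agree for t nonzero. *)
Lemma act_orbit_map g : \det g = 1 -> r g *m v = orbit_map (g 0 0) (g 1 0).
Proof.
move=> g1; have [a0|] := eqVneq (g 0 0) 0; last exact: act_orbit_map_generic.
have b0 : g 1 0 != 0.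
  by apply: contraPneq g1 => b0; 
    rewrite det_mk2E a0 b0 !mul0r mulr0 subrr => /esym/eqP; rewrite oner_eq0.
have [B HB] := ucoef_bound r E.
apply: eq_functional => l.
pose p : {poly K} := \poly_(k < B) (l *m (ucoef r E k *m (r g *m v))) 0 0.
have pE t : p.[t] = (l *m (r ((1%:M + t *: E) *m g) *m v)) 0 0.
  rewrite actM ?(det_unip _ (nilpE K)) // (act_unip _ (nilpE K) HB) -mulmxA.
  rewrite mulmx_suml mulmx_sumr summxE horner_poly.
  by apply: eq_bigr => k _; rewrite -scalemxAl -scalemxAr [RHS]mxE mulrC.
have : p = orbit_poly l (g 1 0 *: 'X) (g 1 0)%:P.
  apply: poly_nz_ext => t t0; rewrite pE horner_orbit_poly hornerZ hornerX hornerC.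
  have e : (1%:M + t *: E) *m g = mk2 (t * g 1 0) (g 0 1 + t * g 1 1) (g 1 0) (g 1 1).
    rewrite unipE {1}[g](_ : _ = mk2 (g 0 0) (g 0 1) (g 1 0) (g 1 1)); last exact: mk2_eta.
    by rewrite mk2M a0; congr mk2; ring.
  have d1 : \det ((1%:M + t *: E) *m g) = 1 by rewrite det_mulmx g1 mulr1; apply/det_unip/nilpE.
  have e00 : ((1%:M + t *: E) *m g) 0 0 = g 1 0 * t by rewrite e mxE /= mulrC.
  have e10 : ((1%:M + t *: E) *m g) 1 0 = g 1 0 by rewrite e mxE.
  by rewrite act_orbit_map_generic ?e00 ?e10 // mulf_neq0.
move/(congr1 (fun q : {poly K} => q.[0])).
by rewrite pE horner_orbit_poly hornerZ hornerX hornerC scale0r addr0 mul1mx mulr0 a0.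
Qed.

Lemma orbit_map00 : orbit_map 0 0 = 0.
Proof.
rewrite /orbit_map big1 // => m _; rewrite big1 // => j _.
rewrite !expr0n; have [j0|j0] := eqVneq (j : nat) 0%N; last by rewrite mulr0 scale0r.
rewrite j0 subn0; have [m0|m0] := eqVneq (m : nat) 0%N; last by rewrite mul0r scale0r.
by rewrite m0 (hwv0 noinv Ev) mulmx0 scaler0.
Qed.

Lemma exists_column a b : (a, b) != (0, 0) ->
  exists2 g : 'M[K]_2, \det g = 1 & g 0 0 = a /\ g 1 0 = b.
Proof.
move=> ab; have [a0|a0] := eqVneq a 0.
  have b0 : b != 0 by apply: contraNneq ab => ->; rewrite a0.
  exists (mk2 a (- b^-1) b 0); last by rewrite !mxE.
  by rewrite det_mk2 a0; field.
exists (mk2 a 0 b a^-1); last by rewrite !mxE.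
by rewrite det_mk2; field.
Qed.

Context (M : 'M[K]_n) (c : 'cV[K]_n).
Hypothesis st : stabilizes r v M c.
Hypothesis minw1 : minw noinv Ev v0 = 1%N.

Local Notation w := (hwv 1).

(** In weight 1, F^2 w = 0, so w and F w span a copy of the standard representation; the matrix with
    these columns intertwines, and its first column is the claim. *)
Lemma act_weight1 g : \det g = 1 -> r g *m w = g 0 0 *: w + g 1 0 *: (rF *m w).
Proof.
have [EF _ _] := dr_brackets r.
have w0 : w != 0 by have := minw_neq0 noinv Ev v0; rewrite minw1.
have [_ F2w] := hwv_string noinv Ev w0.
have Ew : rE *m w = 0 by apply: hwvE.
have Hw : rH *m w = w by rewrite hwvH scale1r.
pose X : 'M[K]_(n, 2) := row_mx w (rF *m w).
have XA (A : 'M[K]_2) : X *m A =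
    row_mx (A 0 0 *: w + A 1 0 *: (rF *m w)) (A 0 1 *: w + A 1 1 *: (rF *m w)).
  have e0 (a b : 'cV[K]_n) i : (row_mx a b : 'M_(n, 2)) i 0 = a i 0.
    by rewrite -(row_mxEl a b i 0); congr (row_mx _ _ _ _); apply: val_inj.
  have e1 (a b : 'cV[K]_n) i : (row_mx a b : 'M_(n, 2)) i 1 = b i 0.
    by rewrite -(row_mxEr a b i 0); congr (row_mx _ _ _ _); apply: val_inj.
  apply/matrixP => i j; rewrite mxE big_ord_recl big_ord1 /X.
  rewrite (_ : lift ord0 ord0 = 1); last exact: val_inj.
  rewrite (e0 w) (e1 w); elim/ord2P: j; rewrite ?e0 ?e1 [RHS]mxE
    [X in _ = X + _]mxE [X in _ = _ + X]mxE.
    by rewrite mulrC [X in _ + X]mulrC.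
  by rewrite mulrC [X in _ + X]mulrC.
have BX (B : 'M[K]_n) : B *m X = row_mx (B *m w) (B *m (rF *m w)).
  by exact: (@mul_mx_row _ n n 1 1 B w (rF *m w)).
have drstd A : dr (std_rep K) A = A.
  by apply/matrixP => i j; rewrite mxE DLE Der_gX mev_mulr mul1mx.
have XE : rE *m X = X *m dr (std_rep K) E.
  rewrite drstd XA BX Ew mulmxA EF mulmxDl -mulmxA Ew mulmx0 add0r Hw.
  by rewrite !mxE /= !scale0r !addr0 scale1r.
have XF : rF *m X = X *m dr (std_rep K) F.
  rewrite drstd XA BX -[rF *m (rF *m w)]/(iter 2 (mulmx rF) w) F2w.
  by rewrite !mxE /= !scale0r !add0r scale1r.
move=> g1; have := intertwine XE XF g1; rewrite XA BX.
by case/(@eq_row_mx _ n 1 1).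
Qed.

Lemma translation_minw_eq1 : c = 0.
Proof.
have w0 : w != 0 by have := minw_neq0 noinv Ev v0; rewrite minw1.
have [l1 [l2 [l1w l1F l2w l2F]]] := dual2 (indep_wFw (noinv := noinv) (Ev := Ev) (v0 := v0)).
rewrite minw1 in l1w l1F l2w l2F.
have [P [Pg P1 P0]] := weight1_projection r N.
have Pv : P *m v = w.
  have -> : P *m v = \sum_(m < N.+1) P *m hwv m by rewrite -mulmx_sumr -(hwv_sum noinv Ev).
  have lt1 : (1 < N.+1)%N by rewrite ltnS -[1%N]minw1 minw_bound.
  have rw1 : rH *m w = w by rewrite hwvH scale1r.
  rewrite (bigD1 (Ordinal lt1)) //= (P1 _ (hwvE Ev 1) rw1) big1 ?addr0 // => -[m ltm] /= m1.
  have [m0|mpos] := posnP m; first by rewrite m0 (hwv0 noinv Ev) mulmx0.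
  apply: (P0 m); rewrite ?hwvE ?hwvH //; have -> : (m <= N)%N by []; rewrite andbT.
  by rewrite ltn_neqAle mpos andbT eq_sym; apply: contraNneq m1 => e; apply/eqP/val_inj.
(* Applying P to f(diag(z, 1/z) v) = gv gives gw, whose coordinates in w and F w are the first
   column of g; so this column is polynomial in z. *)
pose a_ : {poly K} := vpoly r v (l2 *m P *m M) id + ((l2 *m (P *m c)) 0 0)%:P.
pose b_ : {poly K} := vpoly r v (l1 *m P *m M) id + ((l1 *m (P *m c)) 0 0)%:P.
have aE z : a_.[z] = (l2 *m (P *m (M *m hcurve z + c))) 0 0.
  by rewrite /a_ hornerD hornerC horner_vpoly !mulmxDr [RHS]mxE !mulmxA.
have bE z : b_.[z] = (l1 *m (P *m (M *m hcurve z + c))) 0 0.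
  by rewrite /b_ hornerD hornerC horner_vpoly !mulmxDr [RHS]mxE !mulmxA.
have [Mu fO fV] := st.
have curveE z : z != 0 -> M *m hcurve z + c = orbit_map a_.[z] b_.[z].
  move=> z0; have : orbit r v (hcurve z) by exists (tz z); rewrite ?det_tz ?hcurveE.
  move/fO => [g g1 gE]; rewrite aE bE gE !(mulmxA P) -Pg // -!mulmxA Pv act_weight1 //.
  have -> : (l2 *m (g 0 0 *: w + g 1 0 *: (rF *m w))) 0 0 = g 0 0.
    by rewrite mulmxDr -!scalemxAr l2w l2F scaler0 addr0 !mxE mulr1n mulr1.
  have -> : (l1 *m (g 0 0 *: w + g 1 0 *: (rF *m w))) 0 0 = g 1 0.
    by rewrite mulmxDr -!scalemxAr l1w l1F scaler0 add0r !mxE mulr1n mulr1.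
  exact: act_orbit_map.
have cE : c = orbit_map a_.[0] b_.[0].
  apply: eq_functional => l.
  have -> : (l *m c) 0 0 = (vpoly r v (l *m M) id + ((l *m c) 0 0)%:P).[0].
    by rewrite hornerD hornerC horner_vpoly -/(hcurve 0) (hcurve0 noinv Ev) mulmx0
      [(0 : 'M_1) 0 0]mxE add0r.
  rewrite -horner_orbit_poly; congr (_.[_]); apply: poly_nz_ext => z z0.
  rewrite hornerD hornerC horner_vpoly horner_orbit_poly -curveE //.
  by rewrite mulmxDr [RHS]mxE !mulmxA.
have [ab0|/exists_column[g g1 [ga gb]]] := eqVneq (a_.[0], b_.[0]) (0, 0).
  by move: ab0 => [a0 b0]; rewrite cE a0 b0 orbit_map00.
have : orbit r v c by exists g => //; rewrite act_orbit_map // ga gb.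
move/fV; rewrite subrr mulmx0 => -[h h1 /esym hv].
case/eqP: v0; rewrite -[v]mul1mx -(actVK r h1) -mulmxA hv mulmx0 //.
Qed.

End MinimalWeightOne.

(** * The three kinds of stabilizers *)

Section Stabilizers.
Context (K : numClosedFieldType) (n : nat) (r : polyrep K n).
Local Notation E := (mE K).
Local Notation F := (mF K).
Local Notation H := (mH K).
Local Notation rE := (dr r (mE K)).
Local Notation rF := (dr r (mF K)).
Local Notation rH := (dr r (mH K)).
Implicit Types (g h A X : 'M[K]_2) (v x : 'cV[K]_n).
Hypothesis noinv : forall x : 'cV[K]_n, (forall g, \det g = 1 -> r g *m x = x) -> x = 0.

Lemma unipotent_stabilizer_translation v M c : rE *m v = 0 -> v != 0 ->
  stabilizes r v M c -> c = 0.
Proof.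
move=> Ev v0 st; have [lt|le] := ltnP 1 (minw noinv Ev v0).
  exact: translation_minw_ge2 st lt.
apply: translation_minw_eq1 st _; apply/eqP.
by rewrite eqn_leq le; apply: minw_pos.
Qed.

Lemma nilp_conj X : nilp X -> X != 0 ->
  exists g, exists k : K, [/\ \det g = 1, k != 0 & X *m g = k *: (g *m E)].
Proof.
rewrite [X]mk2_eta; move: (X 0 0) (X 0 1) (X 1 0) (X 1 1) => a b c d.
rewrite /nilp tr_mk2 det_mk2 => -[tr0 det0] nz.
have dE : d = - a by apply/eqP; rewrite -addr_eq0 addrC tr0.
have bcE : b * c = - (a * a).
  move: det0; rewrite dE => e.
  by apply/eqP; rewrite -addr_eq0 -oppr_eq0 -e; apply/eqP; ring.
have [b0|b0] := eqVneq b 0.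
  have a0 : a = 0.
    by move/eqP: bcE; rewrite b0 mul0r eq_sym oppr_eq0 mulf_eq0 orbb => /eqP.
  exists (mk2 0 (-1) 1 0), (- c); split.
  - by rewrite det_mk2; ring.
  - rewrite oppr_eq0; apply: contraNneq nz => c0.
    by rewrite b0 a0 dE a0 c0 oppr0; apply/eqP/mx2P; rewrite !mxE.
  - by rewrite /mE !mk2E b0 a0 dE a0; congr mk2; ring.
(* The first column is X applied to the second basis vector and spans the image of X. *)
exists (mk2 b 0 (- a) b^-1), (b^-1); split.
- by rewrite det_mk2; field.
- by rewrite invr_eq0.
- rewrite /mE !mk2E dE; have -> : c = - (a * a) / b by rewrite -bcE; field.
  by congr mk2; field.
Qed.

Lemma semisimple_conj X : \tr X = 0 -> \det X != 0 ->
  exists g, exists k : K, [/\ \det g = 1, k != 0 & X *m g = k *: (g *m H)].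
Proof.
rewrite [X]mk2_eta; move: (X 0 0) (X 0 1) (X 1 0) (X 1 1) => a b c d.
rewrite tr_mk2 det_mk2 => tr0 nz.
have dE : d = - a by apply/eqP; rewrite -addr_eq0 addrC tr0.
have [b0|b0] := eqVneq b 0.
  have a0 : a != 0 by apply: contraNneq nz => ->; rewrite b0 !mul0r subrr.
  exists (mk2 1 0 (c / (2%:R * a)) 1), a; split=> //; first by rewrite det_mk2; ring.
  have a20 : 2%:R * a != 0 by rewrite mulf_neq0 // pnatr_eq0.
  by rewrite /mH !mk2E b0 dE; congr mk2; field.
have [s ss] : exists s : K, s ^+ 2 = a * a + b * c.
  by exists (sqrtC (a * a + b * c)); rewrite sqrtCK.
have s0 : s != 0.
  apply: contraNneq nz => s0; move: ss; rewrite s0 expr0n /= dE => e.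
  by rewrite mulrN -opprD -e oppr0.
have cE : c = (s ^+ 2 - a * a) / b by rewrite ss; field.
(* The columns are eigenvectors for s and -s, scaled to determinant 1. *)
exists (mk2 b (- (2%:R * s)^-1) (s - a) ((s + a) / (2%:R * s * b))), s; split=> //.
  by rewrite det_mk2; field; rewrite s0 b0.
by rewrite /mH !mk2E cE dE; congr mk2; field; rewrite ?s0 ?b0.
Qed.

Lemma stab_conj g A X (k : K) v : \det g = 1 -> k != 0 -> \tr X = 0 -> \tr A = 0 ->
  X *m g = k *: (g *m A) -> dr r X *m v = 0 -> dr r A *m (r (invmx g) *m v) = 0.
Proof.
move=> g1 k0 trX trA Xg Xv.
have XE : X = k *: (g *m A *m invmx g) by rewrite scalemxAl -Xg mulmxK ?SL_unit.
move: Xv; rewrite XE drZ -scalemxAl => /eqP; rewrite scaler_eq0 (negPf k0) /= => /eqP.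
have {1}-> : v = r g *m (r (invmx g) *m v) by rewrite mulmxA actK // mul1mx.
rewrite mulmxA -dr_conj // -mulmxA => /(congr1 (mulmx (r (invmx g)))).
by rewrite mulmx0 mulmxA actVK // mul1mx.
Qed.

Lemma act_neq0 g v : \det g = 1 -> v != 0 -> r g *m v != 0.
Proof.
move=> g1; apply: contraNneq => gv.
by rewrite -[v]mul1mx -(actVK r g1) -mulmxA gv mulmx0.
Qed.

Lemma nilpotent_stabilizer_translation v M c X : nilp X -> X != 0 -> dr r X *m v = 0 ->
  v != 0 -> stabilizes r v M c -> c = 0.
Proof.
move=> nX X0 Xv v0 st; have [g [k [g1 k0 Xg]]] := nilp_conj nX X0.
have gV := det_invmx g1; case: (nX) => trX _.
apply: (unipotent_stabilizer_translation _ (act_neq0 gV v0) (stabilizes_base gV st)).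
exact: stab_conj k0 trX (trE K) Xg Xv.
Qed.

(** If E or F also kills v, the nilpotent case applies. Otherwise E v and F v have weights 2 and -2,
    so they are independent and the stabilizer is C H. *)
Lemma H_stabilizer_translation v M c : rH *m v = 0 -> v != 0 -> stabilizes r v M c -> c = 0.
Proof.
move=> Hv v0 st.
have E0 : E != 0 by apply/eqP => /matrixP/(_ 0 1)/eqP; rewrite !mxE /= oner_eq0.
have F0 : F != 0 by apply/eqP => /matrixP/(_ 1 0)/eqP; rewrite !mxE /= oner_eq0.
have [Ev|Ev] := eqVneq (rE *m v) 0.
  exact: nilpotent_stabilizer_translation (nilpE K) E0 Ev v0 st.
have [Fv|Fv] := eqVneq (rF *m v) 0.
  exact: nilpotent_stabilizer_translation (nilpF K) F0 Fv v0 st.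
apply: (torus_stabilizer_translation st Hv _ noinv) => A trA.
rewrite {1}(sl2_decompH trA) lin_EFH Hv scaler0 addr0 => Av.
have [_ HE HF] := dr_brackets r.
have HAv := congr1 (mulmx rH) Av.
rewrite mulmx0 mulmxDr -!scalemxAr !(mulmxA rH) HE HF mulmxDl mulmxBl in HAv.
rewrite -!mulmxA Hv !mulmx0 add0r sub0r -!scalemxAl in HAv.
have eEF i : A 0 1 * (rE *m v) i 0 + A 1 0 * (rF *m v) i 0 = 0 /\
    A 0 1 * (2%:R * (rE *m v) i 0) + A 1 0 * - (2%:R * (rF *m v) i 0) = 0.
  split; [move/colP: Av => /(_ i) | move/colP: HAv => /(_ i)];
    by move: (rE *m v) (rF *m v) => x y; rewrite !mxE.
have eE : (2%:R * 2%:R * A 0 1) *: (rE *m v) = 0.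
  apply/colP => i; have [e1 e2] := eEF i; rewrite [LHS]mxE [RHS]mxE.
  move: e1 e2; move: ((rE *m v) i 0) ((rF *m v) i 0) => x y e1 e2.
  transitivity (2%:R * (A 0 1 * x + A 1 0 * y) + (A 0 1 * (2%:R * x) + A 1 0 * - (2%:R * y)));
    first by ring.
  by rewrite e1 e2 mulr0 addr0.
have eF : (2%:R * 2%:R * A 1 0) *: (rF *m v) = 0.
  apply/colP => i; have [e1 e2] := eEF i; rewrite [LHS]mxE [RHS]mxE.
  move: e1 e2; move: ((rE *m v) i 0) ((rF *m v) i 0) => x y e1 e2.
  transitivity (2%:R * (A 0 1 * x + A 1 0 * y) - (A 0 1 * (2%:R * x) + A 1 0 * - (2%:R * y)));
    first by ring.
  by rewrite e1 e2 mulr0 subr0.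
move/eqP: eE; rewrite scaler_eq0 (negPf Ev) orbF !mulf_eq0 pnatr_eq0 /= => /eqP a01.
move/eqP: eF; rewrite scaler_eq0 (negPf Fv) orbF !mulf_eq0 pnatr_eq0 /= => /eqP a10.
by exists (A 0 0); rewrite {1}(sl2_decompH trA) a01 a10 !scale0r !add0r.
Qed.

Lemma stabilizer_translation v M c : stabilizes r v M c -> c = 0.
Proof.
have [->|v0] := eqVneq v 0.
  by case=> _ /(_ 0 (orbit_refl _ _)) [g _]; rewrite !mulmx0 add0r.
move=> st.
(* A nonzero traceless X killing v is nilpotent or diagonalizable according to its determinant,
   which selects the case. *)
have [[X [trX X0 Xv]]|free] := boolp.EM (exists X, [/\ \tr X = 0, X != 0 & dr r X *m v = 0]).
  have [detX|detX] := eqVneq (\det X) 0.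
    exact: (nilpotent_stabilizer_translation (conj trX detX) X0 Xv v0 st).
  have [g [k [g1 k0 Xg]]] := semisimple_conj trX detX; have gV := det_invmx g1.
  apply: (H_stabilizer_translation _ (act_neq0 gV v0) (stabilizes_base gV st)).
  exact: stab_conj k0 trX (trH K) Xg Xv.
apply: (finite_stabilizer_translation st _ noinv) => A trA Av.
by apply/eqP; apply/negP => /negP A0; apply: free; exists A.
Qed.

End Stabilizers.

(** * The given representation in terms of polynomials in four variables *)

Definition mpoly_M2 (d : nat) (c : {ffun ('I_2 * 'I_2) -> 'I_d} -> C) : {mpoly C[2 * 2]} :=
  \sum_(e : {ffun ('I_2 * 'I_2) -> 'I_d}) c e *: \prod_(kl : 'I_2 * 'I_2) gX C kl.1 kl.2 ^+ e kl.

Lemma meval_mpoly_M2 d (c : {ffun ('I_2 * 'I_2) -> 'I_d} -> C) (g : 'M[C]_2) :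
  meval (fun k => mxvec g 0 k) (mpoly_M2 c) = polyfun_M2 c g.
Proof.
rewrite /mpoly_M2 /polyfun_M2 raddf_sum; apply: eq_bigr => e _ /=.
rewrite mevalZ rmorph_prod; congr (_ * _); apply: eq_bigr => kl _.
by rewrite rmorphXn /= mev_gX.
Qed.

Theorem theorem3p14 (n : nat) (rho : 'M[C]_2 -> 'M[C]_n)
  (Hrho : rational_rep_SL2 rho) (Hinv : no_invariants rho)
  (v : 'cV[C]_n) (M : 'M[C]_n) (c : 'cV[C]_n)
  (HM : M \in unitmx) (Hpres : preserves M c (orbit_SL2 rho v)) :
  c = 0.
Proof.
case: Hrho => rho1 rhoM [d [k rhoE]].
pose r : polyrep C n := @PolyRep C n rho (\matrix_(i, j) mpoly_M2 (k i j)) rho1 rhoM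
  (fun g g1 i j => etrans (rhoE g g1 i j)
     (etrans (esym (meval_mpoly_M2 (k i j) g)) (congr1 _ (esym (mxE _ _ i j))))).
apply: (@stabilizer_translation C n r Hinv v M c); split=> // [x xO|y yO].
  by apply/(Hpres (M *m x + c)); exists x.
have [x xO ->] : exists2 x, orbit r v x & y = M *m x + c by apply/(Hpres y).
by rewrite addrK mulKmx.
Qed.
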